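(* Suppose that $q$ is odd and $|n|_2=|q-1|_2$. For a partition $\nu=1^{n_1}2^{n_2}\cdots$ of $n$ let $d=|\gcd(n_1,n_2,\dots)|_2$. Then the number of real conjugacy classes in $PSL_n(q)$ is given by $$\sum_{\nu}h_\nu\, psl_\nu,$$ the sum being over all partitions $\nu$ of $n$, where $psl_\nu$ is as follows. If $4\mid n$ then $$psl_\nu=\begin{cases}\frac12\prod_{n_i>0}n_{q,n_i}, & \text{if } d>1\text{ and there exists } i\text{ odd for which } n_i>0;\\ \frac12 sl_\nu, & \text{otherwise.}\end{cases}$$ If $4\nmid n$ then $$psl_\nu=\begin{cases}\frac12\prod_{n_i>0}n_{q,n_i}, & \text{if } d>1\text{ and there exists } i\text{ odd for which } n_i>0;\\ \frac12 sl_\nu, & \text{if } d=1\text{ and there exists } i\text{ odd for which } n_i>0;\\ 0, & \text{otherwise.}\end{cases}$$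
   Context: An element $g$ of a group $G$ is real if $hgh^{-1}=g^{-1}$ for some $h\in G$; a class is real if its elements are. For a positive integer $k$, $|k|_2$ is the largest power of $2$ dividing $k$. The notation $\nu=1^{n_1}2^{n_2}\cdots$ means the partition with $n_i$ parts equal to $i$. If $\nu$ has parts $\nu_1,\dots,\nu_r$ then $h_\nu=\gcd(q-1,\nu_1,\dots,\nu_r)$. For $q$ odd and $m\ge1$: $n_{q,m}=2q^{(m-1)/2}$ if $m$ is odd; $n_{q,m}=(q+1)q^{m/2-1}$ if $m$ is even. The number $sl_\nu$ is defined by: - $sl_\nu=\prod_{n_i>0}n_{q,n_i}$ if $n_i=0$ for all odd $i$; - $sl_\nu=\frac12\prod_{n_i>0}n_{q,n_i}$ if there exists $i$ with $i n_i$ odd; - $sl_\nu=f_\nu(q)\prod_{i\text{ odd},\,n_i>0}q^{n_i/2-1}\prod_{i\text{ even},\,n_i>0}n_{q,n_i}$ otherwise, where $f_\nu(q)=\frac{(q+1)^r+(q-1)^r}{2}$ and $r$ here is the number of odd $i$ with $n_i>0$. *)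

(* Defs.v *)
From mathcomp Require Import all_boot all_order all_algebra all_fingroup all_solvable.

Set Implicit Arguments.
Unset Strict Implicit.
Unset Printing Implicit Defensive.
Import GRing.Theory.

Section RealClasses.
Local Open Scope group_scope.
Variable gT : finGroupType.
Implicit Types G C : {set gT}.

Definition is_real G (g : gT) : bool :=
  [exists h in G, h * g * h^-1 == g^-1].

Definition real_classes G : {set {set gT}} :=
  [set C in classes G | [forall g in C, is_real G g]].

End RealClasses.

Section ProjectiveSpecialLinear.
Local Open Scope group_scope.
Variables (n : nat) (F : finFieldType).

(* {'GL_n[F]} consists of matrices of size n.-1.+1, so this is SL_n(F) as soon
   as 0 < n. *)
Definition SLgroup : {set {'GL_n[F]}} :=
  [set g | (\det (GLval g) == 1)%R].

Lemma SLgroup_group_set : group_set SLgroup.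
Proof.
apply/group_setP; split=> [|x y]; first by rewrite inE GL_1E det1.
by rewrite !inE GL_ME det_mulmx => /eqP-> /eqP->; rewrite mulr1.
Qed.

Canonical SLgroup_group : {group {'GL_n[F]}} := Group SLgroup_group_set.

Definition PSLgroup : {group coset_of 'Z(SLgroup)} :=
  (SLgroup_group / 'Z(SLgroup))%G.

End ProjectiveSpecialLinear.

Section Partitions.
Local Open Scope nat_scope.

(* The partition 1^{n_1} 2^{n_2} ... of n is encoded by its multiplicity
   function i |-> n_i on {0, ..., n}, with n_0 = 0; all parts and all
   multiplicities are at most n. *)
Definition multiplicities (n : nat) := {ffun 'I_n.+1 -> 'I_n.+1}.

Definition is_partition (n : nat) (nu : multiplicities n) : bool :=
  (nu ord0 == ord0) && (\sum_(i < n.+1) i * nu i == n).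

Variables (n : nat) (q : nat) (nu : multiplicities n).

Definition part_h : nat :=
  gcdn (q - 1) (\big[gcdn/0]_(i < n.+1 | 0 < nu i) (i : nat)).

Definition part_d : nat := (\big[gcdn/0]_(i < n.+1) (nu i : nat))`_2.

Definition has_odd_part : bool := [exists i : 'I_n.+1, odd i && (0 < nu i)].

Definition nqm (m : nat) : nat :=
  if odd m then 2 * q ^ ((m - 1) %/ 2) else (q + 1) * q ^ (m %/ 2 - 1).

Definition prod_nqm : nat := \prod_(i < n.+1 | 0 < nu i) nqm (nu i).

Local Open Scope ring_scope.

Definition f_nu : rat :=
  let r := #|[set i : 'I_n.+1 | odd i && (0 < nu i)%N]| in
  ((q%:R + 1) ^+ r + (q%:R - 1) ^+ r) / 2%:R.

(* In the last case nu i is even and positive for every odd i with 0 < nu i, so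
   that nu i %/ 2 - 1 is the exact exponent. *)
Definition sl : rat :=
  if ~~ has_odd_part then prod_nqm%:R
  else if [exists i : 'I_n.+1, odd (i * nu i)%N] then 2%:R^-1 * prod_nqm%:R
  else f_nu
       * (\prod_(i < n.+1 | odd i && (0 < nu i)%N) q%:R ^+ (nu i %/ 2 - 1)%N)
       * (\prod_(i < n.+1 | ~~ odd i && (0 < nu i)%N) (nqm (nu i))%:R).

Definition psl : rat :=
  if (4 %| n)%N then
    if (1 < part_d)%N && has_odd_part then 2%:R^-1 * prod_nqm%:R
    else 2%:R^-1 * sl
  else
    if (1 < part_d)%N && has_odd_part then 2%:R^-1 * prod_nqm%:R
    else if (part_d == 1)%N && has_odd_part then 2%:R^-1 * sl
    else 0.

End Partitions.

(* Main.v *)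
(* Let G = SL_n(q) and let Z be its center.  Counting the pairs (x, y) of G with
   y x y^-1 in Z x^-1 shows that the number of real classes of G / Z is the
   average over z in Z of the number of classes of elements x of G conjugate in G
   to z x^-1.

   Write x = s (1 + N) / (1 - N), where s has order prime to p and N is a
   nilpotent matrix commuting with s; in this form x |-> x^-1 becomes
   (s, N) |-> (s^-1, - N).  The GL_n-class of x is determined by the Jordan type
   nu of N together with the characteristic polynomials u_i, of degree n_i, of s
   acting on the tops of the Jordan chains of length i.  Then x is conjugate to
   z x^-1 in GL_n iff every u_i is z-self-reciprocal.  The determinants of the
   elements centralizing x are the h_nu-th powers, so that the GL_n-class of x
   splits into h_nu classes of SL_n.  If nu has an odd part, then h_nu is odd, and
   a reversing element can be corrected to have determinant 1; otherwise all the
   reversing elements have determinant (-1)^(n/2) d^h_nu, which differs from 1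
   exactly when n/2 is odd, because -1 is then not a square.

   Finally, each u_i has two possible constant terms, opposite to each other, so
   the condition det x = 1 is a parity condition on signs, counted by averaging a
   product of sums against the sign character.  Half of the scalars z are squares
   in the field and contribute sl_nu; the others occur only when all the n_i are
   even, and contribute the families of the opposite parity. *)

Require Import Defs.
From mathcomp Require Import all_boot all_order all_algebra all_fingroup all_solvable all_field.
From mathcomp Require Import zify ring.

Set Implicit Arguments.
Unset Strict Implicit.
Unset Printing Implicit Defensive.
Import GRing.Theory Num.Theory.
Local Open Scope ring_scope.

(** Counting pairs means that the classes of SL inside a class of GL never have to be listed: the
    splitting number enters only as the index of a group of determinants. The obstacle is that
    Maschke's argument applies only to matrices of order prime to [p], while centralizing and
    reversing elements are arbitrary. Passing to their prime-to-[p] part does not change the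
    determinant, and one decomposition theorem for a nilpotent [N] with [N *m s = e *: (s *m N)]
    then serves every purpose: [e = 1] yields the Jordan type and the determinants of centralizing
    elements, [e = -1] those of reversing elements. The Cayley fraction is preferred to [u - 1]
    because it turns inversion into an exact change of sign, which preserves chain bases. The
    equality of 2-parts says that [n] and [q - 1] become equal after multiplication by odd
    cofactors, so an odd power trades one exponent for the other without losing a sign. This is what
    separates squares from nonsquares among the scalars. *)

Section Maschke.

Variables (F : fieldType) (n : nat) (s : 'M[F]_n) (k : nat).
Hypotheses (k_neq0 : k%:R != 0 :> F) (s_k : s ^+ k = 1).

Lemma stable_exp (U : 'M_n) (f : 'M[F]_n) j : stablemx U f -> (U *m f ^+ j <= U)%MS.
Proof.
move=> Uf; elim: j => [|j IH]; first by rewrite expr0 mulmx1.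
by rewrite exprSr -mulmxE mulmxA (submx_trans _ Uf) // submxMr.
Qed.

Definition avg_proj (U : 'M[F]_n) : 'M[F]_n :=
  k%:R^-1 *: \sum_(j < k) s ^+ j *m proj_mx U (U^C)%MS *m s ^+ (k - j).

Lemma avg_proj_comm U : s *m avg_proj U = avg_proj U *m s.
Proof.
rewrite /avg_proj -scalemxAr -scalemxAl; congr (_ *: _).
rewrite mulmx_sumr mulmx_suml.
case: k s_k => [|m] sm; first by rewrite !big_ord0.
rewrite big_ord_recr [RHS]big_ord_recl /= addrC; congr (_ + _).
  rewrite subSnn expr1 expr0 subn0 sm mul1mx mulmx1.
  by rewrite !mulmxA mulmxE -exprS sm mul1r.
apply: eq_bigr => j _; rewrite /bump /= add1n subSS.
set p := proj_mx _ _; rewrite !mulmxA !mulmxE -exprS -!mulrA -exprSr subSn //.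
by rewrite ltnW.
Qed.

Lemma avg_proj_id (U A : 'M_n) :
  stablemx U s -> (A <= U)%MS -> A *m avg_proj U = A.
Proof.
move=> Us AU; rewrite /avg_proj -scalemxAr mulmx_sumr.
rewrite (eq_bigr (fun=> A)) => [|j _].
  by rewrite sumr_const card_ord -[A *+ k]scaler_nat scalerA mulVf // scale1r.
have AsU: (A *m s ^+ j <= U)%MS by rewrite (submx_trans (submxMr _ AU)) ?stable_exp.
rewrite mulmxA (mulmxA A) proj_mx_id ?capmx_compl //.
by rewrite -mulmxA mulmxE -exprD subnKC ?s_k ?mulr1 // ltnW.
Qed.

Lemma avg_proj_sub (U : 'M_n) : stablemx U s -> (avg_proj U <= U)%MS.
Proof.
move=> Us; rewrite /avg_proj scalemx_sub // summx_sub // => j _.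
by rewrite (submx_trans _ (stable_exp (k - j) Us)) // submxMr // -{1}[s ^+ j]mulmx1 proj_mx_sub.
Qed.

Lemma Maschke1 (U W : 'M_n) : stablemx U s -> stablemx W s -> (U <= W)%MS ->
  {U' : 'M_n | [/\ stablemx U' s, (U + U' == W)%MS & (U :&: U')%MS == 0]}.
Proof.
move=> Us Ws UW; exists (W :&: kermx (avg_proj U))%MS; split.
- rewrite sub_capmx (submx_trans _ Ws) ?submxMr ?capmxSl //=.
  apply/sub_kermxP; rewrite -mulmxA avg_proj_comm mulmxA.
  by rewrite (elimT sub_kermxP (capmxSr _ _)) mul0mx.
- rewrite addsmx_sub UW capmxSl /=.
  have pU : (W *m avg_proj U <= U)%MS by rewrite mulmx_sub ?avg_proj_sub.
  rewrite -{1}[W](subrK (W *m avg_proj U)) addrC addmx_sub_adds // sub_capmx.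
  rewrite addmx_sub //=; last by rewrite eqmx_opp (submx_trans pU).
  by apply/sub_kermxP; rewrite mulmxBl (avg_proj_id Us pU) subrr.
- rewrite -submx0; set A := (_ :&: _)%MS.
  have AU: (A <= U)%MS by rewrite capmxSl.
  rewrite -(avg_proj_id Us AU); have: (A <= kermx (avg_proj U))%MS.
    by rewrite (submx_trans (capmxSr _ _)) // capmxSr.
  by move/sub_kermxP=> ->; rewrite sub0mx.
Qed.

Variables (N : 'M[F]_n) (e : F).
Hypotheses (e_neq0 : e != 0) (NsE : N *m s = e *: (s *m N)).

Lemma Ns_sN : s *m N = e^-1 *: (N *m s).
Proof. by rewrite NsE scalerA mulVf // scale1r. Qed.

Lemma stable_mulN (U : 'M_n) : stablemx U s -> stablemx (U *m N) s.
Proof.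
by move=> Us; rewrite -mulmxA NsE -scalemxAr scalemx_sub // mulmxA submxMr.
Qed.

Lemma stable_preN (U P : 'M_n) : stablemx U s -> stablemx P s ->
  stablemx (U :&: kermx (N *m cokermx P))%MS s.
Proof.
move=> Us Ps; rewrite sub_capmx (submx_trans _ Us) ?submxMr ?capmxSl //=.
set A := (U :&: _)%MS.
have AN : (A *m N <= P)%MS.
  by rewrite submxE -mulmxA -(elimT sub_kermxP (capmxSr _ _ : (A <= _)%MS)).
apply/sub_kermxP; rewrite mulmxA; apply/eqP; rewrite -submxE.
rewrite -mulmxA Ns_sN -scalemxAr scalemx_sub // mulmxA.
by rewrite (submx_trans (submxMr _ AN)).
Qed.

(** Induction on the nilpotency index, through the image [U *m N]: each chain of the image is
    lengthened by one vector at its top, and chains of length 1 are added to fill the kernel. Every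
    choice is an [s]-stable Maschke complement. The rank formula records the directness of the sum
    in a form that the induction can carry. *)
Lemma chain_decomp m (U : 'M_n) : stablemx U s -> stablemx U N -> U *m N ^+ m = 0 ->
  {P : nat -> 'M_n | [/\ forall i, stablemx (P i) s, forall i, P i *m N ^+ i = 0,
    forall i, (P i <= U)%MS,
    (U <= \sum_(i < m.+1) \sum_(j < i) P i *m N ^+ j)%MS &
    forall l, \rank (U *m N ^+ l) = (\sum_(i < m.+1) (i - l) * \rank (P i))%N]}.
Proof.
elim: m U => [|m IH] U Us UN UNm.
  have ->: U = 0 by rewrite -UNm expr0 mulmx1.
  exists (fun=> 0); split=> [i|i|i||l]; rewrite ?mul0mx ?sub0mx //.
  by rewrite mxrank0 big1 // => i _; rewrite muln0.
have VN : stablemx (U *m N) N by rewrite submxMr.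
have Vm : U *m N *m N ^+ m = 0 by rewrite -mulmxA mulmxE -exprS.
have [P' [P's P'N P'V V_P' rkP']] := IH (U *m N) (stable_mulN Us) VN Vm.
pose K := (U :&: kermx N)%MS.
have Ks : stablemx K s.
  rewrite sub_capmx (submx_trans _ Us) ?submxMr ?capmxSl //=.
  apply/sub_kermxP; rewrite -mulmxA Ns_sN -scalemxAr mulmxA.
  by rewrite (elimT sub_kermxP (capmxSr _ _)) mul0mx scaler0.
have KVs : stablemx (K :&: (U *m N))%MS s.
  rewrite sub_capmx.
  rewrite (submx_trans _ Ks) ?submxMr ?capmxSl //=.
  by rewrite (submx_trans _ (stable_mulN Us)) ?submxMr ?capmxSr.
have [Q1 [Q1s Q1K Q10]] := Maschke1 KVs Ks (capmxSl _ _).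
(* [Pre i] is the preimage of [P' i] in [U]; a stable complement [Q i] of the kernel [K] in it is
   mapped isomorphically onto [P' i] by [N]. *)
pose Pre i := (U :&: kermx (N *m cokermx (P' i)))%MS.
have KPre i : (K <= Pre i)%MS.
  rewrite sub_capmx capmxSl /=; apply/sub_kermxP.
  by rewrite mulmxA (elimT sub_kermxP (capmxSr _ _)) mul0mx.
have QP i := Maschke1 Ks (stable_preN Us (P's i)) (KPre i).
pose Q i := sval (QP i).
have Qs i : stablemx (Q i) s by rewrite /Q; case: (QP i) => /= ? [].
have QPre i : (K + Q i == Pre i)%MS by rewrite /Q; case: (QP i) => /= ? [].
have Q0 i : (K :&: Q i)%MS = 0 by rewrite /Q; case: (QP i) => /= ? [_ _ /eqP].
have QU i : (Q i <= U)%MS.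
  by rewrite (submx_trans (addsmxSr K _)) // (eqmxP (QPre i)) capmxSl.
have KN : K *m N = 0 by apply/sub_kermxP; rewrite capmxSr.
have QN i : (Q i *m N :=: P' i)%MS.
  apply/eqmxP/andP; split.
    have : (Q i <= Pre i)%MS by rewrite -(eqmxP (QPre i)) addsmxSr.
    rewrite sub_capmx => /andP[_ /sub_kermxP].
    by rewrite mulmxA => /eqP; rewrite -submxE.
  have /submxP[D P'E] := P'V i.
  have : (D *m U <= K + Q i)%MS.
    rewrite (eqmxP (QPre i)) sub_capmx submxMl; apply/sub_kermxP.
    by rewrite mulmxA -[D *m U *m N]mulmxA -P'E mulmx_coker.
  move/(submxMr N); rewrite -mulmxA -P'E => /submx_trans-> //.
  by rewrite addsmxMr KN adds0mx.
have rkQ i : \rank (Q i) = \rank (P' i).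
  rewrite -(QN i) -(mxrank_mul_ker (Q i) N).
  suff -> : (Q i :&: kermx N)%MS = 0 by rewrite mxrank0 addn0.
  apply/eqP; rewrite -submx0 -(Q0 i) sub_capmx capmxSl andbT sub_capmx capmxSr andbT.
  by rewrite (submx_trans (capmxSl _ _)).
(* Chains of length [i] in the image become chains of length [i.+1], and [Q1] supplies the new
   chains of length 1. Nothing is lost by dropping [Q 0], since [P' 0 = 0]. *)
pose P i := if i is i1.+1 then (if i1 is i2.+1 then Q i1 else Q1) else 0.
have Q1U : (Q1 <= U)%MS.
  by rewrite (submx_trans (addsmxSr (K :&: U *m N)%MS _)) // (eqmxP Q1K) capmxSl.
have Q1N : Q1 *m N = 0.
  have : (Q1 <= K)%MS by rewrite -(eqmxP Q1K) addsmxSr.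
  by move/(submxMr N); rewrite KN submx0 => /eqP.
have PN i : P i *m N ^+ i = 0.
  case: i => [|[|i]] /=; rewrite ?mul0mx ?expr1 //.
  apply/eqP; rewrite -submx0 exprS -mulmxE mulmxA.
  by rewrite (submx_trans (submxMr _ (_ : _ <= P' i.+1)%MS)) ?QN ?P'N.
have PU i : (P i <= U)%MS by case: i => [|[|i]] /=; rewrite ?sub0mx.
exists P; split=> //.
- by case=> [|[|i]] //=; rewrite mul0mx sub0mx.
- set S := (\sum_(i < m.+2) _)%MS.
  have SP i j : (i < m.+2)%N -> (j < i)%N -> (P i *m N ^+ j <= S)%MS.
    move=> im ji; rewrite /S.
    by rewrite (sumsmx_sup (Ordinal im)) // (sumsmx_sup (Ordinal ji)).
  have SU : (S <= U)%MS.
    apply/sumsmx_subP=> i _; apply/sumsmx_subP => j _.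
    by rewrite (submx_trans (submxMr _ (PU i))) ?stable_exp.
  have PPN i j : (0 < i)%N -> (P' i *m N ^+ j :=: P i.+1 *m N ^+ j *m N)%MS.
    case: i => // i _ /=.
    have -> : Q i.+1 *m N ^+ j *m N = Q i.+1 *m N *m N ^+ j.
      by rewrite -!mulmxA !mulmxE -exprSr -exprS.
    by apply: eqmx_sym; apply: eqmxMr; apply: QN.
  have VS : (U *m N <= S *m N)%MS.
    apply: (submx_trans V_P'); apply/sumsmx_subP=> i _; apply/sumsmx_subP => j _.
    have i0 : (0 < i)%N by exact: leq_ltn_trans (leq0n j) (ltn_ord j).
    rewrite (PPN _ _ i0) submxMr //; apply: SP; [exact: (ltn_ord i) | exact: leqW].
  have VS' : (U *m N <= S)%MS.
    apply: (submx_trans V_P'); apply/sumsmx_subP=> i _; apply/sumsmx_subP => j _.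
    have i0 : (0 < i)%N by exact: leq_ltn_trans (leq0n j) (ltn_ord j).
    by rewrite (PPN _ _ i0) -mulmxA mulmxE -exprSr; apply: SP; [exact: (ltn_ord i)|rewrite ltnS].
  have KS : (K <= S)%MS.
    rewrite -(eqmxP Q1K) addsmx_sub (submx_trans (capmxSr _ _)) //=.
    by have := SP 1%N 0%N isT isT; rewrite expr0 mulmx1.
  (* [U] and [D *m S] have the same image under [N], so they differ by rows of [K], already known to
     lie in [S]. *)
  case/submxP: VS => D; rewrite mulmxA => DE.
  rewrite -[U](subrK (D *m S)) addmx_sub ?submxMl // (submx_trans _ KS) //.
  rewrite sub_capmx addmx_sub ?eqmx_opp ?mulmx_sub //=.
  by apply/sub_kermxP; rewrite mulmxBl -DE subrr.
- have rkU l : \rank (U *m N ^+ l.+1) = (\sum_(i < m.+2) (i - l.+1) * \rank (P i))%N.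
    rewrite exprS -mulmxE mulmxA rkP' [RHS]big_ord_recl mul0n add0n.
    apply: eq_bigr => i _; rewrite lift0 /= subSS.
    by case: (nat_of_ord i) => [|i'] //=; rewrite ?sub0n ?mul0n // rkQ.
  (* For [U] itself, rank and nullity are applied to [U] and to [U *m N]; what remains is the second
     difference identity [(i + 2) + i = 2 * (i + 1)], weighted by ranks. *)
  case=> [|l]; last exact: rkU.
  rewrite expr0 mulmx1 -(mxrank_mul_ker U N) -/K.
  have rkK : \rank K = (\rank (K :&: (U *m N))%MS + \rank Q1)%N.
    by rewrite -(eqmxP Q1K) mxrank_disjoint_sum //; apply/eqP.
  have := mxrank_mul_ker (U *m N) N.
  have -> : \rank (U *m N :&: kermx N)%MS = \rank (K :&: (U *m N))%MS.
    apply: eqmx_rank; apply/andP; split.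
      by rewrite !sub_capmx capmxSr capmxSl (submx_trans (capmxSl _ _)).
    by rewrite sub_capmx capmxSr (submx_trans (capmxSl _ _)) // capmxSr.
  have := rkU 0%N; have := rkU 1%N.
  rewrite expr1 expr2 -mulmxE mulmxA => -> -> E.
  rewrite rkK; move: E; rewrite !big_ord_recl /= !mul0n !mul1n !add0n.
  set s1 := (\sum_(i < m) _)%N; set s2 := (\sum_(i < m) (_ - 1) * _)%N.
  set s3 := (\sum_(i < m) _)%N.
  move=> E.
  suff H : (s3 + s1 = s2 + s2)%N by move: H E; clearbody s1 s2 s3; clear; lia.
  rewrite -!big_split; apply: eq_bigr => i _ /=; rewrite /bump /=.
  by move: (\rank _) => r; clear; lia.
Qed.

End Maschke.

(** * Determinants and characteristic polynomials of block matrices and under a change of basis *)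

Lemma det_castmx (R : comNzRingType) m n (e e' : m = n) (A : 'M[R]_m) :
  \det (castmx (e, e') A) = \det A.
Proof. by rewrite (eq_irrelevance e' e); case: n / e e' => e'; rewrite castmx_id. Qed.

Lemma det_mx_size0 (R : comNzRingType) n (A : 'M[R]_n) : n = 0 -> \det A = 1.
Proof. by move=> n0; move: A; rewrite n0 => A; apply: det_mx00. Qed.

Lemma char_poly_castmx (R : comNzRingType) m n (e e' : m = n) (A : 'M[R]_m) :
  char_poly (castmx (e, e') A) = char_poly A.
Proof. by rewrite (eq_irrelevance e' e); case: n / e e' => e'; rewrite castmx_id. Qed.

Lemma det_mxdiag (R : comNzRingType) p (p_ : 'I_p -> nat) (B : forall i, 'M[R]_(p_ i)) :
  \det (\mxdiag_i B i) = \prod_i \det (B i).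
Proof.
elim: p p_ B => [|p IH] p_ B; first by rewrite [RHS]big_ord0; apply: det_mx_size0; rewrite big_ord0.
by rewrite mxdiag_recl det_castmx det_ublock IH big_ord_recl.
Qed.

Lemma char_poly_block_diag (R : comNzRingType) m n (A : 'M[R]_m) (B : 'M[R]_n) :
  char_poly (block_mx A 0 0 B) = char_poly A * char_poly B.
Proof. by rewrite /char_poly char_block_diag_mx det_ublock. Qed.

Lemma char_poly_mxdiag (R : comNzRingType) p (p_ : 'I_p -> nat) (B : forall i, 'M[R]_(p_ i)) :
  char_poly (\mxdiag_i B i) = \prod_i char_poly (B i).
Proof.
elim: p p_ B => [|p IH] p_ B; first by rewrite [RHS]big_ord0; apply: det_mx_size0; rewrite big_ord0.
by rewrite mxdiag_recl char_poly_castmx char_poly_block_diag IH big_ord_recl.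
Qed.

Lemma det_exp (R : comNzRingType) n (A : 'M[R]_n.+1) m : \det (A ^+ m) = \det A ^+ m.
Proof. by elim: m => [|m IH]; rewrite ?det1 // !exprS det_mulmx IH. Qed.

Section Transfer.

Variables (F : fieldType).

Lemma det_transfer n r (R : 'M[F]_(r, n)) (x : 'M_n) (D : 'M_r) :
  r = n -> row_full R -> R *m x = D *m R -> \det x = \det D.
Proof.
move=> rn; case: n / rn R x => R x; rewrite row_full_unit => uR RxDR.
apply: (mulfI (_ : \det R != 0)); first by rewrite -unitfE -unitmxE.
by rewrite -det_mulmx RxDR det_mulmx mulrC.
Qed.

Lemma char_poly_transfer n r (R : 'M[F]_(r, n)) (x : 'M_n) (D : 'M_r) :
  r = n -> row_full R -> R *m x = D *m R -> char_poly x = char_poly D.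
Proof.
move=> rn; case: n / rn R x => R x; rewrite row_full_unit => uR RxDR.
have uR' : \det (map_mx (@polyC F) R) != 0.
  by rewrite det_map_mx polyC_eq0 -unitfE -unitmxE.
apply: (mulfI uR'); rewrite [RHS]mulrC /char_poly -!det_mulmx /char_poly_mx.
by rewrite mulmxBr mulmxBl -!map_mxM RxDR scalar_mxC.
Qed.

Lemma char_poly_rowspace n r r' (R : 'M[F]_(r, n)) (R' : 'M[F]_(r', n)) (x : 'M_n)
    (D : 'M_r) (D' : 'M_r') :
  row_free R -> row_free R' -> (R :=: R')%MS -> R *m x = D *m R -> R' *m x = D' *m R' ->
  char_poly D = char_poly D'.
Proof.
move=> /eqP rkR /eqP rkR' RR'; have rr' : r = r' by rewrite -rkR -rkR' RR'.
case: r' / rr' R' rkR' RR' D' => R' rkR' RR' D' RxD RxD'.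
have /submxP[C RC] : (R <= R')%MS by rewrite RR'.
have fR' : row_free R' by apply/eqP.
have fC : row_full C.
  rewrite row_full_unit -row_free_unit /row_free eqn_leq rank_leq_row.
  by rewrite -{1}rkR RC mxrankM_maxl.
symmetry; apply: (char_poly_transfer erefl fC).
by apply: (row_free_inj fR'); rewrite -!mulmxA -RxD' -RC -RxD mulmxA -RC.
Qed.

End Transfer.

(** * Jordan chains *)

Section ChainColumns.

Variables (F : fieldType) (m : nat) (nu : 'I_m -> nat).

(* chain_col k stacks the blocks Y i j with k <= j < i; for the Jordan chains of N
   these rows form a basis of the image of N ^+ k. *)
Definition chain_size k := (\sum_(i < m) \sum_(j < i - k) nu i)%N.

Definition chain_col n k (Y : forall i, nat -> 'M[F]_(nu i, n)) : 'M_(chain_size k, n) :=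
  \mxcol_(i < m) \mxcol_(j < i - k) Y i (j + k)%N.

Definition chain_diag k (X : forall i, nat -> 'M[F]_(nu i)) : 'M_(chain_size k) :=
  \mxdiag_(i < m) \mxdiag_(j < i - k) X i (j + k)%N.

Lemma chain_sizeE k : chain_size k = (\sum_(i < m) (i - k) * nu i)%N.
Proof. by apply: eq_bigr => i _; rewrite sum_nat_const card_ord. Qed.

Lemma chain_col_mul n p k Y (A : 'M_(n, p)) :
  chain_col k Y *m A = chain_col k (fun i j => Y i j *m A).
Proof. by rewrite /chain_col mxcol_mul; apply: eq_mxcol => i; rewrite mxcol_mul. Qed.

Lemma chain_diag_col n k X (Y : forall i, nat -> 'M[F]_(nu i, n)) :
  chain_diag k X *m chain_col k Y = chain_col k (fun i j => X i j *m Y i j).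
Proof.
by rewrite /chain_col /chain_diag mul_mxdiag_mxcol; apply: eq_mxcol => i; rewrite mul_mxdiag_mxcol.
Qed.

Lemma eq_chain_col n k (Y Y' : forall i, nat -> 'M[F]_(nu i, n)) :
  (forall (i : 'I_m) j, (k <= j < i)%N -> Y i j = Y' i j) <-> chain_col k Y = chain_col k Y'.
Proof.
split=> [YY'|]; last first.
  rewrite /chain_col => /(eq_mxcolP (fun i =>
    \mxcol_(j < i - k) Y i (j + k)%N)) YY' i j /andP[kj ji].
  have jk : (j - k < i - k)%N by lia.
  by have /(eq_mxcolP (fun j : 'I_(i - k) => Y i (j + k)%N))/(_ (Ordinal jk)) := YY' i;
    rewrite /= subnK.
by apply: eq_mxcol => i; apply: eq_mxcol => j; apply: YY'; have := ltn_ord j; lia.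
Qed.

(** Indices outside the chain receive 0, so that blocks can be addressed by plain natural
    numbers. *)
Definition chain_block n k (M : 'M[F]_(chain_size k, n)) i (j : nat) : 'M_(nu i, n) :=
  if insub (j - k)%N is Some j' then submxcol (submxcol M i) j' else 0.

Lemma chain_blockK n k (M : 'M_(chain_size k, n)) : chain_col k (chain_block M) = M.
Proof.
rewrite /chain_col -[RHS]submxcolK; apply: eq_mxcol => i.
rewrite -[RHS]submxcolK; apply: eq_mxcol => j.
by rewrite /chain_block addnK; case: insubP => [j' _ /val_inj-> //|]; rewrite ltn_ord.
Qed.

Lemma det_chain_diag k X : \det (chain_diag k X) =
  \prod_(i < m) \prod_(j < i - k) \det (X i (j + k)%N).
Proof. by rewrite det_mxdiag; apply: eq_bigr => i _; rewrite det_mxdiag. Qed.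

Lemma char_poly_chain_diag k (S : forall i, 'M[F]_(nu i)) :
  char_poly (chain_diag k (fun i _ => S i)) = \prod_(i < m) char_poly (S i) ^+ (i - k).
Proof.
rewrite char_poly_mxdiag; apply: eq_bigr => i _.
by rewrite char_poly_mxdiag prodr_const card_ord.
Qed.

Lemma chain_col_sub n k (Y : forall i, nat -> 'M[F]_(nu i, n)) p (W : 'M_(p, n)) :
  reflect (forall (i : 'I_m) j, (k <= j < i)%N -> (Y i j <= W)%MS) (chain_col k Y <= W)%MS.
Proof.
apply: (iffP idP) => [/submxP[D YD] i j kji|YW].
  move: YD; rewrite -(chain_blockK D) chain_col_mul => /eq_chain_col/(_ i j kji) ->.
  exact: submxMl.
apply/submxP; exists (chain_col k (fun i j => Y i j *m pinvmx W)).
by rewrite chain_col_mul; apply/eq_chain_col => i j kji; rewrite mulmxKpV ?YW.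
Qed.

End ChainColumns.

Section Semisimple.

Variable F : fieldType.

(* For a finite field of characteristic p, the matrices of multiplicative order prime to p. *)
Definition pprime_mx n (s : 'M[F]_n) := exists2 k, k%:R != 0 :> F & s ^+ k = 1.

Lemma exp_intertwine r n (E : 'M[F]_(r, n)) (s : 'M_n) (S : 'M_r) k :
  E *m s = S *m E -> E *m s ^+ k = S ^+ k *m E.
Proof.
move=> EsSE; elim: k => [|k IH]; first by rewrite !expr0 mulmx1 mul1mx.
by rewrite exprSr -mulmxE mulmxA IH -mulmxA EsSE mulmxA mulmxE -exprSr.
Qed.

Lemma pprime_restrict r n (E : 'M[F]_(r, n)) (s : 'M_n) (S : 'M_r) k :
  row_free E -> E *m s = S *m E -> s ^+ k = 1 -> S ^+ k = 1.
Proof.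
move=> fE EsSE sk; apply: (row_free_inj fE); rewrite -(exp_intertwine k EsSE) sk.
by rewrite mulmx1 mul1mx.
Qed.

Lemma pprime_unit n (s : 'M[F]_n) : pprime_mx s -> s \in unitmx.
Proof.
case=> [[|k]] k0 sk; first by rewrite eqxx in k0.
by have /mulmx1_unit[] : s *m s ^+ k = 1%:M by rewrite mulmxE -exprS sk.
Qed.

(** Chain decomposition with [s = 1]: a nonzero chain longer than [n] would need more than [n]
    dimensions. *)
Lemma nilpotent_dim n (N : 'M[F]_n) M : N ^+ M = 0 -> N ^+ n = 0.
Proof.
move=> NM.
have Ns : N *m 1 = 1 *: (1 *m N) by rewrite scale1r mul1mx mulmx1.
have i1 : 1%:R != 0 :> F by rewrite oner_eq0.
have := @chain_decomp F n 1 1 i1 (expr1 _) N 1 (oner_neq0 _) Ns M 1%:M.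
case; rewrite ?submx1 ?mul1mx // => P [_ _ _ _ rkP].
apply/eqP; rewrite -mxrank_eq0 -[N ^+ n]mul1mx rkP.
have := rkP 0%N; rewrite expr0 mulmx1 mxrank1 => nE.
rewrite sum_nat_eq0; apply/forallP => i; apply/implyP => _.
rewrite muln_eq0 subn_eq0; case: leqP => //= ni.
case: (posnP (\rank (P i))) => // r0.
have : ((i - 0) * \rank (P i) <= n)%N by rewrite [leqRHS]nE (bigD1 i) //= leq_addr.
rewrite subn0; nia.
Qed.

End Semisimple.

Section ChainBasis.

Variables (F : fieldType) (n : nat) (nu : 'I_n.+1 -> nat).
Implicit Types (N x : 'M[F]_n) (E : forall i, 'M[F]_(nu i, n)).

Definition chains N E (i : 'I_n.+1) (j : nat) := E i *m N ^+ j.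

(** Spanning together with the dimension count amounts to being a basis. Chains of length 0 have no
    rows, which leaves [nu ord0] undetermined; hence the uniqueness statements are restricted to
    [0 < i]. *)
Record chain_basis N E : Prop := ChainBasis {
  chain_nil : forall i, E i *m N ^+ i = 0;
  chain_full : row_full (chain_col 0 (chains N E));
  chain_dim : (\sum_(i < n.+1) i * nu i = n)%N }.

Lemma chain_dim' N E : chain_basis N E -> chain_size nu 0 = n.
Proof.
by case=> _ _ dim; rewrite chain_sizeE -[RHS]dim; apply: eq_bigr => i _; rewrite subn0.
Qed.

Lemma chain_free N E : chain_basis N E -> row_free (chain_col 0 (chains N E)).
Proof. by move=> cE; rewrite /row_free [eqbRHS](chain_dim' cE); exact: chain_full. Qed.

Lemma chain_ext N E p (Y : forall i, nat -> 'M[F]_(nu i, p)) : chain_basis N E ->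
  exists A : 'M_(n, p), forall (i : 'I_n.+1) j, (j < i)%N -> E i *m N ^+ j *m A = Y i j.
Proof.
move=> cE; exists (pinvmx (chain_col 0 (chains N E)) *m chain_col 0 Y) => i j ji.
have : chain_col 0 (chains N E) *m (pinvmx (chain_col 0 (chains N E)) *m chain_col 0 Y) =
  chain_col 0 Y.
  by rewrite mulmxA mulmxVp ?mul1mx ?chain_free.
by rewrite {1}chain_col_mul => /eq_chain_col/(_ i j ji).
Qed.

Lemma chain_eq N E p (A B : 'M_(n, p)) : chain_basis N E ->
  (forall (i : 'I_n.+1) j, (j < i)%N -> E i *m N ^+ j *m A = E i *m N ^+ j *m B) -> A = B.
Proof.
move=> cE AB; apply: (row_full_inj (chain_full cE)).
by rewrite !chain_col_mul; apply/eq_chain_col => i j /andP[_]; apply: AB.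
Qed.

Lemma chain_det N E x (X : forall i, nat -> 'M[F]_(nu i)) : chain_basis N E ->
  (forall (i : 'I_n.+1) j, (j < i)%N -> E i *m N ^+ j *m x = X i j *m (E i *m N ^+ j)) ->
  \det x = \prod_(i < n.+1) \prod_(j < i) \det (X i j).
Proof.
move=> cE EX.
have RxDR : chain_col 0 (chains N E) *m x = chain_diag 0 X *m chain_col 0 (chains N E).
  by rewrite chain_diag_col chain_col_mul; apply/eq_chain_col => i j /andP[_ /EX].
rewrite (det_transfer (chain_dim' cE) (chain_full cE) RxDR) det_chain_diag.
apply: eq_bigr => i _; rewrite subn0.
by apply: eq_bigr => j _; rewrite addn0.
Qed.

Lemma chain_sub_free N E k : chain_basis N E -> row_free (chain_col k (chains N E)).
Proof.
move=> cE.
have [A EA] := chain_ext (fun (i : 'I_n.+1) j =>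
  if (k <= j)%N then @chain_block F n.+1 nu _ k 1%:M i j else 0) cE.
apply/row_freeP; exists A.
rewrite chain_col_mul -[RHS](chain_blockK (m := n.+1) (nu := nu));
  apply/eq_chain_col => i j /andP[kj ji].
by rewrite /chains EA // kj.
Qed.

Lemma chain_image N E k : chain_basis N E -> (chain_col k (chains N E) :=: N ^+ k)%MS.
Proof.
move=> cE; apply/eqmxP/andP; split.
  apply/chain_col_sub => i j /andP[kj _].
  by rewrite /chains -(subnK kj) exprD -mulmxE mulmxA submxMl.
have /(submxMr (N ^+ k)) : (1%:M <= chain_col 0 (chains N E))%MS.
  by rewrite sub1mx chain_full.
rewrite mul1mx => /submx_trans-> //; rewrite chain_col_mul; apply/chain_col_sub => i j /andP[_ ji].
rewrite /chains -mulmxA mulmxE -exprD.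
case: (leqP i (j + k)) => [ijk|jki].
  by rewrite -(subnKC ijk) exprD -mulmxE mulmxA chain_nil // mul0mx sub0mx.
have /chain_col_sub := submx_refl (chain_col k (chains N E)).
by apply; rewrite leq_addl.
Qed.

Lemma chains_comm N E s (S : forall i, 'M[F]_(nu i)) e : N *m s = e *: (s *m N) ->
  (forall i, E i *m s = S i *m E i) ->
  forall (i : 'I_n.+1) j, E i *m N ^+ j *m s = (e ^+ j *: S i) *m (E i *m N ^+ j).
Proof.
move=> NsE Es i j.
have -> : E i *m N ^+ j *m s = e ^+ j *: (E i *m s *m N ^+ j).
  rewrite -!mulmxA scalemxAr; congr (_ *m _).
  elim: j => [|j IH]; first by rewrite !expr0 scale1r mul1mx mulmx1.
  rewrite {1}exprSr -mulmxE -(mulmxA _ N s) NsE -scalemxAr (mulmxA _ s N) IH.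
  by rewrite -scalemxAl scalerA -exprS -mulmxA mulmxE -exprSr.
by rewrite Es -scalemxAl mulmxA.
Qed.

End ChainBasis.

(** Downward induction on [i]: with [k = i.-1] the smaller indices have exponent 0, [u i] has
    exponent 1, and the larger factors already agree and cancel. *)
Lemma prod_exp_inj (R : idomainType) m (u v : 'I_m -> R) :
  (forall i, u i != 0) ->
  (forall k, \prod_(i < m) u i ^+ (i - k) = \prod_(i < m) v i ^+ (i - k)) ->
  forall i : 'I_m, (0 < i)%N -> u i = v i.
Proof.
move=> u0 uv.
suff H d (i : 'I_m) : (m - i <= d)%N -> (0 < i)%N -> u i = v i by move=> i; apply: (H (m - i)%N).
elim: d i => [|d IH] i; first by have := ltn_ord i; lia.
move=> mid i0; have := uv i.-1; rewrite (bigD1 i) //= [RHS](bigD1 i) //=.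
have -> : (i - i.-1 = 1)%N by lia.
rewrite !expr1.
have <- : \prod_(j < m | j != i) u j ^+ (j - i.-1) = \prod_(j < m | j != i) v j ^+ (j - i.-1).
  apply: eq_bigr => j ji; case: (ltngtP i j) => [ij|ij|/val_inj ij].
  - by rewrite IH //; have := ltn_ord j; lia.
  - by have -> : (j - i.-1 = 0)%N by lia.
  - by rewrite ij eqxx in ji.
by apply: mulIf; apply/prodf_neq0 => j _; rewrite expf_neq0.
Qed.

Section ChainUnique.

Variables (F : fieldType) (n : nat).

(* On the image of N ^+ k, s has the characteristic polynomial
   \prod_i char_poly (S i) ^+ (i - k). *)
Lemma chain_unique (N s : 'M[F]_n) nu E S nu' E' S' :
  N *m s = s *m N ->
  @chain_basis F n nu N E -> (forall i, E i *m s = S i *m E i) ->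
  @chain_basis F n nu' N E' -> (forall i, E' i *m s = S' i *m E' i) ->
  forall i : 'I_n.+1, (0 < i)%N -> char_poly (S i) = char_poly (S' i).
Proof.
move=> Ns cE Es cE' Es'; apply: prod_exp_inj => [i|k].
  by rewrite monic_neq0 ?char_poly_monic.
rewrite -!char_poly_chain_diag.
have Ns1 : N *m s = 1 *: (s *m N) by rewrite scale1r.
apply: (char_poly_rowspace (chain_sub_free k cE) (chain_sub_free k cE') (x := s)).
- by apply: (eqmx_trans (chain_image k cE)); apply/eqmx_sym/chain_image.
- rewrite chain_diag_col chain_col_mul; apply/eq_chain_col => i j _.
  by rewrite /chains (chains_comm Ns1 Es) expr1n scale1r.
- rewrite chain_diag_col chain_col_mul; apply/eq_chain_col => i j _.
  by rewrite /chains (chains_comm Ns1 Es') expr1n scale1r.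
Qed.

Lemma chain_exists (N s : 'M[F]_n) k e M :
  k%:R != 0 :> F -> s ^+ k = 1 -> e != 0 -> N *m s = e *: (s *m N) -> N ^+ M = 0 ->
  exists (nu : 'I_n.+1 -> nat) (E : forall i, 'M_(nu i, n)) (S : forall i, 'M_(nu i)),
   [/\ chain_basis N E, nu ord0 = 0%N, forall i, E i *m s = S i *m E i &
       forall i, S i ^+ k = 1].
Proof.
move=> k0 sk e0 NsE /nilpotent_dim Nn.
have := @chain_decomp F n s k k0 sk N e e0 NsE n 1%:M.
case; rewrite ?submx1 ?mul1mx // => P [Ps PN _ P1 rkP].
exists (fun i => \rank (P i)), (fun i => row_base (P i)).
exists (fun i => conjmx (row_base (P i)) s).
have Es i : row_base (P i) *m s = conjmx (row_base (P i)) s *m row_base (P i).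
  by rewrite /conjmx mulmxKpV // stablemx_row_base.
split=> //.
- split.
  + move=> i; apply/eqP; rewrite -submx0 (submx_trans (submxMr _ (_ : _ <= P i)%MS)) ?PN //.
    by rewrite eq_row_base.
  + rewrite -sub1mx (submx_trans P1) //; apply/sumsmx_subP=> i _; apply/sumsmx_subP => j _.
    have /chain_col_sub/(_ i j) :=
      submx_refl (chain_col 0 (chains N (fun i : 'I_n.+1 => row_base (P i)))).
    rewrite ltn_ord => /(_ isT) /(submx_trans _)-> //.
    by rewrite /chains submxMr // eq_row_base.
  + have := rkP 0%N; rewrite expr0 mulmx1 mxrank1 => /esym rk; apply: etrans rk.
    by apply: eq_bigr => i _; rewrite subn0.
- by have := PN 0%N; rewrite expr0 mulmx1 /= => ->; rewrite mxrank0.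
- by move=> i; apply: (pprime_restrict (row_base_free _) (Es i) sk).
Qed.

(** The matrix carrying one chain basis to the other intertwines both pairs, because they act on
    their bases by the same formulas. *)
Lemma chain_conj (N N' s s' : 'M[F]_n) nu E E' (S : forall i, 'M[F]_(nu i)) :
  chain_basis N E -> chain_basis N' E' ->
  N *m s = s *m N -> N' *m s' = s' *m N' ->
  (forall i, E i *m s = S i *m E i) -> (forall i, E' i *m s' = S i *m E' i) ->
  exists2 x : 'M_n, x \in unitmx & s *m x = x *m s' /\ N *m x = x *m N'.
Proof.
move=> cE cE' Ns Ns' Es Es'.
have [x Ex] := chain_ext (chains N' E') cE.
have Ns1 : N *m s = 1 *: (s *m N) by rewrite scale1r.
have Ns1' : N' *m s' = 1 *: (s' *m N') by rewrite scale1r.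
exists x.
  rewrite -row_full_unit -sub1mx (submx_trans (_ : _ <= chain_col 0 (chains N' E'))%MS) //.
    by rewrite sub1mx chain_full.
  apply/chain_col_sub => i j /andP[_ ji]; rewrite -Ex //; exact: submxMl.
split; apply: (chain_eq cE) => i j ji.
- rewrite [LHS]mulmxA (chains_comm Ns1 Es) -(mulmxA _ _ x) [RHS]mulmxA Ex //.
  by rewrite /chains (chains_comm Ns1' Es').
- rewrite [RHS]mulmxA [LHS]mulmxA Ex // -(mulmxA (E i)) mulmxE -exprSr.
  case: (ltngtP j.+1 i) => [ji1|ij|ij].
  + by rewrite Ex // /chains -mulmxA mulmxE -exprSr.
  + by rewrite ltnNge ji in ij.
  + by rewrite ij chain_nil // mul0mx /chains -mulmxA mulmxE -exprSr ij chain_nil.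
Qed.

End ChainUnique.

Lemma row_full_cast1 (F : fieldType) r n (e : r = n) :
  row_full (castmx (erefl r, e) (1%:M : 'M[F]_r)).
Proof. by case: n / e; rewrite castmx_id row_full_unit unitmx1. Qed.

Section ChainStandard.

Variables (F : fieldType) (n : nat) (nu : 'I_n.+1 -> nat) (S : forall i, 'M[F]_(nu i)).

(** The rows of the identity, cut into blocks, are declared to be the chains; [N] is the shift along
    them and [s] acts by [S i] at every level. *)
Lemma chain_std k : (\sum_(i < n.+1) i * nu i = n)%N -> (forall i, S i ^+ k = 1) ->
  exists (N s : 'M[F]_n) (E : forall i, 'M_(nu i, n)),
   [/\ chain_basis N E, N *m s = s *m N, forall i, E i *m s = S i *m E i,
       N ^+ n = 0 & s ^+ k = 1].
Proof.
move=> dim Sk.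
have rn : chain_size nu 0 = n.
  by rewrite chain_sizeE -[RHS]dim; apply: eq_bigr => i _; rewrite subn0.
pose I0 : 'M[F]_(chain_size nu 0, n) := castmx (erefl _, rn) 1%:M.
have I0full : row_full I0 by apply: row_full_cast1.
have I0free : row_free I0 by rewrite /row_free [eqbRHS]rn.
pose e := chain_block I0.
have eE (Y : forall i : 'I_n.+1, nat -> 'M[F]_(nu i, n)) :
  exists A, forall (i : 'I_n.+1) j, (j < i)%N -> e i j *m A = Y i j.
  exists (pinvmx I0 *m chain_col 0 Y) => i j ji.
  have : I0 *m (pinvmx I0 *m chain_col 0 Y) = chain_col 0 Y by rewrite mulmxA mulmxVp ?mul1mx.
  by rewrite -{1}(chain_blockK I0) chain_col_mul => /eq_chain_col/(_ i j ji).
have [s es] := eE (fun i j => S i *m e i j).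
have [N eN] := eE (fun (i : 'I_n.+1) j => if (j.+1 < i)%N then e i j.+1 else 0).
pose E (i : 'I_n.+1) := if (0 < i)%N then e i 0%N else 0.
have EN (i : 'I_n.+1) j : (j < i)%N -> E i *m N ^+ j = e i j.
  elim: j => [|j IH] ji; first by rewrite expr0 mulmx1 /E ji.
  by rewrite exprSr -mulmxE mulmxA IH ?eN ?ji // ltnW.
have cE : chain_basis N E.
  split=> // [i|].
    case: (posnP i) => [i0|i0]; first by rewrite /E i0 ltnn mul0mx.
    rewrite -(prednK i0) exprSr -mulmxE mulmxA EN ?prednK ?eN ?prednK ?ltnn //; lia.
  suff -> : chain_col 0 (chains N E) = I0 by [].
  by rewrite -[RHS]chain_blockK; apply/eq_chain_col => i j /andP[_ ji]; rewrite /chains EN.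
have Es i : E i *m s = S i *m E i.
  by rewrite /E; case: ifP => [i0|_]; rewrite ?es ?mulmx0 ?mul0mx.
exists N, s, E; split=> //.
- apply: (chain_eq cE) => i j ji; rewrite EN // !mulmxA es // eN // -mulmxA eN //.
  by case: ifP => ji1; rewrite ?mul0mx ?mulmx0 ?es.
- apply: (chain_eq cE) => i j ji; rewrite mulmx0 -mulmxA mulmxE -exprD.
  have ijn : (i <= j + n)%N by rewrite (leq_trans (leq_ord i)) ?leq_addl.
  by rewrite -(subnKC ijn) exprD -mulmxE mulmxA (chain_nil cE) mul0mx.
- apply: (chain_eq cE) => i j ji; rewrite EN //.
  by rewrite (exp_intertwine k (es i j ji)) Sk mul1mx mulmx1.
Qed.

End ChainStandard.

(** * Matrices of order prime to the characteristic *)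

Section Frobenius.

Lemma exprB_pchar_comm (R : nzRingType) p e (x y : R) :
  p \in [pchar R] -> GRing.comm x y -> (x - y) ^+ (p ^ e) = x ^+ (p ^ e) - y ^+ (p ^ e).
Proof.
move=> pR; elim: e => [|e IH] cxy; first by rewrite expn0 !expr1.
rewrite expnSr !exprM IH // -!(pFrobenius_autE pR) pFrobenius_autB_comm //.
exact/commrX/commr_sym/commrX/commr_sym.
Qed.

Variable F : finFieldType.

Lemma card_pchar p : p \in [pchar F] -> exists e, #|F| = (p ^ e)%N.
Proof. by move=> pF; exists (logn p #|F|); rewrite -(card_pprimeChar pF). Qed.

Lemma exp_card_poly (u : {poly F}) : u ^+ #|F| = u \Po 'X^#|F|.
Proof.
have [p pp pF] := finPcharP F; have [e Fe] := card_pchar pF.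
have pP : p \in [pchar {poly F}] by rewrite pchar_poly.
elim/poly_ind: u => [|u c IH].
  by rewrite comp_poly0 expr0n; case: #|F| (finNzRing_gt1 F).
rewrite comp_polyD comp_polyM comp_polyX comp_polyC -IH.
rewrite -[c%:P]opprK {1}Fe exprB_pchar_comm //; last exact: mulrC.
rewrite -Fe exprMn -polyCN -polyC_exp; congr (_ - _%:P).
by rewrite expf_card.
Qed.

(* For q = #|F|, ('X - A) ^+ q = 'X^q - A ^+ q, hence (char_poly (A ^+ q))('X^q) is
   (char_poly A) ^+ q = (char_poly A)('X^q). *)
Lemma char_poly_exp_card n (A : 'M[F]_n) : char_poly (A ^+ #|F|) = char_poly A.
Proof.
case: n A => [|n] A; first by rewrite /char_poly !det_mx00.
set q := #|F|.
have q1 : (1 < q)%N by exact: finNzRing_gt1.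
suff : (char_poly (A ^+ q) - char_poly A) \Po 'X^q == 0.
  by rewrite comp_poly_eq0 ?size_polyXn ?ltnS 1?ltnW // subr_eq0 => /eqP.
have [p pp pF] := finPcharP F; have [e Fe] := card_pchar pF.
rewrite comp_polyB subr_eq0 -(exp_card_poly (char_poly A)) -/q; apply/eqP.
rewrite /char_poly.
have pP : p \in [pchar {poly F}] by rewrite pchar_poly.
have pchar_matrix : p \in [pchar 'M[{poly F}]_n.+1].
  rewrite inE pp -scaler_nat; apply/eqP/matrixP => i j; rewrite [LHS]mxE.
  by rewrite (pcharf0 pP) mul0r mxE.
have XA : GRing.comm ('X%:M : 'M[{poly F}]_n.+1) (map_mx (@polyC F) A).
  by rewrite /GRing.comm -!mulmxE scalar_mxC.
have AqE : char_poly_mx A ^+ q = ('X^q)%:M - map_mx (@polyC F) (A ^+ q).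
  by rewrite /char_poly_mx {1}/q Fe (exprB_pchar_comm e pchar_matrix XA) -Fe -!rmorphXn.
rewrite -det_exp AqE -det_map_mx; congr (\det _).
apply/matrixP => i j; rewrite !mxE rmorphB /= rmorphMn /= comp_polyX.
by rewrite comp_polyC.
Qed.

End Frobenius.

Section FiniteField.

Variable F : finFieldType.

Lemma card_pred_neq0 : (#|F|.-1)%:R != 0 :> F.
Proof.
have [p pp pF] := finPcharP F.
have Fq : #|F|%:R = 0 :> F.
  have [e Fe] := card_pchar pF; rewrite Fe; case: e Fe (finNzRing_gt1 F) => [->|e _ _] //.
  by rewrite expnS natrM (pcharf0 pF) mul0r.
have : (#|F|.-1 + 1)%:R = 0 :> F by rewrite addn1 (ltn_predK (finNzRing_gt1 F)).
by rewrite natrD => /eqP; rewrite addr_eq0 => /eqP->; rewrite oppr_eq0 oner_eq0.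
Qed.

Lemma expf_card_pred (c : F) : c != 0 -> c ^+ #|F|.-1 = 1.
Proof.
by move=> c0; apply: (mulfI c0); rewrite -exprS (ltn_predK (finNzRing_gt1 F)) expf_card mulr1.
Qed.

Lemma pprime_scaleV n (S : 'M[F]_n) c : c != 0 -> pprime_mx S -> pprime_mx (c *: invmx S).
Proof.
case: n S => [|n] S c0 pS; first by exists 1%N; rewrite ?oner_eq0 // [LHS]flatmx0 [RHS]flatmx0.
have [k k0 Sk] := pS; exists (k * #|F|.-1)%N; first by rewrite natrM mulf_neq0 ?card_pred_neq0.
rewrite exprZn mulnC exprM expf_card_pred // expr1n scale1r mulnC exprM.
by have := exprVn S k; rewrite Sk invr1 => ->; rewrite expr1n.
Qed.

End FiniteField.

(** * Companion blocks and similarity of matrices of order prime to the characteristic *)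

Section Companion.

Variable F : finFieldType.

Lemma unitmx_torsion n (A : 'M[F]_n) : A \in unitmx -> exists2 o, (0 < o)%N & A ^+ o = 1.
Proof.
case: n A => [|n] A uA; first by exists 1%N; rewrite // [LHS]flatmx0 [RHS]flatmx0.
pose x : {unit 'M[F]_n.+1} := FinRing.unit _ uA.
exists #[x]%g; first exact: order_gt0.
by rewrite -[A]/(val x) -FinRing.val_unitX expg_order.
Qed.

(* Start from the companion matrix and kill the p-part of its order by raising it
   to a power of #|F|. *)
Lemma pprime_char_poly n (u : {poly F}) : u \is monic -> size u = n.+1 -> u`_0 != 0 ->
  exists2 S : 'M[F]_n, pprime_mx S & char_poly S = u.
Proof.
move=> mu su u0.
have [A Au] : exists A : 'M[F]_n, char_poly A = u.
  have d : (size u).-1 = n by rewrite su.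
  by exists (castmx (d, d) (companionmx u)); rewrite char_poly_castmx companionmxK.
have uA : A \in unitmx.
  rewrite unitmxE unitfE; apply: contraNneq u0 => detA.
  by rewrite -Au char_poly_det detA mulr0.
have [o o0 Ao] := unitmx_torsion uA.
have [p pp pF] := finPcharP F; have [e Fe] := card_pchar pF.
have e0 : (0 < e)%N by case: e Fe (finNzRing_gt1 F) => // ->.
(* The exponent [o] is generous: the [p]-part of [o] divides [#|F| ^ o], so the prime-to-[p] part of
   [o] kills this power of [A]. *)
exists (A ^+ (#|F| ^ o)).
  exists (o`_p^')%N; first by rewrite -(dvdn_pcharf pF) -p'natE // part_pnat.
  rewrite -exprM; apply/eqP.
  have /dvdnP[k ->] : (o %| #|F| ^ o * o`_p^')%N.
    rewrite -{1}(partnC p o0) dvdn_mul // Fe -expnM p_part dvdn_exp2l //.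
    by rewrite (leq_trans (ltnW (ltn_logl _ o0))) // leq_pmull.
  by rewrite mulnC exprM Ao expr1n.
elim: o {o0 Ao} => [|o IH]; first by rewrite expn0 expr1.
by rewrite expnSr exprM char_poly_exp_card.
Qed.

(** A nonconstant divisor of least size is irreducible. Divisors are encoded as row vectors, a
    finite type, so that the existence of one of a given size is decidable and a least size can be
    extracted. *)
Lemma irreducible_factor (u : {poly F}) : (1 < size u)%N ->
  exists f : {poly F}, [/\ irreducible_poly f, f \is monic & f %| u].
Proof.
move=> su.
pose P k := [exists v : 'rV[F]_(size u),
  [&& (1 < size (rVpoly v))%N, size (rVpoly v) == k & rVpoly v %| u]].
have u0 : u != 0 by rewrite -size_poly_gt0 ltnW.
have PP (v : {poly F}) : (1 < size v)%N -> v %| u -> P (size v).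
  move=> sv vu; apply/existsP; exists (poly_rV v).
  by rewrite poly_rV_K ?dvdp_leq // sv eqxx vu.
have [k /existsP[v /and3P[sv /eqP svk vu]] kmin] := ex_minnP (ex_intro P _ (PP u su (dvdpp u))).
set f := rVpoly v in sv svk vu.
have f0 : f != 0 by rewrite -size_poly_gt0 ltnW.
have lf : lead_coef f != 0 by rewrite lead_coef_eq0.
have fE : (lead_coef f)^-1 *: f %= f by rewrite eqp_scale ?invr_eq0.
exists ((lead_coef f)^-1 *: f); split.
- split; first by rewrite (eqp_size fE).
  move=> g sg gf; have gf' : g %| f by rewrite -(eqp_dvdr _ fE).
  have g0 : g != 0 by apply: contraTneq gf' => ->; rewrite dvd0p.
  have sg1 : (1 < size g)%N by rewrite ltn_neqAle eq_sym sg size_poly_gt0.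
  have gf2 : g %= f.
    rewrite -(dvdp_size_eqp gf') eqn_leq dvdp_leq //=.
    by rewrite svk kmin // PP // (dvdp_trans gf').
  by rewrite (eqp_ltrans gf2) eqp_sym.
- by rewrite monicE lead_coefZ mulVf.
- by rewrite (eqp_dvdl _ fE).
Qed.

(** Otherwise [f] would be coprime to the minimal polynomial, yet in the extension by a root of [f]
    the minimal and the characteristic polynomial have the same roots. *)
Lemma irreducible_dvd_minpoly n (A : 'M[F]_n.+1) (f : {poly F}) :
  irreducible_poly f -> f %| char_poly A -> f %| mxminpoly A.
Proof.
move=> irf fA; have [L _ [z fz _]] := irredp_FAdjoin irf.
apply: contraLR isT; rewrite -irreducible_poly_coprime // => cfA; move: fz => /=.
rewrite -(coprimep_map (in_alg L)) in cfA.
move=> fz; have := coprimep_root cfA fz; rewrite -mxminpoly_map -/(root _ z) => /negP[].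
rewrite root_mxminpoly -map_char_poly.
move: fz; rewrite -!dvdp_XsubCl => /dvdp_trans; apply.
by rewrite dvdp_map.
Qed.

(** If [r * f] is the minimal polynomial, then [r] does not annihilate [A], and any nonzero row of
    its value at [A] is killed by [f]. *)
Lemma companion_vector n (A : 'M[F]_n.+1) (f : {poly F}) :
  irreducible_poly f -> f %| char_poly A ->
  exists2 v : 'rV_n.+1, v != 0 & v *m horner_mx A f = 0.
Proof.
move=> irf /(irreducible_dvd_minpoly irf)/dvdpP[r Ar].
have m0 : mxminpoly A != 0 by rewrite monic_neq0 ?mxminpoly_monic.
have r0 : r != 0 by apply: contraNneq m0 => r0; rewrite Ar r0 mul0r.
have f0 := irredp_neq0 irf.
exists (nz_row (horner_mx A r)).
  rewrite nz_row_eq0 -dvd_mxminpoly; apply/negP => /(dvdp_leq r0).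
  rewrite Ar size_mul //; case: irf => sf _; move: r0 sf; rewrite -size_poly_gt0.
  by case: (size f) => [|[|d]] // r0 _; rewrite !addnS /= leqNgt ltnS leq_addr.
apply/eqP; rewrite -submx0 (submx_trans (submxMr _ (nz_row_sub _))) //.
by rewrite mulmxE -rmorphM /= -Ar mx_root_minpoly submx0.
Qed.

(** The vector [v] generates a copy of the field [F[X]/(f)]: a nonzero polynomial of smaller degree
    is coprime to [f], so by Bezout it cannot annihilate [v]. *)
Lemma companion_rows n (A : 'M[F]_n.+1) (f : {poly F}) (v : 'rV_n.+1) :
  irreducible_poly f -> f \is monic -> v != 0 -> v *m horner_mx A f = 0 ->
  let R : 'M_((size f).-1, n.+1) := \matrix_i (v *m A ^+ i) in
  row_free R /\ R *m A = companionmx f *m R.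
Proof.
move=> irf mf v0 vf R; have [sf _] := irf.
have aR (a : 'rV_(size f).-1) : a *m R = v *m horner_mx A (rVpoly a).
  rewrite [rVpoly a]poly_def linear_sum mulmx_sumr mulmx_sum_row.
  apply: eq_bigr => i _; rewrite valK /= linearZ /= rmorphXn /= horner_mx_X rowK.
  by rewrite -scalemxAr.
split.
  rewrite -kermx_eq0; apply/rowV0P => a /sub_kermxP; rewrite aR => a0.
  apply/eqP; rewrite -(can_eq (@rVpolyK _ _)) linear0.
  apply: contraNT v0 => ra0.
  have : coprimep f (rVpoly a).
    rewrite irreducible_poly_coprime //; apply/negP => /(dvdp_leq ra0).
    by rewrite leqNgt -{2}(ltn_predK sf) ltnS size_poly.
  case/Bezout_eq1_coprimepP => -[x y] /= /(congr1 (horner_mx A)).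
  rewrite (mulrC x) (mulrC y) rmorphD !rmorphM rmorph1 /= => E.
  rewrite -[v]mulmx1 -[X in _ *m X]E mulmxDr -!mulmxE !mulmxA vf a0 !mul0mx addr0.
  exact: eqxx.
have d0 : (0 < (size f).-1)%N by case: (size f) sf => [|[]].
(* [g i] is the remainder of ['X^(i.+1)] modulo [f], which differs from this power only for the last
   row. *)
pose g (i : 'I_(size f).-1) : {poly F} :=
  if i == (size f).-2 :> nat then 'X^((size f).-1) - f else 'X^(i.+1).
have sg i : (size (g i) <= (size f).-1)%N.
  rewrite /g; case: eqP => [_|/eqP id].
    apply/leq_sizeP => j dj; rewrite coefB coefXn.
    case: (ltngtP j (size f).-1) => [|dj'|->]; first by rewrite ltnNge dj.
      by rewrite nth_default ?subrr // -(ltn_predK sf).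
    by rewrite -lead_coefE (monicP mf) subrr.
  by rewrite size_polyXn; have := ltn_ord i; lia.
apply/row_matrixP => i; rewrite !row_mul rowK.
have -> : row i (companionmx f) = poly_rV (g i).
  apply/rowP => j; rewrite !mxE /g; case: eqP => _.
    by rewrite coefB coefXn ltn_eqF // sub0r.
  by rewrite coefXn eq_sym.
rewrite aR poly_rV_K // /g -mulmxA mulmxE -exprSr; case: eqP => [id|_].
  by rewrite rmorphB rmorphXn /= horner_mx_X mulmxBr vf subr0 id prednK.
by rewrite rmorphXn /= horner_mx_X.
Qed.

End Companion.

Section Similarity.

Variable F : finFieldType.

Lemma split_companion n (S : 'M[F]_n) k (f : {poly F}) :
  k%:R != 0 :> F -> S ^+ k = 1 -> irreducible_poly f -> f \is monic -> f %| char_poly S ->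
  exists e (B : 'M_((size f).-1 + e, n)) (X : 'M_e),
    [/\ ((size f).-1 + e)%N = n, row_full B,
        B *m S = block_mx (companionmx f) 0 0 X *m B & X ^+ k = 1].
Proof.
case: n S => [|n] S k0 Sk irf mf fS.
  case: irf => sf _; move: fS; rewrite /char_poly det_mx00 => /(dvdp_leq (oner_neq0 _)).
  by rewrite size_poly1 leqNgt sf.
have [v v0 vf] := companion_vector irf fS.
have [] := companion_rows irf mf v0 vf; set R := \matrix_i _ => Rfree RS.
have Rs : stablemx <<R>>%MS S.
  by rewrite (eqmxMr _ (genmxE R)) genmxE RS submxMl.
have [U [Us RU RU0]] := Maschke1 k0 Sk Rs (submx1 (1%:M *m S)) (submx1 _).
pose T := row_base U.
have TS : T *m S = conjmx T S *m T.
  by rewrite /conjmx mulmxKpV // stablemx_row_base.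
exists (\rank U), (col_mx R T), (conjmx T S); split.
- have := mxrank_disjoint_sum (eqP RU0); rewrite (eqmxP RU) mxrank1 => rk.
  by apply: esym; apply: (etrans rk); congr addn; rewrite genmxE; apply/eqP.
- rewrite -sub1mx -(eqmxP RU) -addsmxE.
  by rewrite addsmxS ?genmxE // eq_row_base.
- by rewrite mul_col_mx mul_block_col !mul0mx addr0 add0r RS TS.
- exact: pprime_restrict (row_base_free _) TS Sk.
Qed.

Lemma full_inverse r n (B : 'M[F]_(r, n)) : r = n -> row_full B ->
  exists2 P : 'M_(n, r), B *m P = 1%:M & P *m B = 1%:M.
Proof.
move=> rn fB; exists (pinvmx B); last exact: mulVpmx.
by rewrite mulmxVp // /row_free [eqbRHS]rn.
Qed.

(** By Maschke, the companion block of a common irreducible factor splits off both matrices; its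
    polynomial cancels from the characteristic polynomials, and induction applies to the
    complements. *)
Lemma pprime_conj n (S S' : 'M[F]_n) : pprime_mx S -> pprime_mx S' ->
  char_poly S = char_poly S' -> exists2 x, x \in unitmx & S *m x = x *m S'.
Proof.
elim/ltn_ind: n S S' => n IH S S' [k k0 Sk] [k' k'0 Sk'] SS'.
case: (posnP n) => [n0|n0].
  by exists 1%:M; rewrite ?unitmx1 //; move: S S' {IH Sk Sk' SS'}; rewrite n0 => S S';
    rewrite [LHS]flatmx0 [RHS]flatmx0.
have [|f [irf mf fS]] := @irreducible_factor F (char_poly S).
  by rewrite size_char_poly.
have [e [B [X [eB fB BS Xk]]]] := split_companion k0 Sk irf mf fS.
rewrite SS' in fS.
have [e' [B' [X' [eB' fB' BS' Xk']]]] := split_companion k'0 Sk' irf mf fS.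
have ee' : e' = e by apply: (@addnI (size f).-1); rewrite eB eB'.
case: e / ee' B X eB fB BS Xk => B X eB fB BS Xk.
have sf : (1 < size f)%N by case: irf.
have [||||Y uY XY] := IH e' _ X X'.
- by rewrite -eB -[ltnLHS]add0n ltn_add2r; lia.
- by exists k.
- by exists k'.
- apply: (mulfI (irredp_neq0 irf)).
  rewrite -{1 2}(companionmxK mf) -!char_poly_block_diag.
  by rewrite -(char_poly_transfer eB fB BS) -(char_poly_transfer eB fB' BS').
have [P BP PB] := full_inverse eB fB; have [P' BP' PB'] := full_inverse eB fB'.
pose D : 'M[F]_((size f).-1 + e') := block_mx 1%:M 0 0 Y.
pose D' : 'M[F]_((size f).-1 + e') := block_mx 1%:M 0 0 (invmx Y).
have Bx : B *m (P *m D *m B') = D *m B' by rewrite !mulmxA BP mul1mx.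
have DD' : D *m D' = 1%:M.
  by rewrite mulmx_block !(mulmx0, mul0mx, addr0, add0r) mulmx1 mulmxV // -scalar_mx_block.
exists (P *m D *m B').
  have : P *m D *m B' *m (P' *m D' *m B) = 1%:M.
    by rewrite !mulmxA -(mulmxA (P *m D)) BP' mulmx1 -(mulmxA P) DD' mulmx1.
  by case/mulmx1_unit.
apply: (row_full_inj fB); rewrite [LHS]mulmxA BS -(mulmxA _ B) Bx [RHS]mulmxA Bx -(mulmxA D) BS'
  !mulmxA.
congr (_ *m _); rewrite !mulmx_block !(mulmx0, mul0mx, mulmx1, mul1mx, addr0, add0r).
by rewrite XY.
Qed.

Lemma horner_mx_comp n (A : 'M[F]_n.+1) (p g : {poly F}) :
  horner_mx A (p \Po g) = horner_mx (horner_mx A g) p.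
Proof.
rewrite comp_polyE -[p in RHS]coefK poly_def !linear_sum; apply: eq_bigr => i _.
by rewrite !linearZ /= !rmorphXn /= horner_mx_X.
Qed.

(* A generator gam of the multiplicative group of the field F[A] has norm
   gam ^+ (1 + q + ... + q ^ (n - 1)), which generates that of F. *)
Lemma irreducible_cent_det n (A : 'M[F]_n) c :
  irreducible_poly (char_poly A) -> c != 0 ->
  exists Z : 'M_n, Z *m A = A *m Z /\ \det Z = c.
Proof.
case: n A => [|d] A irA c0.
  by have [] := irA; rewrite /char_poly det_mx00 size_poly1.
have [L dimL [z fz Lz]] := irredp_FAdjoin irA.
rewrite size_char_poly /= in dimL.
pose fL : finFieldType := finvect_type L.
have cardL : #|fL| = (#|F| ^ d.+1)%N.
  rewrite -dimL; pose vL : vectType F := finvect_type L.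
  rewrite -(@card_vspacef F fL (Vector.class vL)).
  exact: (@card_vspace F fL (Vector.class vL) fullv).
have /cyclicP[w wE] := field_unit_group_cyclic [set: {unit fL}]%G.
have ow : #[w]%g = (#|F| ^ d.+1).-1.
  by rewrite orderE -wE card_finField_unit cardL.
pose gam : L := val w.
have /Fadjoin1_polyP[g gE] : gam \in <<1; z>>%VS by rewrite Lz memvf.
pose Z := horner_mx A g.
have ZA : Z *m A = A *m Z by apply/comm_horner_mx/comm_mx_refl.
pose psi := char_poly Z.
have q1 : (1 < #|F|)%N := finNzRing_gt1 F.
(* [Z = g(A)] satisfies its own characteristic polynomial, so that of [A] divides [psi \Po g];
   evaluating at the root [z] gives [psi(gam) = 0]. *)
have rpsi : root (map_poly (in_alg L) psi) gam.
  have : char_poly A %| psi \Po g.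
    apply: (dvdp_trans (irreducible_dvd_minpoly irA (dvdpp _))).
    by apply/mxminpoly_minP; rewrite horner_mx_comp Cayley_Hamilton.
  rewrite -(dvdp_map (in_alg L)); move: fz; rewrite -!dvdp_XsubCl => zf /(dvdp_trans zf).
  by rewrite !dvdp_XsubCl map_comp_poly /root horner_comp -gE.
have rgam i : root (map_poly (in_alg L) psi) (gam ^+ (#|F| ^ i)).
  elim: i => [|i]; first by rewrite expn0 expr1.
  rewrite expnSr exprM; move: (gam ^+ _) => y /eqP ry.
  have /(congr1 (fun p => (map_poly (in_alg L) p).[y])) := exp_card_poly psi.
  rewrite map_comp_poly rmorphXn /= map_polyXn horner_comp hornerXn.
  by rewrite horner_exp ry expr0n /root => <-; case: #|F| q1.
pose rs := [seq gam ^+ (#|F| ^ i) | i <- iota 0 d.+1].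
have gamX i : gam ^+ i = val (w ^+ i)%g by rewrite FinRing.val_unitX.
have urs : uniq rs.
  rewrite map_inj_in_uniq ?iota_uniq // => i j; rewrite !mem_iota !add0n /= => id jd.
  rewrite !gamX => /val_inj/eqP; rewrite eq_expg_mod_order ow.
  (* [d = 0] is set apart because the bound [small] fails there when [#|F| = 2]. *)
  have [d0|d0] := posnP d; first by move: id jd; rewrite d0; lia.
  have qd : (1 < #|F| ^ d)%N by rewrite -{1}(expn0 #|F|) ltn_exp2l.
  have small k : (k < d.+1)%N -> (#|F| ^ k < (#|F| ^ d.+1).-1)%N.
    rewrite ltnS => kd; have : (#|F| ^ k <= #|F| ^ d)%N by rewrite leq_exp2l.
    by rewrite expnS; move: q1 qd; move: #|F| (#|F| ^ d)%N (#|F| ^ k)%N => a b e; nia.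
  by rewrite !modn_small ?small // => /eqP /(expnI q1).
have psiE : map_poly (in_alg L) psi = \prod_(y <- rs) ('X - y%:P).
  have szp : size (map_poly (in_alg L) psi) = (size rs).+1.
    by rewrite size_map_poly size_char_poly size_map size_iota.
  rewrite (all_roots_prod_XsubC szp) ?uniq_rootsE //.
    by rewrite lead_coef_map (monicP (char_poly_monic Z)) rmorph1 scale1r.
  by apply/allP => y /mapP[i _ ->].
pose m := (\sum_(i < d.+1) #|F| ^ i)%N.
have detZ : in_alg L (\det Z) = gam ^+ m.
  have := congr1 (fun p => p.[0]) psiE; rewrite /= horner_coef0 coef_map /= char_poly_det.
  rewrite horner_prod big_map -[iota 0 d.+1]/(index_iota 0 d.+1) big_mkord.
  rewrite (eq_bigr (fun i : 'I_d.+1 => - 1 * gam ^+ (#|F| ^ i))); last first.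
    by move=> i _; rewrite hornerXsubC sub0r mulN1r.
  rewrite big_split /= prodr_const card_ord -expr_sum -/m.
  rewrite -in_algE rmorphM rmorphXn rmorphN1 => /mulfI; apply.
  by rewrite signr_eq0.
have dZ : \det Z != 0.
  have gam0 : gam != 0 by have := valP w; rewrite /= unitfE.
  have := expf_neq0 m gam0; rewrite -detZ; apply: contraNneq => ->.
  by rewrite rmorph0.
pose dl : {unit F} := FinRing.unit F (etrans (unitfE _) dZ).
(* The order of [gam] is [m * #|F|.-1] and divides [m] times the order of its norm [dl]; cancel
   [m]. *)
have ord_dl : #[dl]%g = #|F|.-1.
  apply/eqP; rewrite eqn_dvd -{1}card_finField_unit order_dvdG ?inE //=.
  have : ((#|F| ^ d.+1).-1 %| m * #[dl]%g)%N.
    rewrite -ow order_dvdn -val_eqE /= -gamX exprM -detZ -rmorphXn /=.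
    by have /(congr1 val) := expg_order dl; rewrite FinRing.val_unitX /= => ->; rewrite scale1r.
  rewrite predn_exp -/m mulnC dvdn_pmul2l //.
  by rewrite /m (bigD1 ord0) //= expn0.
have /cycleP[j cj] : FinRing.unit F (etrans (unitfE _) c0) \in <[dl]>%g.
  suff -> : <[dl]>%g = [set: {unit F}] by rewrite inE.
  by apply/eqP; rewrite eqEcard subsetT card_finField_unit -ord_dl orderE /=.
exists (Z ^+ j); split.
  by rewrite !mulmxE; apply/commr_sym/commrX/commr_sym.
have /(congr1 val) := cj; rewrite FinRing.val_unitX /= => ->.
by elim: j {cj} => [|j IH]; rewrite ?det1 // !exprS det_mulmx IH.
Qed.

Lemma pprime_cent_det n (S : 'M[F]_n) c : pprime_mx S -> (0 < n)%N -> c != 0 ->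
  exists Y : 'M_n, Y *m S = S *m Y /\ \det Y = c.
Proof.
move=> [k k0 Sk] n0 c0.
have [|f [irf mf fS]] := @irreducible_factor F (char_poly S).
  by rewrite size_char_poly.
have [e [B [X [eB fB BS Xk]]]] := split_companion k0 Sk irf mf fS.
have [||Z [ZC dZ]] := @irreducible_cent_det _ (companionmx f) c; rewrite ?companionmxK //.
have [P BP PB] := full_inverse eB fB.
pose D : 'M[F]_((size f).-1 + e) := block_mx Z 0 0 1%:M.
have BY : B *m (P *m D *m B) = D *m B by rewrite !mulmxA BP mul1mx.
exists (P *m D *m B); split; last first.
  by rewrite (det_transfer eB fB BY) det_ublock det1 mulr1.
apply: (row_full_inj fB); rewrite [LHS]mulmxA BY -(mulmxA D) BS [RHS]mulmxA BS -(mulmxA _ B) BY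
  !mulmxA.
congr (_ *m _); rewrite !mulmx_block !(mulmx0, mul0mx, mulmx1, mul1mx, addr0, add0r).
by rewrite ZC.
Qed.

End Similarity.

(** * Conjugacy classes of the general linear group *)

Section Cayley.

Variables (R : unitRingType) (p : nat).
Hypotheses (pR : p \in [pchar R]) (p_odd : odd p).
Implicit Types u v x N : R.

Definition cayley u := (u - 1) / (u + 1).
Definition cayley_inv N := (1 + N) / (1 - N).

Lemma intertwine_div a a' b b' x : b \is a GRing.unit -> b' \is a GRing.unit ->
  a * x = x * a' -> b * x = x * b' -> a / b * x = x * (a' / b').
Proof.
move=> ub ub' ax bx; rewrite mulrA -ax -!mulrA; congr (a * _).
by apply: (mulrI ub); rewrite mulrA mulrV // mul1r mulrA bx mulrK.
Qed.

Lemma two_unit : (2%:R : R) \is a GRing.unit.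
Proof.
have pp := pcharf_prime pR.
have E : (p.+1./2)%:R * 2%:R = 1 :> R.
  rewrite -natrM muln2; have -> : p.+1./2.*2 = (p + 1)%N by lia.
  by rewrite natrD (pcharf0 pR) add0r.
apply/unitrP; exists (p.+1./2)%:R; split=> //.
by rewrite -natrM mulnC natrM.
Qed.

(** The [p ^ a]-th power of [u + 1] is [1 + 1], a unit since [p] is odd. *)
Lemma unip_unit u a : u ^+ (p ^ a) = 1 -> u + 1 \is a GRing.unit.
Proof.
move=> ua; have : (u + 1) ^+ (p ^ a) \is a GRing.unit.
  have -> : u + 1 = u - (- 1) by rewrite opprK.
  rewrite (exprB_pchar_comm _ pR); last exact/commrN/commr1.
  rewrite ua -signr_odd oddX p_odd orbT expr1 opprK; exact: two_unit.
by rewrite unitrX_pos // expn_gt0 prime_gt0 ?(pcharf_prime pR).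
Qed.

Lemma unip_cayley_nil u a : u ^+ (p ^ a) = 1 -> cayley u ^+ (p ^ a) = 0.
Proof.
move=> ua; rewrite /cayley exprMn_comm.
  by rewrite (exprB_pchar_comm _ pR) ?ua ?expr1n ?subrr ?mul0r //; apply: commr1.
apply: commrV; apply: commrD; last exact: commr1.
exact/commr_sym/commrB/commr1.
Qed.

Lemma nil_unit N a : N ^+ (p ^ a) = 0 -> 1 - N \is a GRing.unit.
Proof.
move=> Na; have : (1 - N) ^+ (p ^ a) \is a GRing.unit.
  rewrite (exprB_pchar_comm _ pR); last exact/commr_sym/commr1.
  by rewrite Na expr1n subr0 unitr1.
by rewrite unitrX_pos // expn_gt0 prime_gt0 ?(pcharf_prime pR).
Qed.

Lemma nil_cayley_inv_unip N a : N ^+ (p ^ a) = 0 -> cayley_inv N ^+ (p ^ a) = 1.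
Proof.
move=> Na; rewrite /cayley_inv exprMn_comm; last first.
  apply: commrV; apply: commrB; first exact: commr1.
  exact/commr_sym/commrD/commr_refl/commr1.
rewrite exprVn (exprB_pchar_comm _ pR); last exact/commr_sym/commr1.
have -> : 1 + N = 1 - (- N) by rewrite opprK.
rewrite (exprB_pchar_comm _ pR); last exact/commr_sym/commr1.
by rewrite exprNn Na mulr0 subr0 expr1n divr1.
Qed.

Lemma cayleyK u : u + 1 \is a GRing.unit -> cayley_inv (cayley u) = u.
Proof.
move=> u1; have E1 : (1 - cayley u) * (u + 1) = 2%:R.
  by rewrite mulrBl mul1r divrK // opprB addrC subrKA.
have E2 : (1 + cayley u) * (u + 1) = 2%:R * u.
  by rewrite mulrDl mul1r divrK // addrACA subrr addr0 -mulr2n mulr_natl.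
have u2 : 1 - cayley u \is a GRing.unit.
  by rewrite -[1 - _](mulrK u1) unitrMl ?unitrV // E1 two_unit.
apply: (mulIr u2); rewrite /cayley_inv divrK //; apply: (mulIr u1).
by rewrite E2 -mulrA E1 mulr_natl mulr_natr.
Qed.

Lemma cayley_invK N : 1 - N \is a GRing.unit -> cayley (cayley_inv N) = N.
Proof.
move=> N1; have E1 : (cayley_inv N + 1) * (1 - N) = 2%:R.
  by rewrite mulrDl mul1r divrK // addrACA subrr addr0.
have E2 : (cayley_inv N - 1) * (1 - N) = 2%:R * N.
  by rewrite mulrBl mul1r divrK // opprB addrC addrA subrK -mulr2n mulr_natl.
have u2 : cayley_inv N + 1 \is a GRing.unit.
  by rewrite -[cayley_inv N + 1](mulrK N1) unitrMl ?unitrV // E1 two_unit.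
apply: (mulIr u2); rewrite /cayley divrK //; apply: (mulIr N1).
by rewrite E2 -mulrA E1 mulr_natl mulr_natr.
Qed.

Lemma cayleyV u : u \is a GRing.unit -> u + 1 \is a GRing.unit -> cayley u^-1 = - cayley u.
Proof.
move=> uu u1; have E1 : (u^-1 + 1) * u = u + 1 by rewrite mulrDl mulVr // mul1r addrC.
have u2 : u^-1 + 1 \is a GRing.unit.
  by rewrite -[_ + 1](mulrK uu) unitrMl ?unitrV // E1.
apply: (mulIr u2); rewrite /cayley divrK //; apply: (mulIr uu).
rewrite -mulrA E1 mulNr divrK // mulrBl mulVr // mul1r.
by rewrite opprB.
Qed.

Lemma cayley_intertwine u v x : u + 1 \is a GRing.unit -> v + 1 \is a GRing.unit ->
  u * x = x * v -> cayley u * x = x * cayley v.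
Proof.
by move=> u1 v1 uv; apply: intertwine_div; rewrite // !mulrDl !mulrDr uv ?mulN1r ?mulrN1 ?mul1r
  ?mulr1.
Qed.

Lemma cayley_inv_intertwine u v x : 1 - u \is a GRing.unit -> 1 - v \is a GRing.unit ->
  u * x = x * v -> cayley_inv u * x = x * cayley_inv v.
Proof.
by move=> u1 v1 uv; apply: intertwine_div; rewrite // !mulrDl !mulrDr ?mulNr ?mulrN uv ?mul1r
  ?mulr1.
Qed.

End Cayley.

(** * Jordan decomposition and the classification of classes of GL *)

Section JordanGL.

Variables (F : finFieldType) (p n : nat).
Hypotheses (pF : p \in [pchar F]) (p_odd : odd p).
Local Notation GL := [the finGroupType of {'GL_n.+1[F]}].
Implicit Types g x : GL.

(** In a finite group of characteristic [p] matrices, the semisimple and unipotent parts are the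
    constituents at [p^'] and [p]; being powers of [g], they are respected by conjugation. *)
Definition ss_part g : 'M[F]_n.+1 := GLval (g.`_p^')%g.
Definition nil_part g : 'M[F]_n.+1 := cayley (GLval (g.`_p)%g).

Lemma pchar_matrix : p \in [pchar 'M[F]_n.+1].
Proof.
rewrite inE (pcharf_prime pF) -scaler_nat; apply/eqP/matrixP => i j; rewrite [LHS]mxE.
by rewrite (pcharf0 pF) mul0r mxE.
Qed.

Lemma GL_X g k : GLval (g ^+ k)%g = GLval g ^+ k.
Proof. exact: FinRing.val_unitX. Qed.

Lemma GL_exp_order g : GLval g ^+ #[g]%g = 1.
Proof. by rewrite -GL_X expg_order. Qed.

Lemma GL_inj : injective (@GLval n.+1 F).
Proof. exact: val_inj. Qed.

Lemma GL_unit_r g : (GLval g : 'M[F]_n.+1) \is a GRing.unit.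
Proof. exact: valP. Qed.

Lemma pprime_ss_part g : pprime_mx (ss_part g).
Proof.
exists #[g.`_p^']%g; last exact: GL_exp_order.
rewrite -(dvdn_pcharf pF) -p'natE ?(pcharf_prime pF) //.
exact: p_elt_constt.
Qed.

Lemma pprime_pelt g : pprime_mx (GLval g : 'M[F]_n.+1) -> (p^'.-elt g)%g.
Proof.
case=> k k0 gk; rewrite /p_elt p'natE ?(pcharf_prime pF) //.
rewrite -(dvdn_pcharf pF) in k0; apply: contra k0 => /dvdn_trans; apply.
by rewrite order_dvdn; apply/eqP/GL_inj; rewrite GL_X gk.
Qed.

Lemma unip_exp g : exists a, GLval (g.`_p)%g ^+ (p ^ a) = 1.
Proof.
have /p_natP[a oa] : p.-nat #[g.`_p]%g by exact: p_elt_constt.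
by exists a; rewrite -oa; apply: GL_exp_order.
Qed.

Lemma unip_pelt g a : GLval g ^+ (p ^ a) = 1 -> (p.-elt g)%g.
Proof.
move=> ga; apply: (@pnat_dvd _ (p ^ a)%N); last by rewrite pnatX pnat_id ?(pcharf_prime pF).
by rewrite order_dvdn; apply/eqP/GL_inj; rewrite GL_X ga.
Qed.

Lemma unip_plus1 g : GLval (g.`_p)%g + 1 \is a GRing.unit.
Proof. by have [a ga] := unip_exp g; apply: unip_unit pchar_matrix p_odd _ _ ga. Qed.

Lemma nil_part_nil g : exists a, nil_part g ^+ (p ^ a) = 0.
Proof. by have [a ga] := unip_exp g; exists a; apply: (unip_cayley_nil pchar_matrix). Qed.

Lemma nil_part_minus g : 1 - nil_part g \is a GRing.unit.
Proof. by have [a ga] := nil_part_nil g; apply: nil_unit pchar_matrix _ _ ga. Qed.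

Lemma GL_decomp g : GLval g = ss_part g * cayley_inv (nil_part g).
Proof.
rewrite /nil_part (cayleyK pchar_matrix p_odd) ?unip_plus1 //.
by rewrite -{1}(consttC p^' g) consttNK.
Qed.

Lemma ss_nil_part_comm g : nil_part g *m ss_part g = ss_part g *m nil_part g.
Proof.
rewrite !mulmxE; apply: (cayley_intertwine (unip_plus1 g) (unip_plus1 g)).
have H : (g.`_p * g.`_p^' = g.`_p^' * g.`_p)%g.
  by rewrite consttC -{1}(consttC p^' g) consttNK.
exact: (congr1 (@GLval n.+1 F) H).
Qed.

Lemma jordan_conj g g' x : (g * x = x * g')%g ->
  ss_part g *m GLval x = GLval x *m ss_part g' /\ nil_part g *m GLval x = GLval x *m nil_part g'.
Proof.
move=> gx; have -> : g' = (g ^ x)%g by rewrite conjgE gx mulKg.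
split; rewrite /ss_part /nil_part consttJ.
  have H : (g.`_p^' * x = x * g.`_p^' ^ x)%g by rewrite conjgE mulKVg.
  exact: (congr1 (@GLval n.+1 F) H).
apply: cayley_intertwine; first exact: unip_plus1.
  by rewrite -consttJ; apply: unip_plus1.
have H : (g.`_p * x = x * g.`_p ^ x)%g by rewrite conjgE mulKVg.
exact: (congr1 (@GLval n.+1 F) H).
Qed.

Lemma conj_jordan g g' x : ss_part g *m GLval x = GLval x *m ss_part g' ->
  nil_part g *m GLval x = GLval x *m nil_part g' ->
  (g * x = x * g')%g.
Proof.
move=> sx Nx; apply: GL_inj; rewrite !GL_ME (GL_decomp g) (GL_decomp g').
have := cayley_inv_intertwine (nil_part_minus g) (nil_part_minus g') Nx.
set a := cayley_inv _; set b := cayley_inv _ => ab; move: sx; rewrite mulmxE => sx.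
rewrite -mulrA ab mulrA sx; exact: esym (mulmxA _ _ _).
Qed.

Lemma jordan_exists (s N : 'M[F]_n.+1) k :
  pprime_mx s -> N ^+ k = 0 -> N *m s = s *m N -> exists g, ss_part g = s /\ nil_part g = N.
Proof.
move=> ps Nk Ns; have us := pprime_unit ps.
have Npk : N ^+ (p ^ k) = 0.
  have kp : (k <= p ^ k)%N by rewrite ltnW // ltn_expl // prime_gt1 ?(pcharf_prime pF).
  by rewrite -(subnK kp) exprD Nk mulr0.
have Nu : cayley_inv N \is a GRing.unit.
  have := nil_cayley_inv_unip pchar_matrix Npk; rewrite -(prednK (_ : 0 < p ^ k)%N).
    by rewrite exprS => /mulmx1_unit[].
  by rewrite expn_gt0 prime_gt0 ?(pcharf_prime pF).
have sN : s * cayley_inv N = cayley_inv N * s.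
  by symmetry; apply: cayley_inv_intertwine; rewrite ?(nil_unit pchar_matrix Npk).
pose a : GL := FinRing.unit _ us; pose b : GL := FinRing.unit _ Nu.
have pa : (p^'.-elt a)%g by apply: pprime_pelt.
have pb : (p.-elt b)%g by apply: (unip_pelt (a := k)); apply: (nil_cayley_inv_unip pchar_matrix).
have ab : commute a b by apply: GL_inj; rewrite !GL_ME.
exists (a * b)%g; rewrite /ss_part /nil_part !consttM //.
have -> : (a.`_p = 1)%g by apply/constt1P.
have -> : (b.`_p^' = 1)%g by apply/constt1P; rewrite /p_elt pnatNK.
rewrite !constt_p_elt // mulg1 mul1g; split=> //=.
by rewrite (cayley_invK pchar_matrix p_odd) ?(nil_unit pchar_matrix Npk).
Qed.

(** A scalar has order prime to [p], hence is absorbed entirely by the semisimple part. *)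
Lemma jordan_scaleV g g' (c : F) : c != 0 -> GLval g' = c *: (GLval g)^-1 ->
  ss_part g' = c *: (ss_part g)^-1 /\ nil_part g' = - nil_part g.
Proof.
move=> c0 gE; have uc : (c%:M : 'M[F]_n.+1) \in unitmx.
  by rewrite unitmxE det_scalar unitfE expf_neq0.
pose z : GL := FinRing.unit _ uc.
have gz : g' = (z * g^-1)%g by apply: GL_inj; rewrite GL_ME gE -mul_scalar_mx.
have zg : commute z g^-1 by apply: GL_inj; rewrite !GL_ME /= -!mulmxE scalar_mxC.
have pz : (p^'.-elt z)%g.
  apply: pprime_pelt; exists #|F|.-1; first exact: card_pred_neq0.
  by rewrite /= -rmorphXn /= expf_card_pred.
have ssE : (g'.`_p^' = z * (g.`_p^')^-1)%g by rewrite gz consttM // (constt_p_elt pz) consttV.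
have nilE : (g'.`_p = (g.`_p)^-1)%g.
  by rewrite gz consttM // consttV; have /constt1P-> := pz; rewrite mul1g.
split; first by rewrite /ss_part ssE GL_ME /= -mulmxE mul_scalar_mx.
by rewrite /nil_part nilE GL_VE cayleyV ?unip_plus1 // GL_unit.
Qed.

Section Data.

(** [S i] is the semisimple part acting on the tops of the chains of length [i], in the basis [E i];
    only its conjugacy class has a meaning. *)
Definition jordan_data g nu (S : forall i, 'M[F]_(nu i)) := exists E : forall i, 'M_(nu i, n.+1),
  chain_basis (nil_part g) E /\ forall i, E i *m ss_part g = S i *m E i.

Lemma jordan_data_exists g : exists nu S,
  [/\ @jordan_data g nu S, nu ord0 = 0%N & forall i, pprime_mx (S i)].
Proof.
have [k k0 sk] := pprime_ss_part g; have [a Na] := nil_part_nil g.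
have Ns : nil_part g *m ss_part g = 1 *: (ss_part g *m nil_part g)
  by rewrite scale1r ss_nil_part_comm.
have [nu [E [S [cE nu0 Es Sk]]]] := chain_exists k0 sk (oner_neq0 _) Ns Na.
exists nu, S; split=> // [|i]; first by exists E.
by exists k.
Qed.

Lemma chain_basis_scale (N : 'M[F]_n.+1) nu (E E' : forall i, 'M[F]_(nu i, n.+1))
   (x : forall i, 'M[F]_(nu i)) :
  chain_basis N E -> (forall i, x i \in unitmx) -> (forall i, E' i = x i *m E i) ->
  chain_basis N E'.
Proof.
case=> EN fE dE ux E'E; split=> // [i|].
  by rewrite E'E -mulmxA EN mulmx0.
rewrite -sub1mx; apply: (submx_trans (_ : _ <= chain_col 0 (chains N E))%MS).
  by rewrite sub1mx.
apply/chain_col_sub => i j ji.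
have /chain_col_sub/(_ i j ji) := submx_refl (chain_col 0 (chains N E')).
apply: submx_trans; apply/submxP; exists (invmx (x i)).
by rewrite /chains E'E mulmxA mulKmx.
Qed.

Lemma jordan_data_conj g g' nu (S S' : forall i, 'M[F]_(nu i)) : jordan_data g S ->
  jordan_data g' S' ->
  (forall i, pprime_mx (S i)) -> (forall i, pprime_mx (S' i)) ->
  (forall i, char_poly (S i) = char_poly (S' i)) -> g' \in (g ^: [set: GL])%g.
Proof.
move=> [E [cE Es]] [E' [cE' Es']] pS pS' SS'.
have [x ux Sx] := fin_all_exists2 (fun i => pprime_conj (pS i) (pS' i) (SS' i)).
have cE'' := chain_basis_scale cE' ux (fun i => erefl).
have Es'' i : x i *m E' i *m ss_part g' = S i *m (x i *m E' i).
  by rewrite -mulmxA Es' !mulmxA Sx.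
have [y uy [sy Ny]] := chain_conj cE cE'' (ss_nil_part_comm g) (ss_nil_part_comm g') Es Es''.
apply/imsetP; exists (FinRing.unit _ uy : GL); rewrite ?inE //.
by rewrite conjgE (conj_jordan (g' := g') (x := FinRing.unit _ uy)) ?mulKg.
Qed.

Lemma jordan_data_class g g' nu S : @jordan_data g nu S -> g' \in (g ^: [set: GL])%g ->
  @jordan_data g' nu S.
Proof.
move=> [E [cE Es]] g'g.
have [x g'E] : exists x : GL, g' = (g ^ x)%g by case/imsetP: g'g => x _ ->; exists x.
have gx : (g * x = x * g')%g by rewrite g'E conjgE mulKVg.
have [sx Nx] := jordan_conj gx.
exists (fun i => E i *m GLval x); split; last first.
  by move=> i; rewrite -mulmxA -sx !mulmxA Es.
have ENx i j : E i *m GLval x *m nil_part g' ^+ j = E i *m nil_part g ^+ j *m GLval x.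
  rewrite -!mulmxA; congr (_ *m _); symmetry.
  elim: j => [|j IH]; first by rewrite !expr0 mulmx1 mul1mx.
  by rewrite !exprSr -!mulmxE -mulmxA Nx !mulmxA IH.
case: cE => EN fE dE; split; [by move=> i; rewrite ENx (EN i) mul0mx | | exact: dE].
have -> : chain_col 0 (chains (nil_part g') (fun i => E i *m GLval x)) =
  chain_col 0 (chains (nil_part g) E) *m GLval x.
  by rewrite chain_col_mul; apply/eq_chain_col => i j _; rewrite /chains ENx.
have fx : row_free (GLval x : 'M[F]_n.+1) by rewrite row_free_unit; exact: GL_unit_r.
by rewrite /row_full mxrankMfree.
Qed.

Lemma jordan_data_unique g nu nu' S S' : @jordan_data g nu S -> @jordan_data g nu' S' ->
  forall i : 'I_n.+2, (0 < i)%N -> char_poly (S i) = char_poly (S' i).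
Proof.
by move=> [E [cE Es]] [E' [cE' Es']]; apply: (chain_unique (ss_nil_part_comm g) cE Es cE' Es').
Qed.

Lemma jordan_data_realize nu (S : forall i, 'M[F]_(nu i)) : (\sum_(i < n.+2) i * nu i = n.+1)%N ->
  (forall i, pprime_mx (S i)) -> exists g, jordan_data g S.
Proof.
move=> dim pS.
have [k [k0 Sk]] : exists k, k%:R != 0 :> F /\ forall i, S i ^+ k = 1.
  have [k k0 Sk] := fin_all_exists2 pS.
  exists (\prod_i k i)%N; split; first by rewrite natr_prod; apply/prodf_neq0 => i _.
  by move=> i; rewrite (bigD1 i) //= exprM Sk expr1n.
have [N [s [E [cE Ns Es Nn sk]]]] := chain_std dim Sk.
have [|g [sg Ng]] := jordan_exists _ Nn Ns; first by exists k.
by exists g; exists E; rewrite sg Ng.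
Qed.

Lemma chain_basis_opp (N : 'M[F]_n.+1) nu (E : forall i, 'M[F]_(nu i, n.+1)) :
  chain_basis N E -> chain_basis (- N) E.
Proof.
have EN i j : E i *m (- N) ^+ j = (-1) ^+ j *: (E i *m N ^+ j).
  elim: j => [|j IH]; first by rewrite !expr0 scale1r.
  by rewrite !exprSr -!mulmxE !mulmxA IH mulmxN -scalemxAl mulrN1 scaleNr.
case=> EN0 fE dE; split=> // [i|]; first by rewrite EN EN0 scaler0.
rewrite -sub1mx; apply: (submx_trans (_ : _ <= chain_col 0 (chains N E))%MS).
  by rewrite sub1mx.
apply/chain_col_sub => i j ji.
have /chain_col_sub/(_ i j ji) := submx_refl (chain_col 0 (chains (- N) E)).
by apply: submx_trans; rewrite /chains EN; rewrite -[X in (X <= _)%MS](signrZK j) scalemx_sub.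
Qed.

Lemma jordan_data_scaleV g g' nu S (c : F) : c != 0 -> GLval g' = c *: (GLval g)^-1 ->
  (forall i, pprime_mx (S i)) -> @jordan_data g nu S -> jordan_data g' (fun i => c *: invmx (S i)).
Proof.
move=> c0 g'E pS [E [cE Es]]; have [sE NE] := jordan_scaleV c0 g'E.
exists E; rewrite sE NE; split=> [|i]; first exact: chain_basis_opp.
rewrite -scalemxAl -scalemxAr; congr (_ *: _).
have uS := pprime_unit (pS i); have us := pprime_unit (pprime_ss_part g).
apply: (row_free_inj (_ : row_free (ss_part g))); first by rewrite row_free_unit.
by rewrite -mulmxA mulmxE mulVr // mulmx1 -mulmxA Es mulKmx.
Qed.

End Data.

End JordanGL.

(** * Determinants of centralizing and reversing elements *)

Section CentralizerDet.

Variables (F : finFieldType) (p n : nat).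
Hypotheses (pF : p \in [pchar F]) (p_odd : odd p).
Local Notation GL := [the finGroupType of {'GL_n.+1[F]}].
Implicit Types g x : GL.

Lemma det_ss_part x : \det (ss_part p x) = \det (GLval x).
Proof.
have -> : GLval x = GLval (x.`_p)%g * GLval (x.`_p^')%g by rewrite -{1}(consttC p x).
rewrite -mulmxE det_mulmx; have [a ua] := unip_exp p x.
have : (\det (GLval (x.`_p)%g) - 1) ^+ (p ^ a) = 0.
  rewrite (exprB_pchar_comm _ pF); last exact: mulrC.
  rewrite expr1n.
  by rewrite -det_exp ua det1 subrr.
by move/eqP; rewrite expf_eq0 subr_eq0 => /andP[_ /eqP->]; rewrite mul1r.
Qed.

(** Take the identity for [s] in [chain_unique]: the degrees of the characteristic polynomials are
    the multiplicities. *)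
Lemma chain_nu_unique (N : 'M[F]_n.+1) nu nu' E E' :
  @chain_basis F _ nu N E -> @chain_basis F _ nu' N E' ->
  forall i : 'I_n.+2, (0 < i)%N -> nu i = nu' i.
Proof.
move=> cE cE' i i0.
have N1 : N *m 1%:M = 1%:M *m N by rewrite mulmx1 mul1mx.
have E1 i' : E i' *m 1%:M = 1%:M *m E i' by rewrite mulmx1 mul1mx.
have E1' i' : E' i' *m 1%:M = 1%:M *m E' i' by rewrite mulmx1 mul1mx.
have /(congr1 (fun f : {poly F} => size f)) := chain_unique N1 cE E1 cE' E1' i0.
by rewrite !size_char_poly => -[].
Qed.

Lemma expf_parts m (nu : 'I_m -> nat) h (d : 'I_m -> F) :
  (forall i, (0 < nu i)%N -> (h %| i)%N) -> (forall i, nu i = 0%N -> d i = 1) ->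
  \prod_(i < m) d i ^+ i = (\prod_(i < m) d i ^+ (i %/ h)) ^+ h.
Proof.
move=> hnu d1; rewrite -prodrXl; apply: eq_bigr => i _.
case: (posnP (nu i)) => [/d1->|/hnu hi]; first by rewrite !expr1n.
by rewrite -exprM divnK.
Qed.

(** The semisimple part of [x] still commutes with the nilpotent part of [g], so a chain basis can
    be adapted to it. A block on tops of length [i] is repeated [i] times and contributes the [i]-th
    power of its determinant. *)
Lemma cent_det_exp g x nu S h : @jordan_data F p n g nu S -> (g * x = x * g)%g ->
  (forall i : 'I_n.+2, (0 < nu i)%N -> (h %| i)%N) -> exists d, \det (GLval x) = d ^+ h.
Proof.
move=> [E [cE _]] gx hnu.
have gsx : (g * x.`_p^' = x.`_p^' * g)%g.
  have /cycleP[l ->] : (x.`_p^')%g \in <[x]>%g by apply: mem_cycle.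
  exact: commuteX.
have [_ Nx] := jordan_conj pF p_odd gsx.
have [k k0 sk] := pprime_ss_part pF x; have [a Na] := nil_part_nil pF g.
have Ns : nil_part p g *m ss_part p x = 1 *: (ss_part p x *m nil_part p g) by rewrite scale1r.
have [nu' [E' [X [cE' nu'0 Es Xk]]]] := chain_exists k0 sk (oner_neq0 _) Ns Na.
rewrite -det_ss_part (chain_det (X := fun i _ => X i) cE'); last first.
  by move=> i j ji; rewrite (chains_comm Ns Es) expr1n scale1r.
exists (\prod_(i < n.+2) \det (X i) ^+ (i %/ h)).
rewrite -(@expf_parts _ nu'); first by apply: eq_bigr => i _; rewrite prodr_const card_ord.
  move=> i; case: (posnP i) => [i0|i0]; first by rewrite i0 dvdn0.
  by rewrite -(chain_nu_unique cE cE' i0) => /hnu.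
by move=> i; apply: det_mx_size0.
Qed.

Lemma cent_det_part g nu S (i : 'I_n.+2) (c : F) : @jordan_data F p n g nu S ->
  (forall i, pprime_mx (S i)) -> (0 < nu i)%N -> c != 0 ->
  exists x : GL, (g * x = x * g)%g /\ \det (GLval x) = c ^+ i.
Proof.
move=> [E [cE Es]] pS nui c0.
have [Y [YS dY]] : exists Y : forall j, 'M[F]_(nu j), (forall j, Y j *m S j = S j *m Y j) /\
    (forall j, \det (Y j) = if j == i then c else 1).
  have [Yi [YiS dYi]] := pprime_cent_det (pS i) nui c0.
  have H j : exists Y : 'M[F]_(nu j), Y *m S j = S j *m Y /\ \det Y = if j == i then c else 1.
    case: eqP => [->|_]; first by exists Yi.
    by exists 1%:M; rewrite mulmx1 mul1mx det1.
  have [Y HY] := fin_all_exists H.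
  by exists Y; split=> j; have [] := HY j.
have [y Ey] := chain_ext (fun i j => Y i *m (E i *m nil_part p g ^+ j)) cE.
have sN := ss_nil_part_comm pF p_odd g.
have sN1 : nil_part p g *m ss_part p g = 1 *: (ss_part p g *m nil_part p g) by rewrite scale1r.
have Ess (j : 'I_n.+2) k : E j *m nil_part p g ^+ k *m ss_part p g =
  S j *m (E j *m nil_part p g ^+ k).
  by rewrite (chains_comm sN1 Es) expr1n scale1r.
have sy : ss_part p g *m y = y *m ss_part p g.
  apply: (chain_eq cE) => j k kj; rewrite [LHS]mulmxA Ess -(mulmxA (S j)) Ey //.
  by rewrite [RHS]mulmxA Ey // -(mulmxA (Y j)) Ess (mulmxA (Y j) (S j)) YS (mulmxA (S j) (Y j)).
have Ny : nil_part p g *m y = y *m nil_part p g.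
  apply: (chain_eq cE) => j k kj; rewrite [RHS]mulmxA Ey //.
  rewrite [LHS]mulmxA -[E j *m _ *m nil_part p g]mulmxA mulmxE -exprSr.
  case: (ltngtP k.+1 j) => [kj1|jk|jk].
  - by rewrite Ey // exprSr -!mulmxE !mulmxA.
  - by rewrite ltnNge kj in jk.
  - rewrite jk (chain_nil cE) mul0mx -!mulmxA mulmxE -exprSr jk.
    by rewrite (chain_nil cE) mulmx0.
have dy : \det y = c ^+ i.
  rewrite (chain_det (X := fun i _ => Y i) cE) => [|j k kj]; last exact: Ey.
  rewrite (eq_bigr (fun j : 'I_n.+2 => (if j == i then c else 1) ^+ j)); last first.
    by move=> j _; rewrite prodr_const card_ord dY.
  rewrite (bigD1 i) //= eqxx big1 ?mulr1 // => j /negPf->.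
  by rewrite expr1n.
have uy : y \in unitmx by rewrite unitmxE dy unitfE expf_neq0.
exists (FinRing.unit _ uy : GL); split=> //.
exact: (conj_jordan pF p_odd).
Qed.

(** The exponents [k] for which every [c ^+ k] is attained are closed under gcd by Bezout. They
    include each part, by [cent_det_part], and [#|F| - 1], since [c ^+ (#|F| - 1) = 1]. *)
Lemma cent_det_gcd g nu S (c : F) : @jordan_data F p n g nu S ->
  (forall i, pprime_mx (S i)) -> c != 0 ->
  exists x : GL, (g * x = x * g)%g /\
    \det (GLval x) = c ^+ gcdn (#|F| - 1) (\big[gcdn/0%N]_(i < n.+2 | (0 < nu i)%N) (i : nat)).
Proof.
move=> gS pS.
pose P k := forall c : F, c != 0 -> exists x : GL, (g * x = x * g)%g /\ \det (GLval x) = c ^+ k.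
have PB a b : P a -> P b -> P (gcdn a b).
  move=> Pa Pb {}c c0; case: (posnP a) => [->|a0]; first by rewrite gcd0n; apply: Pb.
  case: (egcdnP b a0) => k l kl _.
  have [x [gx dx]] := Pa _ (expf_neq0 k c0).
  have [y [gy dy]] := Pb _ (expf_neq0 l (invr_neq0 c0)).
  exists (x * y)%g; split; first exact: commuteM.
  rewrite GL_ME det_mulmx dx dy -!exprM kl exprD mulrAC -exprMn.
  by rewrite mulfV // expr1n mul1r.
move: c; rewrite -/(P _); apply: (PB) => [c c0|].
  exists 1%g; rewrite mulg1 mul1g det1; split=> //.
  apply: (mulfI c0); rewrite mulr1 -exprS subn1 (ltn_predK (finNzRing_gt1 F)).
  by rewrite expf_card.
apply: big_ind => [c c0|a b|i nui c c0]; last exact: cent_det_part gS pS nui c0.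
  by exists 1%g; rewrite mulg1 mul1g det1 expr0.
exact: PB.
Qed.

Lemma odd_bin2_even i : ~~ odd i -> odd 'C(i, 2) = odd i./2.
Proof.
move=> ei; have -> : i = (i./2).*2 by rewrite even_halfK.
rewrite bin2 doubleK; case: (i./2) => [|k] //.
by rewrite -doubleMl doubleK oddM doubleS /= odd_double andbT.
Qed.

(** [x] anticommutes with the nilpotent part of [g], and so does its semisimple part [s]; the chain
    basis adapted to [s] with [e = -1] makes [s] act on level [j] by [(-1) ^+ j] times the top
    block. *)
Lemma reverser_det g g' x (c : F) nu S h : @jordan_data F p n g nu S -> c != 0 ->
  GLval g' = c *: (GLval g)^-1 -> (g' * x = x * g)%g ->
  (forall i : 'I_n.+2, (0 < nu i)%N -> (h %| i)%N) ->
  (forall i : 'I_n.+2, (0 < nu i)%N -> ~~ odd i) ->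
  exists d, \det (GLval x) = (-1) ^+ (n.+1)./2 * d ^+ h.
Proof.
move=> [E [cE _]] c0 g'E gx hnu evnu.
have [_ Nx] := jordan_conj pF p_odd gx; have [_ NE] := jordan_scaleV pF p_odd c0 g'E.
rewrite NE mulNmx in Nx.
set N := nil_part p g in Nx NE cE *.
set y : 'M[F]_n.+1 := GLval (x.`_p)%g; set s := ss_part p x.
have xE : GLval x = y *m s by rewrite -{1}(consttC p x).
have Nx' : N *m GLval x = - (GLval x *m N) by rewrite -Nx opprK.
have NxX l : N *m (GLval x ^+ l) = (-1) ^+ l *: (GLval x ^+ l *m N).
  elim: l => [|l IH]; first by rewrite !expr0 scale1r mulmx1 mul1mx.
  rewrite !exprSr -!mulmxE mulmxA IH -scalemxAl -(mulmxA _ N) Nx' mulmxN mulrN1 scaleNr scalerN.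
  by rewrite mulmxA.
have Ny : N *m y = y *m N.
  (* As a power of [x], [y] commutes with [N] up to sign; its order is a power of the odd prime [p],
     so the sign is [+]. *)
  have /cycleP[l lE] : (x.`_p)%g \in <[x]>%g by apply: mem_cycle.
  have yE : y = GLval x ^+ l by rewrite /y lE GL_X.
  have [a ya] := unip_exp p x; rewrite -/y in ya.
  have NyX b : N *m (y ^+ b) = ((-1) ^+ l) ^+ b *: (y ^+ b *m N).
    by rewrite yE -!exprM NxX.
  have := NyX (p ^ a)%N; rewrite ya mulmx1 mul1mx -exprM -signr_odd oddM oddX p_odd orbT andbT.
  rewrite signr_odd => NN; have := NyX 1%N; rewrite !expr1 => ->.
  by rewrite scalemxAr -NN.
have Ns : N *m s = (-1) *: (s *m N).
  have uy : y \in unitmx by exact: GL_unit_r.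
  apply: (row_full_inj (_ : row_full y)); first by rewrite row_full_unit.
  rewrite mulmxA -Ny -mulmxA -xE Nx' xE scaleN1r mulmxN.
  by congr (- _); apply: esym (mulmxA _ _ _).
have [k k0 sk] := pprime_ss_part pF x; have [a Na] := nil_part_nil pF g.
have m1 : (-1 : F) != 0 by rewrite oppr_eq0 oner_eq0.
have [nu' [E' [X [cE' nu'0 Es Xk]]]] := chain_exists k0 sk m1 Ns Na.
have nuE (i : 'I_n.+2) : (0 < i)%N -> nu i = nu' i := chain_nu_unique cE cE' (i := i).
have evnu' i : (0 < nu' i)%N -> ~~ odd i.
  case: (posnP i) => [i0|i0]; last by rewrite -nuE //; apply: evnu.
  by rewrite i0.
rewrite -det_ss_part (chain_det (X := fun i j => (-1) ^+ j *: X i) cE'); last first.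
  by move=> i j ji; rewrite (chains_comm Ns Es).
exists (\prod_(i < n.+2) \det (X i) ^+ (i %/ h)).
rewrite -(@expf_parts _ nu').
(* The levels [j < i] give the sign exponent [nu' i * 'C(i, 2)], which for even [i] has the parity
   of [nu' i * i./2]; these add up to half of [n.+1]. *)
- rewrite (eq_bigr (fun i : 'I_n.+2 => (-1) ^+ (nu' i * i./2) * \det (X i) ^+ i)).
    rewrite big_split /= prodrXr; congr (_ ^+ _ * _).
    suff : ((\sum_(i < n.+2) nu' i * i./2).*2 = n.+1)%N by move=> /(congr1 half); rewrite doubleK.
    rewrite -muln2 big_distrl /= -[RHS](chain_dim cE'); apply: eq_bigr => i _.
    case: (posnP (nu' i)) => [->|/evnu' ei]; first by rewrite muln0 !mul0n.
    by rewrite -mulnA muln2 even_halfK // mulnC.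
  move=> i _; rewrite (eq_bigr (fun j : 'I_i => (-1) ^+ (nu' i * j) * \det (X i))).
    rewrite big_split /= prodr_const card_ord; congr (_ * _).
    rewrite prodrXr -big_distrr /=; case: (posnP (nu' i)) => [->|/evnu' ei].
      by rewrite !mul0n.
    have -> : (\sum_(j < i) j = 'C(i, 2))%N by rewrite -bin2_sum big_mkord.
    by rewrite -[LHS]signr_odd -[RHS]signr_odd !oddM odd_bin2_even.
  by move=> j _; rewrite detZ mulnC exprM.
- move=> i; case: (posnP i) => [i0|i0]; first by rewrite i0 dvdn0.
  by rewrite -nuE // => /hnu.
- by move=> i; apply: det_mx_size0.
Qed.

End CentralizerDet.

(** * The characteristic polynomial of a scaled inverse *)

Lemma horner_char_poly (R : comNzRingType) n (A : 'M[R]_n) a :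
  (char_poly A).[a] = \det (a%:M - A).
Proof.
rewrite -horner_evalE -det_map_mx; congr (\det _); apply/matrixP => i j.
by rewrite !mxE /= horner_evalE !hornerE hornerMn hornerX.
Qed.

Lemma divf_rearrange (K : fieldType) (y w a b : K) :
  y != 0 -> w * y * (a * (b / y)) = a * b * w.
Proof. by move=> y0; field. Qed.

(** The right side is [X^n u(c/X)] for [u = char_poly S]; the computation takes place in the
    fraction field, where [X] can be inverted. *)
Lemma char_poly_scaleV (F : fieldType) n (S : 'M[F]_n) (c : F) : S \in unitmx ->
  (char_poly S)`_0 *: char_poly (c *: invmx S) =
  \sum_(j < n.+1) ((char_poly S)`_j * c ^+ j) *: 'X^(n - j).
Proof.
move=> uS; set u := char_poly S.
pose K : fieldType := {fraction {poly F}}; pose t : {rmorphism {poly F} -> K} := @tofrac {poly F}.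
pose f : {rmorphism F -> K} := t \o polyC.
pose x : K := t 'X.
have x0 : x != 0 by rewrite tofrac_eq0 polyX_eq0.
have t_inj : injective t by move=> a b /eqP; rewrite tofrac_eq => /eqP.
apply: t_inj.
have mxf (A : 'M[F]_n) : map_mx t (map_mx polyC A) = map_mx f A.
  by apply/matrixP => i j; rewrite !mxE.
have detE : t (char_poly (c *: invmx S)) * f (\det S) = \det (x *: map_mx f S - (f c)%:M).
  rewrite /char_poly -!det_map_mx map_mxB mxf map_scalar_mx -det_mulmx mulmxBl.
  by rewrite mul_scalar_mx -map_mxM -scalemxAl mulVmx // scalemx1 map_scalar_mx.
have -> : t (u`_0 *: char_poly (c *: invmx S)) = (- 1) ^+ n * \det (x *: map_mx f S - (f c)%:M).
  rewrite -detE -mul_polyC /u char_poly_det !rmorphM rmorphXn rmorphN1 /=.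
  rewrite -mulrA; congr (_ * _); last exact: mulrC.
  exact: (rmorph_sign t n).
have -> : x *: map_mx f S - (f c)%:M = (- x) *: ((f c / x)%:M - map_mx f S).
  by rewrite scalerBr scale_scalar_mx mulNr mulrCA divff // mulr1 raddfN /= !scaleNr opprK addrC.
rewrite detZ -horner_char_poly -map_char_poly -/u (exprNn x) !mulrA -expr2 sqrr_sign mul1r.
rewrite (@horner_coef_wide _ n.+1) ?size_map_poly ?size_char_poly // mulr_sumr [RHS]rmorph_sum.
apply: eq_bigr => j _; rewrite coef_map.
have jn : (j <= n)%N by rewrite -ltnS.
have tZ a (b : {poly F}) : t (a *: b) = f a * t b by rewrite -mul_polyC rmorphM.
rewrite tZ (rmorphXn t) -/x exprMn exprVn rmorphM rmorphXn.
have xn : x ^+ n = x ^+ (n - j) * x ^+ j by rewrite -exprD subnK.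
by rewrite xn; apply: divf_rearrange; rewrite expf_neq0.
Qed.

Lemma char_poly_scaleV_eq (F : fieldType) n (S : 'M[F]_n) (c : F) : S \in unitmx ->
  (char_poly (c *: invmx S) = char_poly S) <->
  (forall j, (j <= n)%N ->
     (char_poly S)`_j * (char_poly S)`_0 = (char_poly S)`_(n - j) * c ^+ (n - j)).
Proof.
move=> uS; have u0 : (char_poly S)`_0 != 0.
  by rewrite char_poly_det mulf_neq0 ?signr_eq0 // -unitfE -unitmxE.
have cE j : (j <= n)%N -> (char_poly (c *: invmx S))`_j * (char_poly S)`_0 =
  (char_poly S)`_(n - j) * c ^+ (n - j).
  move=> jn; have /(congr1 (fun f : {poly F} => f`_j)) := char_poly_scaleV c uS.
  rewrite coefZ mulrC => ->; rewrite coef_sum (bigD1 (inord (n - j))) //=.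
  rewrite inordK ?ltnS ?leq_subr // coefZ coefXn subKn // eqxx mulr1 big1 ?addr0 //.
  move=> i ij; rewrite coefZ coefXn; case: eqP => [E|]; last by rewrite mulr0.
  case/eqP: ij; apply/val_inj; rewrite /= inordK ?ltnS ?leq_subr // E subKn //.
  by rewrite -ltnS.
split=> [E j jn|E]; first by rewrite -cE // E.
apply/polyP => j; case: (leqP j n) => jn.
  by apply: (mulIf u0); rewrite cE // E.
by rewrite !nth_default ?size_char_poly.
Qed.

(** * Self-reciprocal polynomials *)

Section Count.

Variables (F : finFieldType) (m : nat).
Implicit Types (v : 'rV[F]_m) (z e : F).

Definition rVmonic v : {poly F} := 'X^m + rVpoly v.

Lemma rVmonic_monic v : rVmonic v \is monic.
Proof.
by rewrite monicE lead_coefDl ?lead_coefXn // size_polyXn ltnS size_poly.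
Qed.

Lemma size_rVmonic v : size (rVmonic v) = m.+1.
Proof. by rewrite size_polyDl size_polyXn // ltnS size_poly. Qed.

Lemma rVmonic_surj (u : {poly F}) : u \is monic -> size u = m.+1 -> exists v, u = rVmonic v.
Proof.
move=> mu su; exists (poly_rV (u - 'X^m)); rewrite /rVmonic poly_rV_K; first by rewrite addrC subrK.
apply/leq_sizeP => j mj; rewrite coefB coefXn.
case: (ltngtP j m) => [|mj'|->]; first by rewrite ltnNge mj.
  by rewrite nth_default ?subrr // su.
by have := monicP mu; rewrite lead_coefE su => ->; rewrite subrr.
Qed.

Lemma coef_rVmonic_ord v (j : 'I_m) : (rVmonic v)`_j = v 0 j.
Proof. by rewrite coefD coefXn ltn_eqF // add0r coef_rVpoly_ord. Qed.

Lemma coef_rVmonic_m v : (rVmonic v)`_m = 1.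
Proof. by have := monicP (rVmonic_monic v); rewrite lead_coefE size_rVmonic. Qed.

Lemma rVmonic_inj : injective rVmonic.
Proof. by move=> v w vw; apply/rowP => j; rewrite -!coef_rVmonic_ord vw. Qed.

(** Coefficientwise form of [X^m u(z/X) = u(0) u(X)]. *)
Definition self_recip z v := ((rVmonic v)`_0 != 0) &&
  [forall j : 'I_m.+1, (rVmonic v)`_j * (rVmonic v)`_0 == (rVmonic v)`_(m - j) * z ^+ (m - j)].

Lemma self_recip_coef0 z v : self_recip z v -> (rVmonic v)`_0 ^+ 2 = z ^+ m.
Proof.
by case/andP=> _ /forallP/(_ ord0)/eqP; rewrite subn0 coef_rVmonic_m mul1r.
Qed.

Hypothesis m0 : (0 < m)%N.

Lemma card_self_recip z e : e ^+ 2 = z ^+ m -> e != 0 ->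
  #|[set v | self_recip z v && ((rVmonic v)`_0 == e)]| =
  (#|F| ^ (if ~~ odd m && (e == z ^+ m./2)
           then m./2 else m.-1./2))%N.
Proof.
move=> ez e0; set fr := _ && _; set k := if fr then _ else _.
have km : (k < m)%N by rewrite /k; case: ifP => _; lia.
have kb : (m.-1./2 <= k <= m./2)%N by rewrite /k; case: (fr); lia.
have z0 : z != 0.
  by apply: contraNneq e0 => z0; move/eqP: ez; rewrite z0 expr0n gtn_eqF // expf_eq0.
(* The coefficients of index 1, ..., k are free and determine the other ones; the
   middle one is among them iff e = z ^+ m./2. *)
pose b (w : 'rV[F]_k) i : F := if insub i is Some i' then w 0 i' else 0.
have bE w (i : 'I_k) : b w i = w 0 i by rewrite /b valK.
pose a (w : 'rV[F]_k) j : F := if j == 0%N then e else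
  if (j.-1 < k)%N then b w j.-1 else
  if (j.*2 == m) then 0 else b w (m - j).-1 * z ^+ (m - j) / e.
pose f (w : 'rV[F]_k) : 'rV[F]_m := \row_j a w j.
have fE w j : (j < m)%N -> (rVmonic (f w))`_j = a w j.
  by move=> jm; rewrite -[j]/(val (Ordinal jm)) coef_rVmonic_ord mxE.
have af w (i : 'I_k) : a w i.+1 = w 0 i by rewrite /a /= ltn_ord bE.
have f_inj : injective f.
  move=> w w' ff; apply/rowP => i; rewrite -!af -!fE ?ff //.
    by apply: leq_ltn_trans km.
  by apply: leq_ltn_trans km.
rewrite -[in RHS](mul1n k) -card_mx -(card_imset _ f_inj); apply: eq_card => v.
have kfr j : j.*2 = m -> fr = (j.-1 < k)%N.
  move=> jm; rewrite /k; case: (fr) => /=; lia.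
have kfr' : fr -> m = k.*2 /\ e = z ^+ k.
  move=> h; have kE : k = m./2 by rewrite /k h.
  move: h; rewrite kE => /andP[em /eqP h]; split=> //; lia.
apply/idP/imsetP => [|[w _ ->]]; rewrite inE.
  case/andP=> /andP[u0 /forallP R] /eqP ve.
  pose c j := (rVmonic v)`_j.
  have Rc j : (j <= m)%N -> c j * e = c (m - j)%N * z ^+ (m - j).
    by rewrite -ltnS => jm; have /eqP := R (Ordinal jm); rewrite ve.
  exists (\row_i c i.+1) => //; apply/rowP => j; rewrite mxE -coef_rVmonic_ord -/(c j) /a.
  case: eqP => [->//|/eqP j0].
  have bc i : (i < k)%N -> b (\row_i c i.+1) i = c i.+1.
    by move=> ik; rewrite /b insubT mxE.
  case: ifP => [jk|jk]; first by rewrite bc // prednK // lt0n.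
  have jm := ltn_ord j.
  case: eqP => [jm2|/eqP jm2].
    have := kfr _ jm2; rewrite jk; have := Rc j (ltnW jm).
    have -> : (m - j = j)%N by lia.
    move/eqP; rewrite -subr_eq0 -mulrBr mulf_eq0 subr_eq0 => /orP[/eqP//|ezj].
    rewrite /fr => /negbT; rewrite negb_and; have -> : m./2 = j by lia.
    by rewrite ezj; lia.
  have mjk : ((m - j).-1 < k)%N by lia.
  rewrite bc // prednK; last by lia.
  by rewrite -Rc ?mulfK // ltnW.
have c0 : (rVmonic (f w))`_0 = e by rewrite fE.
rewrite c0 eqxx andbT /self_recip c0 e0 /=; apply/forallP => -[j jm] /=; apply/eqP.
case: (ltngtP j m) => [jm'||->]; [|by lia|]; last first.
  by rewrite subnn c0 coef_rVmonic_m mul1r mulr1.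
case: (posnP j) => [->|j0].
  by rewrite subn0 c0 coef_rVmonic_m mul1r -expr2.
have mjm : (m - j < m)%N by lia.
rewrite !fE // /a.
have -> : (j == 0)%N = false by lia.
have -> : (m - j == 0)%N = false by lia.
(* The definition of [a] imposes the relation at indices above [m/2]; below [m/2] it follows from
   [e ^+ 2 = z ^+ m]. *)
case: (ltngtP j.*2 m) => jm2.
- have -> : (j.-1 < k)%N by lia.
  have -> : ((m - j).-1 < k)%N = false by lia.
  have -> : ((m - j).*2 == m) = false by lia.
  rewrite subKn // mulrAC -(mulrA (b w _)) -exprD subnKC // -ez.
  by rewrite expr2 mulrA mulfK.
- have -> : (j.-1 < k)%N = false by lia.
  have -> : ((m - j).-1 < k)%N by lia.
  by rewrite divfK.
- have -> : (m - j = j)%N by lia.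
  rewrite -(kfr _ jm2); case: ifP => [/kfr'[mk ek]|_]; last by rewrite ?jm2 ?eqxx !mul0r.
  by rewrite ek; congr (_ * z ^+ _); lia.
Qed.

End Count.

Lemma prod_sum_fprod (R : comNzRingType) (I : finType) (T : I -> finType)
    (P : forall i, T i -> R) :
  \prod_i \sum_(x : T i) P i x = \sum_(t : fprod T) \prod_i P i (t i).
Proof.
transitivity (\sum_(t : fprod T) \prod_i [ffun x => P i x] (t i)); last first.
  by apply: eq_bigr => t _; apply: eq_bigr => i _; rewrite ffunE.
rewrite (big_fprod _ _ (fun i => [ffun x => P i x])).
under eq_bigr => i _ do rewrite (big_tag (T_ := T) P).
rewrite bigA_distr_big_dep; apply: eq_bigr => g _; apply: eq_bigr => i _.
by rewrite /untag; case: eqP => // e; rewrite ffunE.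
Qed.

(** * Families of self-reciprocal polynomials with prescribed determinant *)

Section Signs.

Variables (F : finFieldType).
Hypothesis two_neq0 : (2%:R : F) != 0.

Lemma neq_opp (r : F) : r != 0 -> r != - r.
Proof.
move=> r0; rewrite -subr_eq0 opprK -mulr2n -mulr_natr mulf_eq0 negb_or r0.
exact: two_neq0.
Qed.

Lemma rVmonic_size0 m (v : 'rV[F]_m) : m = 0%N -> rVmonic v = 1.
Proof.
case: m v => // v _; apply/polyP => -[|j]; first by rewrite coef_rVmonic_m coef1.
by rewrite nth_default ?coef1 // size_rVmonic.
Qed.

(* (-1) ^+ m * u`_0 is the determinant of the matrices with characteristic
   polynomial u; it is r or - r when u is z-self-reciprocal and r ^+ 2 = z ^+ m. *)
Definition sgn m (r : F) (v : 'rV[F]_m) : bool := (-1) ^+ m * (rVmonic v)`_0 != r.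

Lemma self_recip_sign m z r (v : 'rV[F]_m) : r ^+ 2 = z ^+ m -> self_recip z v ->
  (-1) ^+ m * (rVmonic v)`_0 = (-1) ^+ sgn r v * r.
Proof.
move=> rz /self_recip_coef0; rewrite -rz /sgn => E.
case: eqP => [->|/eqP ne]; rewrite ?expr0 ?mul1r // expr1 mulN1r.
have : ((-1) ^+ m * (rVmonic v)`_0) ^+ 2 == r ^+ 2 by rewrite exprMn sqrr_sign mul1r E.
by rewrite eqf_sqr (negPf ne) => /eqP.
Qed.

(** The difference between the numbers of self-reciprocal polynomials of determinant [r] and of
    determinant [- r]. For odd [m] both are [q^((m-1)/2)]; for even [m] and [r = z ^+ m./2] they are
    [q^(m/2)] and [q^(m/2-1)]. *)
Definition nqm_diff q m : rat := if odd m then 0 else (q%:R - 1) * q%:R ^+ (m %/ 2 - 1).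

Lemma self_recip_sums m z r : (0 < m)%N -> z != 0 -> r ^+ 2 = z ^+ m ->
    (~~ odd m -> r = z ^+ m./2) ->
  (\sum_(v : 'rV[F]_m | self_recip z v) 1 = (nqm #|F| m)%:R :> rat) /\
  (\sum_(v : 'rV[F]_m | self_recip z v) (-1) ^+ sgn r v = nqm_diff #|F| m).
Proof.
move=> m0 z0 rz rev; set q := #|F|.
have r0 : r != 0 by apply: contraNneq z0 => r0; move/esym/eqP: rz; rewrite r0 expr0n expf_eq0 m0.
have rN0 : - r != 0 by rewrite oppr_eq0.
have rNz : (- r) ^+ 2 = z ^+ m by rewrite sqrrN.
have rsplit (f : 'rV[F]_m -> rat) a b :
   (forall v : 'rV[F]_m, (rVmonic v)`_0 = r -> f v = a) ->
   (forall v : 'rV[F]_m, (rVmonic v)`_0 = - r -> f v = b) ->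
   \sum_(v : 'rV[F]_m | self_recip z v) f v =
     a *+ #|[set v : 'rV[F]_m | self_recip z v && ((rVmonic v)`_0 == r)]| +
     b *+ #|[set v : 'rV[F]_m | self_recip z v && ((rVmonic v)`_0 == - r)]|.
  move=> fa fb; rewrite (bigID (fun v : 'rV[F]_m => (rVmonic v)`_0 == r)) /=; congr (_ + _).
    rewrite (eq_bigr (fun=> a)) => [|v /andP[_ /eqP /fa] //].
    rewrite (eq_bigl (fun v =>
      v \in [set v : 'rV[F]_m | self_recip z v && ((rVmonic v)`_0 == r)])) ?sumr_const;
      last by move=> v; rewrite inE.
    by [].
  rewrite (eq_bigr (fun=> b)) => [|v /andP[rv ne]]; last first.
    apply: fb; have := self_recip_coef0 rv.
    by rewrite -rz => /eqP; rewrite eqf_sqr (negPf ne) => /eqP.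
  rewrite (eq_bigl (fun v =>
    v \in [set v : 'rV[F]_m | self_recip z v && ((rVmonic v)`_0 == - r)])) ?sumr_const // => v.
  rewrite inE; case rv: (self_recip z v) => //=; have := self_recip_coef0 rv.
  rewrite -rz => /eqP; rewrite eqf_sqr => /orP[] /eqP->; rewrite eqxx ?(negPf (neq_opp r0)) //=.
  by rewrite eq_sym neq_opp.
have sg (v : 'rV[F]_m) :
  sgn r v = (if odd m then (rVmonic v)`_0 != - r else (rVmonic v)`_0 != r) :> bool.
  rewrite /sgn -signr_odd; case: odd; rewrite ?expr0 ?expr1 ?mul1r //.
  by rewrite mulN1r eqr_oppLR.
have rNr : (r == - r) = false by apply/negbTE/neq_opp.
have rNr' : (- r == r) = false by rewrite eq_sym.
split.
  rewrite (rsplit _ 1 1) // !(card_self_recip m0) // -!natrD /nqm !divn2 -/q.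
  case mo: (odd m) => /=.
    by rewrite subn1 mul2n -addnn.
  rewrite rev ?mo // eqxx; have -> : (- z ^+ m./2 == z ^+ m./2) = false by rewrite -rev ?mo // rNr'.
  have -> : (m.-1./2 = m./2 - 1)%N by lia.
  by congr (_%:R); rewrite mulnDl mul1n -expnS; congr (_ ^ _ + _)%N; lia.
rewrite (rsplit _ ((-1) ^+ odd m) (- (-1) ^+ odd m)); last 2 first.
- by move=> v vr; rewrite sg vr eqxx rNr; case: odd.
- by move=> v vr; rewrite sg vr eqxx rNr'; case: odd; rewrite /= ?expr1 ?expr0 ?opprK.
rewrite !(card_self_recip m0) // /nqm_diff !divn2 -/q.
case mo: (odd m) => /=; first by rewrite -mulrnDl addrN mul0rn.
rewrite rev ?mo // eqxx; have -> : (- z ^+ m./2 == z ^+ m./2) = false by rewrite -rev ?mo // rNr'.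
have -> : (m.-1./2 = m./2 - 1)%N by lia.
rewrite !expr0 mulNrn mulrBl mul1r -exprS -!natrX; congr (_ *+ (_ ^ _) - _); lia.
Qed.

Section Family.

Variables (k : nat) (nu : 'I_k -> nat) (z : F) (r : 'I_k -> F).
Hypotheses (z0 : z != 0) (rz : forall i, r i ^+ 2 = z ^+ nu i).
Hypothesis rev : forall i, ~~ odd (nu i) -> r i = z ^+ (nu i)./2.

Definition rV_family := fprod (fun i : 'I_k => 'rV[F]_(nu i)).

Definition fam_recip (v : rV_family) := [forall i, self_recip z (v i)].

(** The weight [i] appears because the top block of a chain of length [i] enters the determinant [i]
    times. *)
Definition fam_sign (v : rV_family) := odd (\sum_(i < k) i * sgn (r i) (v i)).

(** The indicator of the parity is half of 1 plus a product of signs, and both sums factor over [i].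
    The sign at [i] is raised to the power [i], so only odd [i] see the difference [nqm_diff]. *)
Lemma fam_sums b : \sum_(v : rV_family | fam_recip v && (fam_sign v == b)) 1 =
  (\prod_(i < k | (0 < nu i)%N) (nqm #|F| (nu i))%:R +
   (-1) ^+ b * \prod_(i < k | (0 < nu i)%N)
     (if odd i then nqm_diff #|F| (nu i) else (nqm #|F| (nu i))%:R)) / 2%:R :> rat.
Proof.
have prodE (P : forall i, 'rV[F]_(nu i) -> rat) :
    \sum_(v | fam_recip v) \prod_i P i (v i) = \prod_i \sum_(x | self_recip z x) P i x.
  transitivity (\prod_i \sum_x (if self_recip z x then P i x else 0)); last first.
    by apply: eq_bigr => i _; rewrite -big_mkcond.
  rewrite (prod_sum_fprod (fun i x => if self_recip z x then P i x else 0)).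
  rewrite big_mkcond; apply: eq_bigr => v _; rewrite /fam_recip.
  case: ifP => [/forallP fv|/negbT]; first by apply: eq_bigr => i _; rewrite fv.
  by rewrite negb_forall => /existsP[i iv]; rewrite (bigD1 i) //= (negPf iv) mul0r.
have one i : nu i = 0%N -> forall x : 'rV[F]_(nu i), self_recip z x /\ sgn (r i) x = false.
  move=> i0 x; have xE := rVmonic_size0 x i0.
  split; last by rewrite /sgn xE coef1 mulr1 rev i0 ?expr0 ?eqxx.
  rewrite /self_recip xE coef1 oner_eq0 /=; apply/forallP => -[j jm] /=.
  by move: jm; rewrite i0 ltnS leqn0 => /eqP->; rewrite subn0 coef1 expr0 !mulr1.
have card1 i : nu i = 0%N -> #|{: 'rV[F]_(nu i)}| = 1%N by move=> i0; rewrite card_mx i0 muln0.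
have sum1 i (P : 'rV[F]_(nu i) -> rat) : nu i = 0%N -> (forall x, P x = 1) ->
  \sum_(x | self_recip z x) P x = 1.
  move=> i0 P1; rewrite (eq_bigr (fun=> 1)) // (eq_bigl predT) => [|x];
    last by rewrite (one i i0 x).1.
  by rewrite sumr_const card1.
transitivity (\sum_(v | fam_recip v)
   (1 + (-1) ^+ b * \prod_i ((-1) ^+ sgn (r i) (v i)) ^+ i) / 2%:R : rat).
  rewrite big_mkcondr; apply: eq_bigr => v _.
  have -> : \prod_(i < k) ((-1) ^+ sgn (r i) (v i)) ^+ i = (-1) ^+ fam_sign v :> rat.
    by rewrite signr_odd -prodrXr; apply: eq_bigr => i _; rewrite -exprM mulnC.
  by case: (fam_sign v); case: b.
rewrite -mulr_suml big_split /= -mulr_sumr; congr ((_ + _ * _) / _).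
  transitivity (\sum_(v | fam_recip v) \prod_(i < k) (1 : rat)).
    by apply: eq_bigr => v _; rewrite big1.
  rewrite (prodE (fun _ _ => 1)) [RHS]big_mkcond; apply: eq_bigr => i _.
  case: posnP => i0; first exact: sum1.
  by have [] := self_recip_sums i0 z0 (rz i) (@rev i).
rewrite (prodE (fun i x => ((-1) ^+ sgn (r i) x) ^+ i)) [RHS]big_mkcond; apply: eq_bigr => i _.
case: posnP => i0.
  by apply: sum1 => // x; rewrite (one i i0 x).2 expr0 expr1n.
have [s1 s2] := self_recip_sums i0 z0 (rz i) (@rev i).
case: ifP => io.
  by rewrite -s2; apply: eq_bigr => x _; rewrite -exprM mulnC exprM -signr_odd io expr1.
by rewrite -s1; apply: eq_bigr => x _; rewrite -exprM mulnC exprM -signr_odd io expr0 expr1n.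
Qed.

End Family.

End Signs.

(** * Reversing elements *)

Section RealPairs.
Local Open Scope group_scope.
Variable gT : finGroupType.
Implicit Types G : {group gT}.

Definition reversers (G : {set gT}) (z x : gT) := [set y in G | y * x * y^-1 == z * x^-1].

Lemma mem_classT (x w : gT) : w \in x ^: [set: gT] <-> exists y, y * x * y^-1 = w.
Proof.
split=> [/imsetP[y _ ->]|[y <-]]; first by exists y^-1; rewrite invgK conjgE mulgA.
by apply/imsetP; exists y^-1; rewrite ?inE // conjgE invgK mulgA.
Qed.

(** The map sending [x] to [z * x^-1] is an involution when [z] commutes with [x] and [y]. *)
Lemma reverser_sq_comm (z x y : gT) : commute z x -> commute z y ->
  y * x * y^-1 = z * x^-1 -> x * (y * y) = y * y * x.
Proof.
move=> zx zy yx.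
have yx1 : y * x = z * x^-1 * y by rewrite -yx mulgKV.
have yx2 : y * x^-1 = x * z^-1 * y.
  by have := congr1 invg yx; rewrite !invMg !invgK mulgA => <-; rewrite mulgKV.
rewrite -[RHS]mulgA yx1 !mulgA -zy -(mulgA z y) yx2 !mulgA zx.
by rewrite -(mulgA x z) mulgV mulg1.
Qed.

Lemma card_reversers G z x y0 : x \in G -> y0 \in reversers G z x ->
  #|reversers G z x| = #|'C_G[x]|.
Proof.
move=> xG; rewrite inE => /andP[y0G /eqP y0x].
rewrite -[RHS](card_lcoset _ y0); apply: eq_card => y; rewrite mem_lcoset in_setI inE.
rewrite groupMl ?groupV //; case yG: (y \in G) => //=.
have cE w : w * x * w^-1 = x ^ w^-1 by rewrite conjgE invgK mulgA.
rewrite -y0x !cE; apply/eqP/idP => [yx|/cent1P/commute_sym/commgP/conjg_fixP].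
  by apply/cent1P/commute_sym/commgP/conjg_fixP; rewrite conjgM -yx conjgKV.
by rewrite conjgM => /(canRL (conjgK _)).
Qed.

(** The reversers of a real element form a coset of its centralizer, so the elements of each real
    class contribute [#|G|] altogether. *)
Lemma card_real_classes G :
  (#|real_classes G| * #|G| = \sum_(x in G) #|reversers G 1 x|)%N.
Proof.
have rev1 x : x \in G -> #|reversers G 1 x| = if is_real G x then #|'C_G[x]| else 0%N.
  move=> xG; case: ifP => [/existsP[y /andP[yG yx]]|nr].
    by apply: (@card_reversers _ _ _ y); rewrite // inE yG mul1g.
  apply/eqP; rewrite cards_eq0 -subset0; apply/subsetP => y; rewrite inE mul1g => yG.
  by move: nr; rewrite /is_real => /existsP[]; exists y.
rewrite (eq_bigr _ rev1) -big_mkcondr /=.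
have realJ x y : y \in G -> is_real G x -> is_real G (x ^ y).
  move=> yG /existsP[h /andP[hG /eqP hx]]; apply/existsP; exists (h ^ y).
  by rewrite groupJ //= -!conjVg -!conjMg hx conjVg.
rewrite (set_partition_big_cond _ (classes_partition G)) /=.
rewrite -sum_nat_const [LHS](eq_bigl (fun C => (C \in classes G) && (C \in real_classes G)));
  last first.
  by move=> C; rewrite inE andbA andbb.
rewrite [LHS]big_mkcondr; apply: eq_bigr => _ /imsetP[x xG ->].
rewrite inE mem_classes //=; case: ifP => [/forallP rC|/negbT].
  rewrite (eq_bigl (fun y => y \in x ^: G)) => [|y]; last first.
    by case yC: (y \in _) => //=; have := rC y; rewrite yC.
  rewrite (eq_bigr (fun=> #|'C_G[x]|)) => [|y /class_eqP yx].
    by rewrite sum_nat_const -index_cent1 mulnC Lagrange // subsetIl.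
  have := Lagrange (subsetIl G 'C[x]); have := Lagrange (subsetIl G 'C[y]).
  rewrite !index_cent1 yx => <- /eqP; rewrite eqn_pmul2r ?card_gt0; first by move/eqP.
  by apply/set0Pn; exists x; apply: class_refl.
rewrite negb_forall => /existsP[y]; rewrite negb_imply => /andP[yC yr].
rewrite big_pred0 // => w; case wC: (w \in _) => //=; apply: contraNF yr => wr.
have /imsetP[h hG ->] : y \in w ^: G by rewrite (class_eqP wC).
exact: realJ.
Qed.

End RealPairs.

Section RealQuotient.
Local Open Scope group_scope.
Variable gT : finGroupType.
Implicit Types G : {group gT}.

Lemma sum_quotient G (Z : {group gT}) (f : coset_of Z -> nat) : Z <| G ->
  (\sum_(x in G) f (coset Z x) = #|Z| * \sum_(X in G / Z) f X)%N.
Proof.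
move=> nZG; rewrite (partition_big (coset Z) (mem (G / Z))) /=; last first.
  by move=> x xG; apply: mem_quotient.
rewrite big_distrr /=; apply: eq_bigr => X XG.
rewrite (eq_bigr (fun=> f X)) => [|x /andP[_ /eqP->] //].
rewrite sum_nat_const; congr (_ * _)%N.
have [x xN xG XE] := morphimP XG.
rewrite -[RHS](card_rcoset Z x); apply: eq_card => y.
rewrite -[LHS]/((y \in G) && (coset Z y == X)).
have -> : Z :* x = X :> {set gT} by rewrite XE val_coset.
apply/andP/idP => [[yG /eqP <-]|yX]; first by rewrite val_coset ?rcoset_refl //
  (subsetP (normal_norm nZG)).
split; last by rewrite (coset_mem yX).
move: yX; rewrite XE val_coset // => /rcosetP[w wZ ->].
by rewrite groupM // (subsetP (normal_sub nZG)).
Qed.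

(** Each pair in the quotient lifts to [#|Z| ^ 2] pairs of [G], and the lifts with
    [y * x * y^-1 * x] in [Z] are sorted by the value [z] of this product. *)
Lemma card_real_classes_quotient G (Z : {group gT}) : Z <| G ->
  (#|real_classes (G / Z)| * #|G| * #|Z| =
    \sum_(z in Z) \sum_(x in G) #|reversers G z x|)%N.
Proof.
move=> nZG; have sZG := normal_sub nZG; have nG := subsetP (normal_norm nZG).
have cGZ : (#|(G / Z)%G| * #|Z| = #|G|)%N by rewrite card_quotient ?normal_norm // mulnC Lagrange.
have Q := card_real_classes (G / Z)%G.
have -> : (#|real_classes (G / Z)| * #|G| * #|Z| =
  #|Z| * (#|Z| * (#|real_classes (G / Z)| * #|(G / Z)%G|)))%N.
  by rewrite -cGZ; ring.
rewrite Q -(sum_quotient (fun X => #|reversers (G / Z) 1 X|) nZG) big_distrr exchange_big /=.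
apply: eq_bigr => x xG.
transitivity ((\sum_(y in G) ((y * x * y^-1 * x)%g \in Z))%N).
  have -> : (#|reversers (G / Z) 1 (coset Z x)| =
     \sum_(Y in G / Z) ((Y * coset Z x * Y^-1 * coset Z x)%g == 1%g))%N.
    rewrite -sum1_card big_mkcond [in RHS]big_mkcond /=; apply: eq_bigr => Y _; rewrite inE.
    by case: (Y \in _) => //=; rewrite mul1g eq_mulgV1 invgK; case: eqP.
  rewrite -(sum_quotient (fun Y => ((Y * coset Z x * Y^-1 * coset Z x)%g == 1%g) : nat) nZG).
  apply: eq_bigr => y yG; have yN := nG _ yG; have xN := nG _ xG.
  have -> : coset Z y * coset Z x * (coset Z y)^-1 * coset Z x = coset Z (y * x * y^-1 * x).
    by rewrite -morphV // -!morphM ?groupM ?groupV.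
  congr nat_of_bool; apply/eqP/idP => [/coset_idr|]; last exact: coset_id.
  by apply; rewrite !groupM ?groupV.
rewrite [RHS](eq_bigr (fun z => \sum_(y in G) ((y * x * y^-1 * x)%g == z))%N) => [|z zZ];
  last first.
  rewrite -sum1_card big_mkcond [in RHS]big_mkcond /=; apply: eq_bigr => y _; rewrite inE.
  case: (y \in G) => //=; rewrite -(can2_eq (mulgK x) (mulgKV x)).
  by case: eqP.
rewrite exchange_big /=; apply: eq_bigr => y yG.
case: (boolP (_ \in Z)) => wZ.
  by rewrite (bigD1 _ wZ) eqxx big1 //= => z /andP[_ /negPf]; rewrite eq_sym => ->.
by rewrite big1 // => z zZ; case: eqP wZ => // ->; rewrite zZ.
Qed.

End RealQuotient.

(** * Determinants of centralizers and counting of reversers in SL *)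

Section DetMorphism.

Variables (F : finFieldType) (p n : nat).
Hypotheses (pF : p \in [pchar F]) (p_odd : odd p).
Local Notation GL := [the finGroupType of {'GL_n.+1[F]}].
Local Notation SL := (SLgroup_group n.+1 F).
Implicit Types g x : GL.

Lemma det_unit g : \det (GLval g) \is a GRing.unit.
Proof. by have := GL_unit g; rewrite -[_ \is a _]/(_ \in unitmx) unitmxE. Qed.

Definition detGL g : {unit F} := FinRing.unit F (det_unit g).

Lemma detGLM : {in [set: GL] &, {morph detGL : x y / (x * y)%g}}.
Proof. by move=> x y _ _; apply: val_inj; rewrite /= det_mulmx. Qed.

Canonical detGL_morphism := Morphism detGLM.

Lemma ker_detGL : ('ker detGL = SLgroup n.+1 F)%g.
Proof.
apply/setP => x; rewrite !inE /= -val_eqE /=; congr (_ == _).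
Qed.

Variables (x : GL) (nu : multiplicities n.+1) (S : forall i, 'M[F]_(nu i)).
Hypotheses (xS : jordan_data p x S) (pS : forall i, pprime_mx (S i)).
Let h := part_h #|F| nu.

Lemma part_h_gt0 : (0 < h)%N.
Proof. by rewrite gcdn_gt0 subn_gt0 finNzRing_gt1. Qed.

Lemma part_h_dvd (i : 'I_n.+2) : (0 < nu i)%N -> (h %| i)%N.
Proof.
move=> nui; apply: (dvdn_trans (dvdn_gcdr _ _)).
by rewrite (bigD1 i) //= dvdn_gcdl.
Qed.

Lemma card_detGL_cent : #|(detGL @* 'C[x])%g| = ((#|F| - 1) %/ h)%N.
Proof.
have /cyclicP[w wE] := field_unit_group_cyclic [set: {unit F}]%G.
have ow : #[w]%g = (#|F| - 1)%N by rewrite orderE -wE card_finField_unit subn1.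
have -> : (detGL @* 'C[x] = <[w ^+ h]>)%g.
  apply/setP=> u; apply/morphimP/cycleP => [[y _ /cent1P yx ->]|[k ->]].
    have [d dE] := cent_det_exp pF p_odd xS (commute_sym yx) part_h_dvd.
    have d0 : d != 0.
      apply: contraTneq (det_unit y) => d0.
      by rewrite dE d0 expr0n gtn_eqF ?part_h_gt0 // unitr0.
    have /cycleP[k dk] : FinRing.unit F (etrans (unitfE d) d0) \in <[w]>%g by rewrite -wE inE.
    exists k; rewrite -expgM mulnC expgM -dk; apply: val_inj.
    by rewrite /= dE FinRing.val_unitX.
  have wk0 : val (w ^+ k)%g != 0 by rewrite -unitfE; apply: (valP (w ^+ k)%g).
  have [y [xy dy]] := cent_det_gcd pF p_odd xS pS wk0.
  exists y; [by rewrite inE | exact/cent1P/commute_sym |].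
  by apply: val_inj; rewrite /= dy -expgM mulnC expgM FinRing.val_unitX.
by rewrite -orderE orderXdiv ow // dvdn_gcdl.
Qed.

End DetMorphism.

Section SLCount.

Variables (F : finFieldType) (p n : nat).
Hypotheses (pF : p \in [pchar F]) (p_odd : odd p).
Local Notation GL := [the finGroupType of {'GL_n.+1[F]}].
Local Notation SL := (SLgroup_group n.+1 F).
Implicit Types g x : GL.

Lemma card_cent_SL x (nu : multiplicities n.+1) (S : forall i, 'M[F]_(nu i)) :
  jordan_data p x S -> (forall i, pprime_mx (S i)) ->
  (#|'C_SL[x]%g| * (#|F| - 1) = #|'C[x]%g| * part_h #|F| nu)%N.
Proof.
move=> xS pS; have := LagrangeI 'C[x]%G ('ker (@detGL F n))%G.
have -> : (#|'C[x] : 'ker (@detGL F n)|)%g = #|(@detGL F n @* 'C[x])%g|.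
  by rewrite card_morphim setTI.
rewrite (card_detGL_cent pF p_odd xS pS) /= ker_detGL setIC => <-.
by rewrite -mulnA divnK // dvdn_gcdl.
Qed.

Lemma detGL_surj : (@detGL F n @* [set: GL] = [set: {unit F}])%g.
Proof.
apply/setP => u; rewrite [RHS]inE; apply/morphimP.
pose A : 'M[F]_n.+1 := diag_mx (\row_i if i == ord0 then val u else 1).
have dA : \det A = val u.
  by rewrite det_diag big_ord_recl !mxE eqxx big1 ?mulr1 // => i _; rewrite mxE.
have uA : A \in unitmx by rewrite unitmxE dA; apply: (valP u).
exists (FinRing.unit _ uA : GL); rewrite ?inE //.
by apply: val_inj; rewrite /= dA.
Qed.

Lemma card_SL : (#|SL| * (#|F| - 1) = #|[set: GL]|)%N.
Proof.
have := LagrangeI [set: GL]%G ('ker (@detGL F n))%G.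
have -> : (#|[set: GL] : 'ker (@detGL F n)|)%g = #|(@detGL F n @* [set: GL])%g|.
  by rewrite card_morphim setTI.
by rewrite detGL_surj card_finField_unit /= ker_detGL setTI subn1.
Qed.

(** When all elements of a GL-class inside SL have reversers, their numbers add up to
    [part_h #|F| nu * #|SL|], so the class counts [part_h #|F| nu] times. *)
Lemma card_reversers_SL x z (nu : multiplicities n.+1) (S : forall i, 'M[F]_(nu i)) y0 :
  x \in SL -> jordan_data p x S -> (forall i, pprime_mx (S i)) -> y0 \in reversers SL z x ->
  (#|reversers SL z x| * #|(x ^: [set: GL])%g| = part_h #|F| nu * #|SL|)%N.
Proof.
move=> xSL xS pS y0R; rewrite (card_reversers xSL y0R).
have C := card_cent_SL xS pS; have L := card_SL.
have I := index_cent1 [set: GL]%G x; rewrite /= setTI in I.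
have LC : (#|'C[x]%g| * #|[set: GL] : 'C[x]%g|%g)%N = #|[set: GL]|.
  by rewrite Lagrange // subsetT.
rewrite I in LC; have q0 : (0 < #|F| - 1)%N by rewrite subn_gt0 finNzRing_gt1.
apply/eqP; rewrite -(eqn_pmul2r q0); apply/eqP.
rewrite mulnAC C -[RHS]mulnA L -LC; ring.
Qed.

End SLCount.

(** * Which elements are reversed by an element of determinant 1 *)

Section Criterion.

Variables (F : finFieldType) (p n : nat).
Hypotheses (pF : p \in [pchar F]) (p_odd : odd p).
Local Notation GL := [the finGroupType of {'GL_n.+1[F]}].
Local Notation SL := (SLgroup_group n.+1 F).
Implicit Types x y z : GL.

Variables (x z : GL) (c : F) (nu : multiplicities n.+1) (S : forall i, 'M[F]_(nu i))
  (v : rV_family F (fun i => nu i : nat)).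
Hypotheses (xS : jordan_data p x S) (pS : forall i, pprime_mx (S i))
  (Sv : forall i, char_poly (S i) = rVmonic (v i)).
Hypotheses (nu0 : nu ord0 = 0%N :> nat) (c0 : c != 0) (zc : GLval z = c%:M).
Let h := part_h #|F| nu.
Let q := #|F|.

Lemma GL_realP : (exists y : GL, (y * x * y^-1 = z * x^-1)%g) <-> fam_recip c v.
Proof.
pose x' : GL := (z * x^-1)%g.
have x'E : GLval x' = c *: (GLval x)^-1.
  by rewrite GL_ME zc /= -mulmxE mul_scalar_mx.
have x'S := jordan_data_scaleV pF p_odd c0 x'E pS xS.
have recE i : self_recip c (v i) <-> char_poly (c *: invmx (S i)) = char_poly (S i).
  have u0 : (rVmonic (v i))`_0 != 0.
    rewrite -Sv char_poly_det mulf_neq0 ?signr_eq0 // -unitfE -unitmxE.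
    exact: pprime_unit.
  rewrite /self_recip u0 -Sv char_poly_scaleV_eq ?pprime_unit //.
  split=> [/forallP H j jn|H]; first by have /eqP := H (Ordinal (jn : (j < (nu i).+1)%N)).
  by apply/forallP => -[j jn]; apply/eqP/H.
have pS' i : pprime_mx (c *: invmx (S i)) by apply: pprime_scaleV.
split=> [[y yx]|/forallP rv].
  apply/forallP => i; apply/recE; case: (posnP i) => [i0|i0].
    have -> : i = ord0 by apply: val_inj.
    by rewrite /char_poly !det_mx_size0.
  symmetry; apply: (jordan_data_unique (g := x') pF p_odd _ x'S i0).
  apply: (jordan_data_class pF p_odd xS).
  by apply/mem_classT; exists y.
apply/mem_classT; apply: (jordan_data_conj pF p_odd xS x'S pS pS') => i.
by symmetry; apply/recE.
Qed.

Hypotheses (hodd : odd q) (n2 : ~~ odd n.+1) (h2 : ((n.+1)`_2 = (q - 1)`_2)%N).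
Hypothesis xSL : x \in SL.

(** The equality of 2-parts carries over to [q - 1] the fact that 4 does not divide [n.+1], so
    [(q - 1)./2] is odd and a square root of [-1] would have [(q - 1)]-th power [-1]. *)
Lemma minus1_nonsquare (w : F) : ~~ (4 %| n.+1)%N -> w ^+ 2 != -1.
Proof.
move=> n4; apply/eqP => w2.
have q2 : (~~ (4 %| q - 1))%N.
  apply: contra n4 => q4; rewrite -[4%N]/(2 ^ 2)%N pfactor_dvdn //.
  have := congr1 (logn 2) h2; rewrite !logn_part => ->.
  by rewrite -pfactor_dvdn // subn_gt0 finNzRing_gt1.
have w0 : w != 0.
  by apply: contra_eq_neq w2 => ->; rewrite expr0n eq_sym oppr_eq0 oner_eq0.
have := expf_card_pred w0; rewrite -/q -subn1.
have -> : (q - 1 = 2 * ((q - 1)./2))%N by lia.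
rewrite exprM w2 -signr_odd; have -> : odd (q - 1)./2 by lia.
rewrite expr1 => /esym/eqP; rewrite -subr_eq0 opprK -[1 + 1]/(2%:R).
by rewrite -(dvdn_pcharf pF) dvdn_prime2 ?(pcharf_prime pF) // => /eqP p2; move: p_odd; rewrite p2.
Qed.

Lemma SL_realP : (exists y : GL, y \in reversers SL z x) <->
  fam_recip c v && (has_odd_part nu || (4 %| n.+1)%N).
Proof.
rewrite -(rwP andP) -GL_realP.
pose x' : GL := (z * x^-1)%g.
have x'E : GLval x' = c *: (GLval x)^-1.
  by rewrite GL_ME zc /= -mulmxE mul_scalar_mx.
have hi i : (0 < nu i)%N -> (h %| i)%N by apply: part_h_dvd.
have evnu : ~~ has_odd_part nu -> forall i : 'I_n.+2, (0 < nu i)%N -> ~~ odd i.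
  by rewrite negb_exists => /forallP H i nui; have := H i; rewrite nui andbT.
have hev : ~~ has_odd_part nu -> (2 %| h)%N.
  move=> /evnu ev; rewrite dvdn_gcd dvdn2 oddB ?finNzRing_gt1 ?hodd //=
    ?(ltnW (finNzRing_gt1 F)) //.
  apply: (big_ind (fun k => 2 %| k)%N) => // [a b ha hb|i /ev]; last by rewrite dvdn2.
  by rewrite dvdn_gcd ha hb.
split=> [[y]|[[y yx] reversible]].
  rewrite inE => /andP[ySL /eqP yx]; split; first by exists y.
  case: (boolP (has_odd_part nu)) => //= /[dup] /evnu ev /hev h2'.
  have yx' : (x' * y = y * x)%g by rewrite /x' -yx mulgKV.
  have [d] := reverser_det pF p_odd xS c0 x'E yx' hi ev.
  move: ySL; rewrite inE => /eqP->; apply: contra_eqT => n4.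
  have -> : (h = h./2 * 2)%N by lia.
  have -> : (-1) ^+ (n.+1)./2 = -1 :> F.
    by rewrite -signr_odd; have -> : odd (n.+1)./2 by lia.
  rewrite mulN1r eq_sym eqr_oppLR exprM; exact: minus1_nonsquare.
have [D dD] : exists D, \det (GLval y) = D ^+ h.
  case: (boolP (has_odd_part nu)) reversible => [odp _|/evnu ev n4]; last first.
    have yx' : (x' * y = y * x)%g by rewrite /x' -yx mulgKV.
    have [d ->] := reverser_det pF p_odd xS c0 x'E yx' hi ev.
    exists d; rewrite -signr_odd; have -> : odd (n.+1)./2 = false by lia.
    by rewrite expr0 mul1r.
  have hodd' : odd h.
    have /existsP[i /andP[oi nui]] := odp.
    exact: dvdn_odd (hi i nui) oi.
  have zC g : commute z g by apply: GL_inj; rewrite !GL_ME zc -!mulmxE scalar_mxC.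
  have xyy := reverser_sq_comm (zC x) (zC y) yx.
  have [d dE] := cent_det_exp pF p_odd xS xyy hi.
  rewrite GL_ME det_mulmx in dE.
  (* [y * y] centralizes [x], so [(\det y) ^+ 2 = d ^+ h]; as [h] is odd, [\det y = (\det y) ^+ h.+1
     / (\det y) ^+ h] is an [h]-th power. *)
  exists (d ^+ (h.+1)./2 / \det (GLval y)); rewrite expr_div_n -exprM mulnC exprM -dE.
  have dy0 : \det (GLval y) != 0 by exact: GL_det.
  apply: (canRL (mulfK _)); first by rewrite expf_neq0.
  by rewrite -expr2 -exprM -exprS; congr (_ ^+ _); lia.
have D0 : D != 0.
  apply: contraTneq (GL_det y) => D0.
  by rewrite dD D0 expr0n gtn_eqF ?part_h_gt0 // negbK.
(* A centralizing element of determinant [D^-1 ^+ h] corrects [y] without affecting the conjugation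
   of [x]. *)
have [w [xw dw]] := cent_det_gcd pF p_odd xS pS (invr_neq0 D0).
exists (y * w)%g; rewrite !inE; apply/andP; split.
  by rewrite GL_ME det_mulmx dw dD -exprMn mulfV // expr1n.
by rewrite invMg !mulgA -(mulgA y w) -xw mulgA mulgK yx.
Qed.

Lemma jordan_data_det : \det (GLval x) = \prod_(i < n.+2) ((-1) ^+ nu i * (rVmonic (v i))`_0) ^+ i.
Proof.
have [E [cE Es]] := xS.
have Ns : nil_part p x *m ss_part p x = 1 *: (ss_part p x *m nil_part p x)
  by rewrite scale1r (ss_nil_part_comm pF p_odd).
rewrite -(det_ss_part pF x) (chain_det (X := fun i _ => S i) cE); last first.
  by move=> i j ji; rewrite (chains_comm Ns Es) expr1n scale1r.
apply: eq_bigr => i _; rewrite prodr_const card_ord -Sv char_poly_det.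
by rewrite mulrA -expr2 sqrr_sign mul1r.
Qed.

End Criterion.

(** * The summands of the formula *)

Section PSLFormula.

Variables (n q : nat) (nu : multiplicities n.+1).
Hypothesis nuP : is_partition nu.

Definition all_even := [forall i, ~~ odd (nu i)].
Definition prod_diff : rat := \prod_(i < n.+2 | (0 < nu i)%N)
  (if odd i then nqm_diff q (nu i) else (nqm q (nu i))%:R).

Lemma prod_nqmE : (prod_nqm q nu)%:R = \prod_(i < n.+2 | (0 < nu i)%N) (nqm q (nu i))%:R :> rat.
Proof. by rewrite natr_prod. Qed.

Lemma prod_diff_no_odd : ~~ has_odd_part nu -> prod_diff = (prod_nqm q nu)%:R.
Proof.
rewrite negb_exists prod_nqmE => /forallP ev; apply: eq_bigr => i nui.
by have := ev i; rewrite nui andbT => /negPf->.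
Qed.

(** Explains the three cases of [sl]: without odd parts the two products agree; an odd [i * nu i]
    makes a factor of [prod_diff] vanish; otherwise the odd parts give [(q + 1)^r] and [(q - 1)^r]
    times the same power of [q], whose average is [f_nu]. *)
Lemma sl_prod_diff : sl q nu = ((prod_nqm q nu)%:R + prod_diff) / 2%:R.
Proof.
have two : (2%:R : rat) != 0 by [].
rewrite /sl; case: ifP => [/prod_diff_no_odd->|/negbT/negPn odp].
  by field.
case: ifP => [/existsP[i]|/negbT].
  rewrite oddM => /andP[oi on]; rewrite mulrC /prod_diff (bigD1 i) /=; last first.
    by case: (nat_of_ord (nu i)) on.
  by rewrite oi /nqm_diff on mul0r addr0.
rewrite negb_exists => /forallP ev.
have evi (i : 'I_n.+2) : odd i -> odd (nu i) = false.
  by move=> oi; have := ev i; rewrite oddM oi => /negbTE.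
rewrite prod_nqmE /prod_diff /f_nu.
set r := #|_|.
have card_r : r = #|[pred i : 'I_n.+2 | (0 < nu i)%N && odd i]|.
  by apply: eq_card => i; rewrite !inE andbC.
have oddE (a : rat) (f : 'I_n.+2 -> rat) :
   (forall i : 'I_n.+2, (0 < nu i)%N && odd i -> f i = a * q%:R ^+ (nu i %/ 2 - 1)) ->
   \prod_(i < n.+2 | (0 < nu i)%N && odd i) f i =
   a ^+ r * \prod_(i < n.+2 | odd i && (0 < nu i)%N) q%:R ^+ (nu i %/ 2 - 1).
  move=> fE; rewrite (eq_bigr _ fE) big_split /= card_r prodr_const; congr (_ * _).
  by apply: eq_bigl => i; rewrite andbC.
have evE (f : 'I_n.+2 -> rat) : (forall i : 'I_n.+2, ~~ odd i -> f i = (nqm q (nu i))%:R) ->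
   \prod_(i < n.+2 | (0 < nu i)%N && ~~ odd i) f i =
   \prod_(i < n.+2 | ~~ odd i && (0 < nu i)%N) (nqm q (nu i))%:R.
  move=> fE; apply: eq_big => [i|i /andP[_ oi]]; first by rewrite andbC.
  exact: fE.
rewrite [X in _ = (X + _) / _](bigID (fun i : 'I_n.+2 => odd i)) /=.
rewrite [X in _ = (_ + X) / _](bigID (fun i : 'I_n.+2 => odd i)) /=.
rewrite (oddE (q%:R + 1)) => [|i /andP[_ oi]]; last first.
  by rewrite /nqm evi // natrM natrD natrX.
rewrite (oddE (q%:R - 1)) => [|i /andP[_ oi]]; last first.
  by rewrite oi /nqm_diff evi.
rewrite !evE // => [|i /negPf-> //].
by move: (\prod_(i < _ | odd _ && _) _) (\prod_(i < _ | ~~ odd _ && _) _) => a b; field.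
Qed.

Lemma part_dE : (1 < part_d nu)%N = all_even /\ (part_d nu == 1)%N = ~~ all_even.
Proof.
set g := (\big[gcdn/0]_(i < n.+2) (nu i : nat))%N.
(* A zero gcd would make all multiplicities vanish, against their weighted sum [n.+1]. *)
have g0 : (0 < g)%N.
  rewrite lt0n; apply/negP => /eqP g0; move: nuP => /andP[_ /eqP].
  rewrite big1 // => i _; have : (g %| nu i)%N by rewrite /g (bigD1 i) //= dvdn_gcdl.
  by rewrite g0 dvd0n => /eqP->; rewrite muln0.
have gev : (2 %| g)%N = all_even.
  apply/idP/forallP => [g2 i|ev].
    by rewrite -dvdn2; apply: dvdn_trans g2 _; rewrite /g (bigD1 i) //= dvdn_gcdl.
  by apply: (big_ind (fun k => 2 %| k)%N) => // [a b ha hb|i _]; rewrite ?dvdn_gcd ?ha // dvdn2.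
have E : (g`_2 == 1)%N = ~~ all_even.
  rewrite -gev p_part -[in RHS](expn1 2) pfactor_dvdn //.
  by case: (logn 2 g) => // k; rewrite expnS; lia.
split; last exact: E.
rewrite /part_d -/g -[RHS]negbK -E; have := part_gt0 2%N g.
by case: (g`_2)%N => [|[|k]].
Qed.

(** The two inner terms are the contributions of square and nonsquare scalars, each kind being half
    of the center. When all multiplicities are even they add up to [prod_nqm]. *)
Lemma psl_prod_diff : psl q nu =
  (if has_odd_part nu || (4 %| n.+1)%N then
    (((prod_nqm q nu)%:R + prod_diff) / 2%:R +
     (if all_even then ((prod_nqm q nu)%:R - prod_diff) / 2%:R else 0)) / 2%:R
   else 0).
Proof.
have [d1 d2] := part_dE; rewrite /psl d1 d2 sl_prod_diff.
have two : (2%:R : rat) != 0 by [].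
case: (boolP (has_odd_part nu)) => [odp|/prod_diff_no_odd->];
  case: (4 %| n.+1)%N; case: all_even; rewrite /= ?andbF ?andbT //; by field.
Qed.

End PSLFormula.

(** * Classes of GL indexed by partitions and families of polynomials *)

Section ClassIndex.

Variables (F : finFieldType) (p n : nat).
Hypotheses (pF : p \in [pchar F]) (p_odd : odd p).
Local Notation GL := [the finGroupType of {'GL_n.+1[F]}].
Local Notation fam nu := (rV_family F (fun i : 'I_n.+2 => (nu : multiplicities n.+1) i : nat)).
Implicit Types (x y : GL) (nu : multiplicities n.+1).

Definition class_data x nu (v : fam nu) := exists S : forall i, 'M[F]_(nu i),
  [/\ jordan_data p x S, forall i, pprime_mx (S i) & forall i, char_poly (S i) = rVmonic (v i)].

Definition nonsing nu (v : fam nu) := [forall i, (rVmonic (v i))`_0 != 0].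

Lemma class_data_class x y nu (v : fam nu) : class_data x v -> y \in (x ^: [set: GL])%g ->
  class_data y v.
Proof.
by move=> [S [xS pS Sv]] yx; exists S; split=> //; apply: jordan_data_class xS yx.
Qed.

Lemma class_data_conj x y nu (v : fam nu) : class_data x v -> class_data y v ->
  y \in (x ^: [set: GL])%g.
Proof.
move=> [S [xS pS Sv]] [S' [yS' pS' S'v]]; apply: jordan_data_conj xS yS' pS pS' _ => //.
by move=> i; rewrite Sv S'v.
Qed.

Lemma class_data_realize nu (v : fam nu) : is_partition nu -> nonsing v -> exists x, class_data x v.
Proof.
move=> /andP[_ /eqP dim] /forallP v0.
have H i : exists2 S : 'M[F]_(nu i), pprime_mx S & char_poly S = rVmonic (v i).
  exact: pprime_char_poly (rVmonic_monic _) (size_rVmonic _) (v0 i).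
have [S pS Sv] := fin_all_exists2 H.
have [x xS] := jordan_data_realize pF p_odd dim pS.
by exists x, S.
Qed.

Lemma jordan_data_multiplicities x : exists nu S,
  [/\ is_partition nu, @jordan_data F p n x (fun i => nu i) S & forall i, pprime_mx (S i)].
Proof.
have [nu0 [S0 [[E0 [cE Es]] nu00 pS0]]] := jordan_data_exists pF p_odd x.
have dim := chain_dim cE.
have nub i : (nu0 i < n.+2)%N.
  rewrite ltnS -[leqRHS]dim (bigD1 i) //=; case: (posnP i) => [i0|i0].
    have -> : i = ord0 by apply: val_inj.
    by rewrite nu00.
  by apply: leq_trans (leq_addr _ _); rewrite leq_pmull.
pose nu : multiplicities n.+1 := [ffun i => Ordinal (nub i)].
have nuE i : nu0 i = nu i by rewrite ffunE.
(* Transport along [nu0 i = nu i] retains only the row space of [E0 i], which suffices for a chain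
   basis and keeps casts out of the statement. *)
have H i : exists ES : 'M[F]_(nu i, n.+1) * 'M[F]_(nu i),
  [/\ (ES.1 :=: E0 i)%MS, ES.1 *m ss_part p x = ES.2 *m ES.1 & pprime_mx ES.2].
  move: (E0 i) (S0 i) (Es i) (pS0 i); case: (nat_of_ord (nu i)) / (nuE i) => E S ? ?.
  by exists (E, S).
have [ES HES] := fin_all_exists H.
exists nu, (fun i => (ES i).2); split; last by move=> i; have [] := HES i.
- apply/andP; split; first by rewrite -val_eqE /= ffunE /= nu00.
  by rewrite -[eqbRHS]dim; apply/eqP/eq_bigr => i _; rewrite nuE.
exists (fun i => (ES i).1); split; last by move=> i; have [] := HES i.
split=> [i||].
- have [EE _ _] := HES i; apply/eqP; rewrite -submx0 (eqmxMr _ EE).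
  rewrite (chain_nil cE); exact: sub0mx.
- rewrite -sub1mx; apply: (submx_trans (_ : _ <= chain_col 0 (chains (nil_part p x) E0))%MS).
    by rewrite sub1mx (chain_full cE).
  apply/chain_col_sub => i j ji.
  have /chain_col_sub/(_ i j ji) :=
    submx_refl (chain_col 0 (chains (nil_part p x) (fun i => (ES i).1))).
  apply: submx_trans; have [EE _ _] := HES i; rewrite /chains (eqmxMr _ EE); exact: submx_refl.
- by rewrite -[RHS]dim; apply: eq_bigr => i _; rewrite nuE.
Qed.

Lemma class_data_exists x : exists nu (v : fam nu),
  [/\ is_partition nu, nonsing v & class_data x v].
Proof.
have [nu [S [nuP xS pS]]] := jordan_data_multiplicities x.
have H i : exists v : 'rV[F]_(nu i), char_poly (S i) = rVmonic v.
  by apply: rVmonic_surj; [apply: char_poly_monic | apply: size_char_poly].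
have [v Sv] := fin_all_exists H.
exists nu, (fprod_of_fun v : fam nu); split=> //.
  apply/forallP => i; rewrite fprodE -Sv char_poly_det mulf_neq0 ?signr_eq0 //.
  by rewrite -unitfE -unitmxE pprime_unit.
by exists S; split=> // i; rewrite fprodE.
Qed.

Lemma class_data_unique x nu nu' (v : fam nu) (v' : fam nu') :
  is_partition nu -> is_partition nu' -> class_data x v -> class_data x v' ->
  Tagged (fun nu => fam nu) v = Tagged (fun nu => fam nu) v'.
Proof.
move=> /andP[/eqP nu0 _] /andP[/eqP nu'0 _] [S [xS _ Sv]] [S' [xS' _ Sv']].
have uE (i : 'I_n.+2) : (0 < i)%N -> rVmonic (v i) = rVmonic (v' i).
  by move=> i0; rewrite -Sv -Sv'; apply: (jordan_data_unique pF p_odd xS xS').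
have nuE : nu = nu'.
  apply/ffunP => i; case: (posnP i) => [i0|i0].
    by have -> : i = ord0 by [apply: val_inj]; rewrite nu0 nu'0.
  by apply/val_inj; have /(congr1 (fun f : {poly F} => size f)) := uE i i0;
    rewrite !size_rVmonic => -[].
case: nu' / nuE v' nu'0 S' xS' Sv' uE => v' _ S' _ _ uE.
congr Tagged; apply/fprodP => i; case: (posnP i) => [i0|i0].
  have iE : i = ord0 by apply: val_inj.
  rewrite iE; apply/rowP => j.
  by have : (j < 0)%N by apply: leq_trans (ltn_ord j) _; rewrite nu0.
exact/rVmonic_inj/uE.
Qed.

(** Every element lies in the class of exactly one valid index, by [class_data_exists] and
    [class_data_unique]. Representatives come from finite choice over tagged pairs, with the
    identity at invalid ones. *)
Lemma sum_classes (f : GL -> rat) :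
  exists rep : forall nu, fam nu -> GL,
    (forall nu (v : fam nu), is_partition nu -> nonsing v -> class_data (rep nu v) v) /\
    \sum_x f x = \sum_(nu | is_partition nu) \sum_(v : fam nu | nonsing v)
      \sum_(x in ((rep nu v) ^: [set: GL])%g) f x.
Proof.
pose I := {nu : multiplicities n.+1 & fam nu}.
pose tg nu (v : fam nu) : I := Tagged (fun nu => fam nu) v.
pose valid (d : I) := is_partition (tag d) && nonsing (tagged d).
have [rep repP] : exists rep : I -> GL, forall d, valid d -> class_data (rep d) (tagged d).
  apply: (@fin_all_exists _ (fun=> GL) (fun d x => valid d -> class_data x (tagged d))) => d.
  case vd: (valid d); last by exists 1%g.
  by have /andP[dP dn] := vd; have [x xd] := class_data_realize dP dn; exists x.
exists (fun nu v => rep (tg _ v)); split.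
  by move=> nu v nuP vn; apply: (repP (tg nu v)); apply/andP.
rewrite (sig_big_dep (fun nu => is_partition nu) (fun nu (v : fam nu) => nonsing v)
   (fun nu v => \sum_(x in (rep (tg _ v) ^: [set: GL])%g) f x)) /=.
rewrite (exchange_big_dep predT) //=; apply: eq_bigr => x _.
have [nu [v [nuP vn xv]]] := class_data_exists x.
have key d : valid d && (x \in (rep d ^: [set: GL])%g) = (d == tg nu v).
  apply/andP/eqP => [[vd xd]|->].
    have /andP[dP dn] := vd; have dd := class_data_class (repP _ vd) xd.
    by have := class_data_unique dP nuP dd xv; case: (d).
  have vd : valid (tg nu v) by apply/andP.
  by split=> //; apply: class_data_conj (repP _ vd) xv.
by rewrite (big_pred1 (tg _ v)) // => -[nu' v']; apply: key.
Qed.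

End ClassIndex.

(** * The center of the special linear group *)

Section RootsOfUnity.

Variables (F : finFieldType) (N : nat).
Hypotheses (Fodd : odd #|F|) (h2 : (N`_2 = (#|F| - 1)`_2)%N) (N0 : (0 < N)%N).

Let q' := ((#|F| - 1)`_2^')%N.
Let N' := (N`_2^')%N.

Lemma card_pred_gt0 : (0 < #|F| - 1)%N.
Proof. by rewrite subn_gt0 finNzRing_gt1. Qed.

Lemma card_pred_even : ~~ odd (#|F| - 1).
Proof. by rewrite oddB ?Fodd // ltnW ?finNzRing_gt1. Qed.

Lemma even_of_two_part : ~~ odd N.
Proof.
have /negPf q_ev := card_pred_even.
rewrite -dvdn2 -[2%N]expn1 pfactor_dvdn // -(logn_part 2%N N) h2 logn_part -pfactor_dvdn
  ?card_pred_gt0 //.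
by rewrite expn1 dvdn2 q_ev.
Qed.

Lemma odd_cofactor k : (0 < k)%N -> odd (k`_2^')%N.
Proof. by move=> k0; rewrite -[odd _]negbK -dvdn2 -p'natE // part_pnat. Qed.

(** Both cofactors are odd, so powers by them preserve signs: this is the form in which the equality
    of 2-parts is used. *)
Lemma cofactor_swap : ((#|F| - 1) * N' = N * q')%N.
Proof.
have qE := partnC 2%N card_pred_gt0; have NE := partnC 2%N N0.
by rewrite -qE -[in RHS]NE -h2 /q' /N'; ring.
Qed.

Lemma half_cofactor_swap : ((#|F| - 1)./2 * N' = N./2 * q')%N.
Proof.
have := cofactor_swap; have := card_pred_even; have := even_of_two_part.
rewrite -!(rwP negPf) => nev qev.
rewrite -{1}(odd_double_half N) -{1}(odd_double_half (#|F| - 1)) nev qev !add0n.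
by rewrite -!doubleMl => /double_inj.
Qed.

Lemma minus1_neq1 : (-1 : F) != 1.
Proof.
have [p pp pF] := finPcharP F; have [e Fe] := card_pchar pF.
rewrite eq_sym -subr_eq0 opprK -[1 + 1]/(2%:R) -(dvdn_pcharf pF) dvdn_prime2 //.
by apply: contraTneq Fodd => p2; rewrite Fe p2 oddX /= orbF; case: e Fe (finNzRing_gt1 F) => [->|].
Qed.

(** Euler's criterion: [c ^+ (#|F| - 1)./2] squares to 1 and its odd power by [N'] is 1, so it is 1,
    and the exponent of [c] over a generator is even. *)
Lemma half_root_square (c : F) : c != 0 -> c ^+ N./2 = 1 -> exists y, y ^+ 2 = c.
Proof.
move=> c0 cN.
have s2 : (c ^+ (#|F| - 1)./2) ^+ 2 = 1.
  rewrite -exprM muln2 even_halfK ?card_pred_even // subn1.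
  exact: expf_card_pred.
have sN : (c ^+ (#|F| - 1)./2) ^+ N' = 1 by rewrite -exprM half_cofactor_swap exprM cN expr1n.
have s1 : c ^+ (#|F| - 1)./2 = 1.
  move: sN; rewrite -(odd_double_half N') odd_cofactor // -mul2n exprD exprM s2 expr1n mulr1.
  by rewrite expr1.
have /cyclicP[w wE] := field_unit_group_cyclic [set: {unit F}]%G.
have ow : #[w]%g = (#|F| - 1)%N by rewrite orderE -wE card_finField_unit subn1.
have /cycleP[k ck] : FinRing.unit F (etrans (unitfE c) c0) \in <[w]>%g by rewrite -wE inE.
have cE : c = val (w ^+ k)%g by rewrite -ck.
have : (w ^+ (k * (#|F| - 1)./2) == 1)%g.
  by rewrite -val_eqE expgM FinRing.val_unitX -cE s1.
rewrite -order_dvdn ow.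
have q2 : (#|F| - 1 = 2 * (#|F| - 1)./2)%N by rewrite mul2n even_halfK // card_pred_even.
rewrite {1}q2 dvdn_pmul2r; last by have := card_pred_gt0; lia.
move=> k2; exists (val (w ^+ (k %/ 2))%g).
by rewrite -FinRing.val_unitX -expgM divnK // -cE.
Qed.

(** A square root [w] would have [w ^+ N = -1], whose odd power by [q'] is [-1], although
    [w ^+ ((#|F| - 1) * N') = 1]. *)
Lemma half_root_nonsquare (c w : F) : c ^+ N./2 = -1 -> w ^+ 2 != c.
Proof.
move=> cN; apply/eqP => wc.
have w0 : w != 0.
  apply: contraTneq isT => w0; move: cN; rewrite -wc w0 expr0n /= expr0n.
  have : (0 < N./2)%N by have := even_of_two_part; lia.
  by case: (N./2) => // k _ /esym/eqP; rewrite oppr_eq0 oner_eq0.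
have wN : w ^+ N = -1 by rewrite -cN -wc -exprM mul2n even_halfK // even_of_two_part.
have := expf_card_pred w0; rewrite -subn1 => /(congr1 (fun x => x ^+ N')).
rewrite expr1n -exprM cofactor_swap exprM wN -signr_odd odd_cofactor ?card_pred_gt0 // expr1.
by move/eqP; rewrite (negPf minus1_neq1).
Qed.

Lemma half_root_minus1 : exists z : F, z ^+ N./2 = -1.
Proof.
have /cyclicP[w wE] := field_unit_group_cyclic [set: {unit F}]%G.
have ow : #[w]%g = (#|F| - 1)%N by rewrite orderE -wE card_finField_unit subn1.
exists (val (w ^+ q')%g).
have t2 : (val (w ^+ (#|F| - 1)./2)%g) ^+ 2 = 1.
  rewrite -FinRing.val_unitX -expgM muln2 even_halfK ?card_pred_even // -ow.
  by rewrite expg_order.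
have t1 : val (w ^+ (#|F| - 1)./2)%g = -1.
  move/eqP: t2; rewrite sqrf_eq1 => /orP[|/eqP//].
  rewrite -[1]/(val (1%g : {unit F})) val_eqE -order_dvdn ow => /dvdn_leq.
  by have := card_pred_gt0; have := card_pred_even; lia.
rewrite -FinRing.val_unitX -expgM mulnC -half_cofactor_swap expgM FinRing.val_unitX t1.
by rewrite -signr_odd odd_cofactor // expr1.
Qed.

Lemma half_sign (c : F) : c ^+ N = 1 -> c ^+ N./2 = 1 \/ c ^+ N./2 = -1.
Proof.
move=> cN; have : (c ^+ N./2) ^+ 2 == 1.
  by rewrite -exprM muln2 even_halfK ?even_of_two_part ?cN.
by rewrite sqrf_eq1 => /orP[] /eqP; [left|right].
Qed.

(** Multiplication by a [z] with [z ^+ N./2 = -1] exchanges the two sets. *)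
Lemma card_half_roots :
  #|[set c : F | (c ^+ N == 1) && (c ^+ N./2 != 1)]| =
  #|[set c : F | (c ^+ N == 1) && (c ^+ N./2 == 1)]|.
Proof.
have [z zN] := half_root_minus1.
have z0 : z != 0.
  apply: contraTneq isT => z0; move: zN; rewrite z0 expr0n.
  have : (0 < N./2)%N by have := even_of_two_part; lia.
  by case: (N./2) => // k _ /esym/eqP; rewrite oppr_eq0 oner_eq0.
have zNN : z ^+ N = 1 by rewrite -(even_halfK even_of_two_part) -muln2 exprM zN sqrrN expr1n.
rewrite -[RHS](card_imset _ (mulfI z0)); apply: eq_card => c; rewrite inE.
apply/andP/imsetP => [[/eqP cN cN2]|[d]].
  exists (c / z); last by rewrite mulrCA divff ?mulr1.
  rewrite inE !expr_div_n cN zNN divr1 eqxx /= zN.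
  by case: (half_sign cN) cN2 => ->; rewrite ?eqxx // divff // oppr_eq0 oner_eq0.
rewrite inE => /andP[/eqP dN /eqP dN2] ->.
by rewrite !exprMn dN zNN dN2 zN !mulr1 eqxx minus1_neq1.
Qed.

End RootsOfUnity.

(** * The center of SL consists of scalars *)

Section CenterSL.

Variables (F : finFieldType) (n : nat).
Local Notation GL := [the finGroupType of {'GL_n.+1[F]}].
Local Notation SL := (SLgroup_group n.+1 F).

Definition scalar_GL (c : F) : GL := insubd (1%g : GL) (c%:M : 'M[F]_n.+1).

Lemma scalar_GLE c : c != 0 -> GLval (scalar_GL c) = c%:M.
Proof.
move=> c0; apply: (insubdK (1%g : GL)); rewrite -[_ \in _]/(_ \in unitmx).
by rewrite unitmxE det_scalar unitfE expf_neq0.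
Qed.

Lemma transvection_SL (i j : 'I_n.+1) : i != j ->
  exists x : GL, x \in SL /\ GLval x = 1 + delta_mx i j.
Proof.
move=> ij; pose T : 'M[F]_n.+1 := 1 + delta_mx i j.
have dT : \det T = 1.
  case: (ltngtP i j) => [lt|lt|/val_inj E]; last by rewrite E eqxx in ij.
    rewrite -det_tr det_trig; last first.
      apply/is_trig_mxP => k l kl; rewrite !mxE -val_eqE (gtn_eqF kl) add0r.
      suff -> : (l == i) && (k == j) = false by [].
      by apply/negP => /andP[/eqP E1 /eqP E2]; move: kl; rewrite E1 E2 ltnNge ltnW.
    by apply: big1 => k _; rewrite !mxE eqxx; case: eqP => [->|]; rewrite ?(negPf ij) addr0.
  rewrite det_trig; last first.
    apply/is_trig_mxP => k l kl; rewrite !mxE -val_eqE (ltn_eqF kl) add0r.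
    suff -> : (k == i) && (l == j) = false by [].
    by apply/negP => /andP[/eqP E1 /eqP E2]; move: kl; rewrite E1 E2 ltnNge ltnW.
  by apply: big1 => k _; rewrite !mxE eqxx; case: eqP => [->|]; rewrite ?(negPf ij) addr0.
have uT : T \in unitmx by rewrite unitmxE dT unitr1.
by exists (FinRing.unit _ uT : GL); rewrite inE /= dT.
Qed.

(** Commuting with a transvection is commuting with the elementary matrix [delta_mx i j]; comparing
    entries forces a scalar. *)
Lemma center_SL : (0 < n)%N -> 'Z(SL)%g = [set scalar_GL c | c in [set c | c ^+ n.+1 == 1]].
Proof.
move=> n0; apply/setP => x; apply/centerP/imsetP => [[xSL xC]|[c]].
  have comm i j : i != j -> GLval x *m delta_mx i j = delta_mx i j *m GLval x.
    move=> ij; have [t [tSL tE]] := transvection_SL ij.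
    have := congr1 (@GLval n.+1 F) (xC t tSL); rewrite !GL_ME tE.
    by rewrite mulrDr mulrDl mulr1 mul1r => /addrI.
  have entry (k l i j : 'I_n.+1) : i != j ->
      GLval x k i *+ (l == j) = (GLval x j l) *+ (k == i).
    move=> ij; have /matrixP/(_ k l) := comm i j ij; rewrite !mxE.
    rewrite (bigD1 i) //= [in RHS](bigD1 j) //= !mxE !eqxx /= !big1 ?addr0 =>
      [|m /negPf mi|m /negPf mi].
    - by rewrite andbT mulr_natr mulr_natl.
    - by rewrite mxE mi andbF mul0r.
    - by rewrite mxE mi mulr0.
  have diag i : GLval x i i = GLval x ord0 ord0.
    by case: (eqVneq i ord0) => [->//|i0]; have := entry i ord0 i ord0 i0; rewrite !eqxx.
  have offd (k i : 'I_n.+1) : k != i -> GLval x k i = 0.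
    move=> ki; pose j : 'I_n.+1 := if i == ord0 then ord_max else ord0.
    have ij : i != j.
      rewrite /j; case: (eqVneq i ord0) => [->|//].
      by rewrite -val_eqE /= eq_sym -lt0n.
    by have := entry k j i j ij; rewrite eqxx (negPf ki).
  have xE : GLval x = (GLval x ord0 ord0)%:M.
    apply/matrixP => i j; rewrite [RHS]mxE; case: (eqVneq i j) => [->|ij].
      by rewrite diag mulr1n.
    by rewrite offd.
  set c := GLval x ord0 ord0 in xE.
  have cn : c ^+ n.+1 = 1 by move: xSL; rewrite inE xE det_scalar => /eqP.
  have c0 : c != 0 by apply: contra_eq_neq cn => ->; rewrite expr0n eq_sym oner_eq0.
  by exists c; [rewrite inE cn | apply: GL_inj; rewrite scalar_GLE].
rewrite inE => /eqP cn ->.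
have c0 : c != 0 by apply: contra_eq_neq cn => ->; rewrite expr0n eq_sym oner_eq0.
split; first by rewrite inE scalar_GLE // det_scalar cn.
by move=> y _; apply: GL_inj; rewrite !GL_ME scalar_GLE // -!mulmxE scalar_mxC.
Qed.

Lemma scalar_GL_inj : {in [set c | c ^+ n.+1 == 1] &, injective scalar_GL}.
Proof.
move=> c d; rewrite !inE => /eqP cn /eqP dn /(congr1 (@GLval n.+1 F)).
have nz (e : F) : e ^+ n.+1 = 1 -> e != 0.
  by move=> en; apply: contra_eq_neq en => ->; rewrite expr0n eq_sym oner_eq0.
by rewrite !scalar_GLE ?nz // => /matrixP/(_ ord0 ord0); rewrite !mxE eqxx !mulr1n.
Qed.

End CenterSL.

Lemma mul_halves (K : numFieldType) (h s : K) g :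
  h * (s *+ g) = h * (s / 2%:R) * (g%:R + g%:R).
Proof.
have -> : g%:R + g%:R = 2%:R * g%:R :> K by rewrite mulr_natl mulr2n.
by rewrite -[RHS]mulrA (mulrA (s / _)) divfK ?pnatr_eq0 // mulr_natr.
Qed.

(** * Real classes of the projective special linear group *)

Section Assembly.

Variables (F : finFieldType) (p n : nat).
Hypotheses (pF : p \in [pchar F]) (p_odd : odd p) (Fodd : odd #|F|).
Hypothesis h2 : ((n.+1)`_2 = (#|F| - 1)`_2)%N.
Local Notation GL := [the finGroupType of {'GL_n.+1[F]}].
Local Notation SL := (SLgroup_group n.+1 F).
Local Notation fam nu := (rV_family F (fun i : 'I_n.+2 => (nu : multiplicities n.+1) i : nat)).
Implicit Types (nu : multiplicities n.+1) (c : F).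

Definition family_det1 nu (v : fam nu) :=
  \prod_(i < n.+2) ((-1) ^+ nu i * (rVmonic (v i))`_0) ^+ i == 1.

Definition reversible nu := has_odd_part nu || (4 %| n.+1)%N.

Lemma two_neq0 : (2%:R : F) != 0.
Proof. by have := minus1_neq1 Fodd; rewrite eq_sym -subr_eq0 opprK. Qed.

Lemma n_even : ~~ odd n.+1.
Proof. exact: even_of_two_part Fodd h2 isT. Qed.

(** Determinant and reversibility depend only on the class data, so the summand is constant on the
    class: the splitting number divided by the size of the class, or 0. *)
Lemma sum_reversers_class c nu (v : fam nu) x0 : c != 0 -> is_partition nu -> class_data p x0 v ->
  \sum_(x in (x0 ^: [set: GL])%g)
    (if x \in SL then #|reversers SL (scalar_GL n c) x|%:R / #|SL|%:R else 0) =
  (if [&& family_det1 v, fam_recip c v & reversible nu] then (part_h #|F| nu)%:R else 0) :> rat.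
Proof.
move=> c0 /andP[/eqP nu0 _] x0v.
have nu0' : nu ord0 = 0%N :> nat by rewrite nu0.
have SL0 : (#|SL|%:R : rat) != 0 by rewrite pnatr_eq0 -lt0n cardG_gt0.
have cl0 : (#|(x0 ^: [set: GL])%g|%:R : rat) != 0.
  by rewrite pnatr_eq0 -lt0n; apply/card_gt0P; exists x0; apply: class_refl.
transitivity (\sum_(x in (x0 ^: [set: GL])%g)
  (if [&& family_det1 v, fam_recip c v & reversible nu] then
     (part_h #|F| nu)%:R / #|(x0 ^: [set: GL])%g|%:R else 0 : rat)); last first.
  rewrite sumr_const; case: ifP => _; last by rewrite mul0rn.
  by rewrite -[_ *+ _]mulr_natr divfK.
apply: eq_bigr => x xx0; have [S [xS pS Sv]] := class_data_class pF p_odd x0v xx0.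
have -> : (x \in SL) = family_det1 v.
  by rewrite inE (jordan_data_det pF p_odd xS Sv).
case dv: (family_det1 v) => //=.
have xSL : x \in SL by rewrite inE (jordan_data_det pF p_odd xS Sv).
have R := SL_realP pF p_odd xS pS Sv nu0' c0 (scalar_GLE n c0) Fodd n_even h2 xSL.
case: ifP => [/R[y yR]|/negP nR].
  have := card_reversers_SL pF p_odd xSL xS pS yR.
  have -> : (x ^: [set: GL])%g = (x0 ^: [set: GL])%g by apply: class_eqP.
  move=> /(congr1 (fun k => k%:R : rat)); rewrite !natrM => E.
  by apply: (mulIf SL0); rewrite divfK // mulrAC -E mulfK.
suff -> : reversers SL (scalar_GL n c) x = set0 by rewrite cards0 mul0r.
apply/eqP; rewrite -subset0; apply/subsetP => y yR; case: nR; apply/R.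
by exists y.
Qed.

Lemma fam_recip_nonsing c nu (v : fam nu) : fam_recip c v -> nonsing v.
Proof. by move=> /forallP rv; apply/forallP => i; have /andP[] := rv i. Qed.

Lemma sum_reversers c : c != 0 ->
  \sum_(x in SL) #|reversers SL (scalar_GL n c) x|%:R / #|SL|%:R =
  \sum_(nu | is_partition nu) (if reversible nu then (part_h #|F| nu)%:R else 0) *
     \sum_(v : fam nu | fam_recip c v && family_det1 v) 1 :> rat.
Proof.
move=> c0; rewrite big_mkcond /=.
have [rep [repP ->]] := sum_classes pF p_odd (fun x =>
  if x \in SL then #|reversers SL (scalar_GL n c) x|%:R / #|SL|%:R else 0).
apply: eq_bigr => nu nuP.
rewrite mulr_sumr [RHS]big_mkcond [LHS]big_mkcond; apply: eq_bigr => v _.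
rewrite mulr1; case: (boolP (nonsing v)) => [nv|nv]; last first.
  by case: ifP => // /andP[/fam_recip_nonsing]; rewrite (negPf nv).
rewrite (sum_reversers_class c0 nuP (repP _ _ nuP nv)).
by case: (family_det1 v); case: (fam_recip c v); case: (reversible nu).
Qed.

Lemma family_det1_sign c (r : 'I_n.+2 -> F) (b : bool) nu (v : fam nu) :
  (forall i, r i ^+ 2 = c ^+ nu i) -> \prod_(i < n.+2) r i ^+ i = (-1) ^+ b ->
  fam_recip c v -> family_det1 v = (fam_sign r v == b).
Proof.
move=> rc rb /forallP rv; rewrite /family_det1.
rewrite (eq_bigr (fun i : 'I_n.+2 => (-1) ^+ (i * sgn (r i) (v i)) * r i ^+ i)) => [|i _].
  rewrite big_split /= rb prodrXr -[X in X * _]signr_odd -/(fam_sign r v).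
  have m1 := minus1_neq1 Fodd.
  rewrite -signr_addb; case: (fam_sign r v); case: b {rb};
    by rewrite /= ?expr0 ?expr1 ?eqxx ?(negPf m1).
by rewrite (self_recip_sign (rc i) (rv i)) exprMn -exprM mulnC.
Qed.

(** With [y ^+ 2 = c], the reference roots [r i = y ^+ nu i] have weighted product
    [y ^+ n.+1 = c ^+ (n.+1)./2 = 1], so determinant 1 means an even number of signs. *)
Lemma sum_family_square c nu : is_partition nu -> c ^+ n.+1 = 1 -> c ^+ (n.+1)./2 = 1 ->
  \sum_(v : fam nu | fam_recip c v && family_det1 v) 1 =
  ((prod_nqm #|F| nu)%:R + prod_diff #|F| nu) / 2%:R :> rat.
Proof.
move=> /andP[_ /eqP dim] cn cn2.
have c0 : c != 0 by apply: contra_eq_neq cn => ->; rewrite expr0n eq_sym oner_eq0.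
have [y yc] := half_root_square Fodd h2 isT c0 cn2.
pose r (i : 'I_n.+2) := y ^+ nu i.
have rc i : r i ^+ 2 = c ^+ nu i by rewrite -yc -!exprM mulnC.
have rev i : ~~ odd (nu i) -> r i = c ^+ (nu i)./2.
  by move=> ev; rewrite -yc -exprM mul2n even_halfK.
have rb : \prod_(i < n.+2) r i ^+ i = (-1) ^+ false.
  rewrite (eq_bigr (fun i : 'I_n.+2 => y ^+ (i * nu i))) => [|i _]; last by rewrite -exprM mulnC.
  by rewrite prodrXr dim -(even_halfK n_even) -mul2n exprM yc cn2.
have := fam_sums two_neq0 c0 rc rev false.
rewrite expr0 mul1r -prod_nqmE => <-; apply: eq_bigl => v.
by case rv: (fam_recip c v) => //=; rewrite (family_det1_sign rc rb rv).
Qed.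

(** The reference roots [c ^+ (nu i)./2] have weighted product [c ^+ (n.+1)./2 = -1], which selects
    the families of odd sign. *)
Lemma sum_family_nonsquare c nu : is_partition nu -> c ^+ n.+1 = 1 -> c ^+ (n.+1)./2 != 1 ->
  \sum_(v : fam nu | fam_recip c v && family_det1 v) 1 =
  (if all_even nu then ((prod_nqm #|F| nu)%:R - prod_diff #|F| nu) / 2%:R else 0) :> rat.
Proof.
move=> /andP[_ /eqP dim] cn cn2.
have c0 : c != 0 by apply: contra_eq_neq cn => ->; rewrite expr0n eq_sym oner_eq0.
have cm1 : c ^+ (n.+1)./2 = -1.
  by case: (half_sign Fodd h2 isT cn) cn2 => // ->; rewrite eqxx.
case: ifP => [/forallP ev|/negbT]; last first.
  (* For odd [nu i] the constant term squares to [c ^+ nu i], an odd power of [c], which would make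
     [c] a square. *)
  rewrite negb_forall => /existsP[i]; rewrite negbK => oi; apply: big1 => v /andP[/forallP rv _].
  have /self_recip_coef0 E := rv i.
  have := half_root_nonsquare Fodd h2 isT ((rVmonic (v i))`_0 / c ^+ (nu i)./2) cm1.
  rewrite expr_div_n E -exprM muln2 -{1}(odd_double_half (nu i)) oi exprD expr1 mulfK ?eqxx //.
  by rewrite expf_neq0.
pose r (i : 'I_n.+2) := c ^+ (nu i)./2.
have rc i : r i ^+ 2 = c ^+ nu i by rewrite -exprM muln2 even_halfK.
have rb : \prod_(i < n.+2) r i ^+ i = (-1) ^+ true.
  rewrite (eq_bigr (fun i : 'I_n.+2 => c ^+ (i * (nu i)./2))) => [|i _];
    last by rewrite -exprM mulnC.
  rewrite prodrXr expr1 -cm1; congr (_ ^+ _).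
  rewrite -[in RHS]dim -[LHS]doubleK; congr half.
  rewrite -muln2 big_distrl /=; apply: eq_bigr => i _.
  by rewrite -mulnA muln2 even_halfK.
have := fam_sums two_neq0 c0 rc (fun i _ => erefl (r i)) true.
rewrite expr1 mulN1r -prod_nqmE => <-; apply: eq_bigl => v.
by case rv: (fam_recip c v) => //=; rewrite (family_det1_sign rc rb rv).
Qed.

Lemma real_classes_PSL :
  (#|real_classes (PSLgroup n.+1 F)|%:R : rat) =
  \sum_(nu : multiplicities n.+1 | is_partition nu) (part_h #|F| nu)%:R * psl #|F| nu.
Proof.
have n0 : (0 < n)%N by have := n_even; case: (n).
have SL0 : (#|SL|%:R : rat) != 0 by rewrite pnatr_eq0 -lt0n cardG_gt0.
have Z0 : (#|'Z(SL)%g|%:R : rat) != 0 by rewrite pnatr_eq0 -lt0n cardG_gt0.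
pose G1 := [set c : F | (c ^+ n.+1 == 1) && (c ^+ (n.+1)./2 == 1)].
pose G2 := [set c : F | (c ^+ n.+1 == 1) && (c ^+ (n.+1)./2 != 1)].
have G12 : #|G2| = #|G1| := card_half_roots Fodd h2 isT.
have cardZ : #|'Z(SL)%g| = (#|G1| + #|G1|)%N.
  rewrite center_SL // card_in_imset; last exact: scalar_GL_inj.
  rewrite -{2}G12 -[LHS](cardsID [set c : F | c ^+ (n.+1)./2 == 1]).
  by congr (_ + _)%N; apply: eq_card => c; rewrite !inE // andbC.
apply: (mulIf Z0); apply: (mulIf SL0).
have := card_real_classes_quotient (center_normal SL).
move=> /(congr1 (fun k => k%:R : rat)); rewrite !natrM mulrAC => ->.
rewrite (eq_bigl (fun z => z \in [set scalar_GL n c | c in [set c : F | c ^+ n.+1 == 1]])) =>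
  [|z]; last first.
  by rewrite -center_SL.
rewrite big_imset /=; last exact: scalar_GL_inj.
rewrite natr_sum.
rewrite (eq_bigr (fun c : F => (\sum_(nu | is_partition nu)
    (if reversible nu then (part_h #|F| nu)%:R else 0) *
     \sum_(v : fam nu | fam_recip c v && family_det1 v) 1) * #|SL|%:R)); last first.
  move=> c; rewrite inE => /eqP cn.
  have c0 : c != 0 by apply: contra_eq_neq cn => ->; rewrite expr0n eq_sym oner_eq0.
  rewrite -sum_reversers // natr_sum mulr_suml; apply: eq_bigr => x _.
  by rewrite divfK.
rewrite -mulr_suml; congr (_ * _); rewrite exchange_big mulr_suml; apply: eq_bigr => nu nuP.
(* The central scalars split into two sets of equal size; division by the order of the center, twice
   that size, produces the outer half in [psl]. *)
rewrite -mulr_sumr (bigID (fun c => c ^+ (n.+1)./2 == 1)) /=.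
rewrite (eq_bigr (fun=> ((prod_nqm #|F| nu)%:R + prod_diff #|F| nu) / 2%:R)); last first.
  by move=> c; rewrite inE => /andP[/eqP cn /eqP cn2]; apply: sum_family_square.
rewrite [X in _ + X](eq_bigr (fun=>
  if all_even nu then ((prod_nqm #|F| nu)%:R - prod_diff #|F| nu) / 2%:R else 0)); last first.
  by move=> c; rewrite inE => /andP[/eqP cn cn2]; apply: sum_family_nonsquare.
rewrite (eq_bigl (fun c => c \in G1)) => [|c]; last by rewrite !inE.
rewrite [X in _ + X](eq_bigl (fun c => c \in G2)) => [|c]; last by rewrite !inE.
rewrite !sumr_const G12 cardZ natrD psl_prod_diff // /reversible.
case: (_ || _); last by rewrite !(mul0r, mulr0).
by rewrite -mulrnDl; apply: mul_halves.
Qed.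

End Assembly.

Theorem theorem9p3 (F : finFieldType) (q n : nat)
    (hF : #|F| = q) (hodd : odd q) (h2 : (n`_2 = (q - 1)`_2)%N) :
  (#|real_classes (PSLgroup n F)|%:R : rat)
  = \sum_(nu : multiplicities n | is_partition nu)
      (part_h q nu)%:R * psl q nu.
Proof.
have Fodd : odd #|F| by rewrite hF.
have [p pp pF] := finPcharP F; have [e Fe] := card_pchar pF.
have p_odd : odd p.
  by move: Fodd; rewrite Fe oddX; case: e Fe (finNzRing_gt1 F) => [->|].
(* For [n = 0] the convention [logn 2 0 = 0] would make [q - 1] odd. *)
rewrite -{q hodd}hF in h2 *; case: n h2 => [|n] h2; last exact: real_classes_PSL pF p_odd Fodd h2.
have /negP[] := card_pred_even Fodd.
have := congr1 (logn 2) h2; rewrite !logn_part logn0 => /esym/eqP.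
by rewrite -leqn0 leqNgt -pfactor_dvdn ?card_pred_gt0 // expn1 dvdn2 negbK.
Qed.
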